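(* Let $C=\{c_k\}_{k\in\mathbb{N}}$ be a sequence of real numbers and $m\in\mathbb{N}$, and let $\hat{\mathcal{M}}(C_m)=\hat H_1^{-1}(c_1)\cap\dots\cap\hat H_m^{-1}(c_m)\subset\hat{\mathcal{M}}$, assumed non-empty. On $\hat{\mathcal{M}}(C_m)$, for each $n\in\mathbb{N}$ and each $k=0,1,\dots,m+1$, the vector field $\hat X_n$ is a Hamiltonian vector field for $\hat H_{n+k}$ with respect to $\hat\omega_k$, i.e. $\hat\omega_k(\hat X_n,\,\cdot\,)=d\hat H_{n+k}$ on $\hat{\mathcal{M}}(C_m)$; that is, the set $\bigl(\{\hat H_n\}_{n\in\mathbb{N}},\{\hat\omega_k\}_{k=0}^{m+1}\bigr)$ is a multi-Hamiltonian system on $\hat{\mathcal{M}}(C_m)$ describing the higher modified KdV flows $\hat\gamma_t=\hat X_n$.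
   Context: All maps are smooth, $\mathbb{N}=\{1,2,\dots\}$, $S^1=\mathbb{R}/2\pi\mathbb{Z}$, subscript $s$ is the derivative in $s\in S^1$, $D_s=\partial/\partial s$. Space of curves. $\mathbb{E}^2$ is the Euclidean plane with inner product $\langle\cdot,\cdot\rangle$, and $\hat{\mathcal{M}}=\{\hat\gamma:S^1\to\mathbb{E}^2 : \langle\hat\gamma_s,\hat\gamma_s\rangle\equiv1\}$. With $T=\hat\gamma_s$ and $N$ the left-oriented unit normal, the curvature $\hat\kappa$ is defined by $T_s=\hat\kappa N$. $T_{\hat\gamma}\hat{\mathcal{M}}=\{\lambda T+\mu N : \lambda,\mu:S^1\to\mathbb{R},\ \lambda_s=\hat\kappa\mu\}$. Under $\hat\gamma_t=\lambda T+\mu N$ one has $\hat\kappa_t=\mu_{ss}+\hat\kappa\lambda_s+\hat\kappa_s\lambda=\hat\Omega(2\mu)$, where $\hat\Omega=\frac12(D_s^2+\hat\kappa^2+\hat\kappa_sD_s^{-1}\hat\kappa)$ and $D_s^{-1}(\hat\kappa\mu)=\lambda$. For polynomials in $\hat\kappa$ and its derivatives, $D_s^{-1}$ denotes the antiderivative that is a polynomial in $\hat\kappa,\hat\kappa_s,\dots$ without constant term. Hamiltonians. $\hat H_m=\int_{S^1}\hat h_m(\hat\kappa,\hat\kappa_s,\dots)\,ds$ is the standard series of conserved quantities of the mKdV hierarchy $\hat\kappa_t=\hat\Omega^n\hat\kappa_s$: $\hat h_m$ is a polynomial in $\hat\kappa$ and its derivatives, weighted homogeneous of weight $2m$ when the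 $j$-th derivative of $\hat\kappa$ has weight $j+1$, with $\hat\Omega^n\hat\kappa_s=2D_s\frac{\delta\hat H_{n+1}}{\delta\hat\kappa}$ for $n\ge0$, where $\frac{\delta \hat H}{\delta\hat\kappa}=\frac{\partial \hat h}{\partial\hat\kappa}-D_s\frac{\partial\hat h}{\partial\hat\kappa_s}+D_s^2\frac{\partial\hat h}{\partial\hat\kappa_{ss}}-\cdots$. E.g. $\hat h_1=\frac14\hat\kappa^2$, $\hat h_2=\frac1{32}\hat\kappa^4-\frac18\hat\kappa_s^2$. They are regarded as functions on $\hat{\mathcal{M}}$. Vector fields. $(\hat X_n)_{\hat\gamma}=\frac12\bigl(D_s^{-1}(\hat\kappa\hat\Omega^{n-1}\hat\kappa_s)\bigr)T+\frac12(\hat\Omega^{n-1}\hat\kappa_s)N$, $n\in\mathbb{N}$; the flow $\hat\gamma_t=\hat X_n$ is the $n$th mKdV flow, under which $\hat\kappa_t=\hat\Omega^n\hat\kappa_s$. The $\hat X_n$ are tangent to $\hat{\mathcal{M}}(C_m)$. Geometric Miura transformation. Identify $\mathbb{E}^2$ with $\mathbb{C}$. Let $\mathcal{M}^{\mathbb{C}}=\{\gamma:S^1\to\mathbb{C}^2\setminus\{0\} : \det\begin{pmatrix}\gamma\\ \gamma_s\end{pmatrix}=1\}$, with curvature $\kappa$ given by $\gamma_{ss}=-\kappa\gamma$ and tangent vectors $-\frac12\alpha_s\gamma+\alpha\gamma_s$, $\alpha:S^1\to\mathbb{C}$, and put $\Omega=\frac12D_s^2+2\kappa+\kappa_sD_s^{-1}$.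 Define $\Phi:\hat{\mathcal{M}}\to\mathcal{M}^{\mathbb{C}}$ by $\Phi(\hat\gamma)=(-\hat\gamma_s)^{-1/2}(\hat\gamma,1)$ (continuous branch of the root; the curvature and the tangent functions $\alpha$ below are periodic in any case). The curvature of $\Phi(\hat\gamma)$ is $\kappa=\frac{\sqrt{-1}}2\hat\kappa_s+\frac14\hat\kappa^2$, and $\Phi_*(\lambda T+\mu N)=-\frac12\alpha_s\gamma+\alpha\gamma_s$ with $\gamma=\Phi(\hat\gamma)$, $\alpha=\lambda+\sqrt{-1}\mu$. KdV conserved quantities. $H_m=\int_{S^1}h_m\,ds$ on $\mathcal{M}^{\mathbb{C}}$ are the KdV conserved quantities, with $h_1=\kappa$ and $D_s\frac{\delta H_{n+2}}{\delta\kappa}=\Omega^n\kappa_s$ ($n\ge0$; $h_m$ homogeneous of weight $2m$ when the $j$-th derivative of $\kappa$ has weight $j+2$); then $\hat H_m=\Phi^*H_m$, so $\Phi$ maps $\hat{\mathcal{M}}(C_m)$ to $\mathcal{M}^{\mathbb{C}}(C_m)=H_1^{-1}(c_1)\cap\dots\cap H_m^{-1}(c_m)$. Forms. $T_{\hat\gamma}\hat{\mathcal{M}}(C_m)=\{X\in T_{\hat\gamma}\hat{\mathcal{M}} : d\hat H_1(X)=\dots=d\hat H_m(X)=0\}$. For $X=\lambda T+\mu N$, $Y=\tilde\lambda T+\tilde\mu N$: on $\hat{\mathcal{M}}$, $\hat\omega_0(X,Y)=\int_{S^1}\langle D_sX,Y\rangle ds=\int_{S^1}(\hat\kappa\lambda+\mu_s)\tilde\mu\,ds$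 and $\hat\omega_1(X,Y)=\frac12\int_{S^1}\langle D_sX,D_s^2Y\rangle ds=\int_{S^1}(\hat\kappa\lambda+\mu_s)\hat\Omega\tilde\mu\,ds$ (with $D_s^{-1}(\hat\kappa\tilde\mu)=\tilde\lambda$). On $\hat{\mathcal{M}}(C_j)$ ($j\in\mathbb{N}$), $\hat\omega_{j+1}=\Phi^*\omega_{j+1}$, where $\omega_{j+1}(-\frac12\alpha_s\gamma+\alpha\gamma_s,-\frac12\beta_s\gamma+\beta\gamma_s)=\int_{S^1}\alpha\,\Omega^{j+1}\beta_s\,ds$ on $\mathcal{M}^{\mathbb{C}}(C_j)$; explicitly $\hat\omega_{j+1}(X,Y)=\int_{S^1}(\lambda+\sqrt{-1}\mu)\,\Omega^{j+1}(\tilde\lambda+\sqrt{-1}\tilde\mu)_s\,ds$. Here $D_s^{-1}\beta_s=\beta$, and for tangent vectors to $\mathcal{M}^{\mathbb{C}}(C_j)$ the functions $\Omega\beta_s,\dots,\Omega^{j+1}\beta_s$ are well defined on $S^1$ up to constants of integration, whose choice does not affect $\omega_{j+1}$. On $\hat{\mathcal{M}}(C_m)$ the forms $\hat\omega_0,\dots,\hat\omega_m$ are the restrictions of $\hat\omega_0,\hat\omega_1$ and of $\hat\omega_{j+1}$ from $\hat{\mathcal{M}}(C_j)$, $1\le j\le m-1$. A presymplectic form is a closed (possibly degenerate) 2-form; ''multi-Hamiltonian system'' means that the $\hat\omega_k$ are presymplectic forms and each $\hat X_n$ is Hamiltonian for $\hat H_{n+k}$ with respect to every $\hat\omega_k$.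 *)

(* Defs.v *)
(* Stdlib reals with Coquelicot. *)
From Stdlib Require Import Reals List Arith ClassicalEpsilon.
From Coquelicot Require Import Coquelicot.
Open Scope R_scope.

(** * Loops in the plane

   The plane is identified with [C].  A map on the circle R/2piZ is a function
   on R which is 2pi-periodic. *)

Definition CDerive (f : R -> C) : R -> C :=
  fun s => (Derive (fun x => fst (f x)) s, Derive (fun x => snd (f x)) s).

Definition CInt (f : R -> C) (a b : R) : C :=
  (RInt (fun x => fst (f x)) a b, RInt (fun x => snd (f x)) a b).

Definition smooth (f : R -> C) : Prop :=
  forall (n : nat) (s : R),
    ex_derive_n (fun x => fst (f x)) n s /\ ex_derive_n (fun x => snd (f x)) n s.

Definition loop (f : R -> C) : Prop :=
  smooth f /\ forall s, f (s + 2 * PI) = f s.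

Definition dot (z w : C) : R := fst z * fst w + snd z * snd w.

Definition tangent_of (g : R -> C) : R -> C := CDerive g.
Definition normal_of (g : R -> C) : R -> C := fun s => (Ci * CDerive g s)%C.

(* On unit-speed curves this is the function k with T_s = k N.  The same
   expression makes sense for every plane curve. *)
Definition curvature (g : R -> C) : R -> R :=
  fun s => dot (CDerive (tangent_of g) s) (normal_of g s).

Definition Mhat (g : R -> C) : Prop :=
  loop g /\ forall s, dot (CDerive g s) (CDerive g s) = 1.

(* X = lambda T + mu N *)
Definition lam (g X : R -> C) : R -> R := fun s => dot (X s) (tangent_of g s).
Definition mu (g X : R -> C) : R -> R := fun s => dot (X s) (normal_of g s).

Definition tangent_Mhat (g X : R -> C) : Prop :=
  loop X /\ forall s, Derive (lam g X) s = curvature g s * mu g X s.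

(** * Differential polynomials

   Real polynomials in the jet variables k_0 = k, k_1 = k_s, k_2 = k_ss, ...
   They are represented by terms; since R is infinite, two terms denote the same
   polynomial if and only if they have the same value at every jet ([dp_eq]). *)

Inductive dpoly : Type :=
  | DConst (a : R)
  | DVar (j : nat)
  | DAdd (p q : dpoly)
  | DMul (p q : dpoly).

Fixpoint dp_eval (p : dpoly) (x : nat -> R) : R :=
  match p with
  | DConst a => a
  | DVar j => x j
  | DAdd p q => dp_eval p x + dp_eval q x
  | DMul p q => dp_eval p x * dp_eval q x
  end.

Definition dp_eq (p q : dpoly) : Prop := forall x, dp_eval p x = dp_eval q x.

Fixpoint dp_D (p : dpoly) : dpoly :=
  match p with
  | DConst _ => DConst 0
  | DVar j => DVar (S j)
  | DAdd p q => DAdd (dp_D p) (dp_D q)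
  | DMul p q => DAdd (DMul (dp_D p) q) (DMul p (dp_D q))
  end.

Fixpoint dp_partial (i : nat) (p : dpoly) : dpoly :=
  match p with
  | DConst _ => DConst 0
  | DVar j => DConst (if Nat.eqb i j then 1 else 0)
  | DAdd p q => DAdd (dp_partial i p) (dp_partial i q)
  | DMul p q => DAdd (DMul (dp_partial i p) q) (DMul p (dp_partial i q))
  end.

(* No variable k_j with j >= [dp_order p] occurs in p. *)
Fixpoint dp_order (p : dpoly) : nat :=
  match p with
  | DConst _ => 0
  | DVar j => S j
  | DAdd p q | DMul p q => Nat.max (dp_order p) (dp_order q)
  end.

(* The variational derivative: sum over j of (-1)^j D^j (dp/dk_j). *)
Definition dp_euler (p : dpoly) : dpoly :=
  fold_right DAdd (DConst 0)
    (map (fun j => DMul (DConst ((-1) ^ j)) (Nat.iter j dp_D (dp_partial j p)))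
         (seq 0 (dp_order p))).

(* Weighted homogeneity of weight w, the variable k_j having weight j + 1. *)
Definition dp_homogeneous (w : nat) (p : dpoly) : Prop :=
  forall (t : R) (x : nat -> R),
    dp_eval p (fun j => t ^ (S j) * x j) = t ^ w * dp_eval p x.

(* The polynomial antiderivative without constant term.  It is unique, as a
   polynomial, when it exists, because D p = 0 only for constant p. *)
Definition dp_Dinv (p : dpoly) : dpoly :=
  epsilon (inhabits (DConst 0))
    (fun q => dp_eq (dp_D q) p /\ dp_eval q (fun _ => 0) = 0).

(* (1/2) (D^2 + k^2 + k_s D^-1 k) *)
Definition dp_Omegahat (p : dpoly) : dpoly :=
  DMul (DConst (/ 2))
    (DAdd (DAdd (dp_D (dp_D p)) (DMul (DMul (DVar 0) (DVar 0)) p))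
          (DMul (DVar 1) (dp_Dinv (DMul (DVar 0) p)))).

Definition mkdv_rhs (n : nat) : dpoly := Nat.iter n dp_Omegahat (DVar 1).

(* [h i] is the density with index i; the index 0 is not used. *)
Definition mkdv_densities (h : nat -> dpoly) : Prop :=
  (forall i, (1 <= i)%nat -> dp_homogeneous (2 * i) (h i)) /\
  (forall n, dp_eq (mkdv_rhs n) (DMul (DConst 2) (dp_D (dp_euler (h (S n)))))).

(** * Hamiltonians, level sets and vector fields *)

Definition dp_on (p : dpoly) (g : R -> C) : R -> R :=
  fun s => dp_eval p (fun j => Derive_n (curvature g) j s).

Definition Hhat (p : dpoly) (g : R -> C) : R := RInt (dp_on p g) 0 (2 * PI).

(* The formula for [curvature] extends [Hhat p] to the linear space of all
   loops; its differential on [Mhat] is the restriction to the tangent vectors of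
   [Mhat] of the directional derivative of this extension. *)
Definition dHhat (p : dpoly) (g X : R -> C) : R :=
  Derive (fun e => Hhat p (fun s => (g s + RtoC e * X s)%C)) 0.

Definition level (h : nat -> dpoly) (c : nat -> R) (m : nat) (g : R -> C) : Prop :=
  Mhat g /\ forall i, (1 <= i <= m)%nat -> Hhat (h i) g = c i.

Definition tangent_level (h : nat -> dpoly) (m : nat) (g X : R -> C) : Prop :=
  tangent_Mhat g X /\ forall i, (1 <= i <= m)%nat -> dHhat (h i) g X = 0.

(* For n >= 1. *)
Definition Xhat (n : nat) (g : R -> C) : R -> C :=
  fun s =>
    (RtoC (/ 2 * dp_on (dp_Dinv (DMul (DVar 0) (mkdv_rhs (n - 1)))) g s) * tangent_of g s
     + RtoC (/ 2 * dp_on (mkdv_rhs (n - 1)) g s) * normal_of g s)%C.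

(** * The forms

   The KdV operator (1/2) D^2 + 2 k + k_s D^-1 applied to b_s, with
   D^-1 b_s = b. *)

Definition Omega (k b : R -> C) : R -> C :=
  fun s => (RtoC (/ 2) * CDerive (CDerive (CDerive b)) s
            + RtoC 2 * k s * CDerive b s + CDerive k s * b s)%C.

(* [kdv_prim a k b i] is an antiderivative of Omega^i b_s: b itself for i = 0,
   and the one with value [a i] at 0 for i >= 1.  Hence Omega^(i+1) b_s is
   [Omega k (kdv_prim a k b i)]. *)
Fixpoint kdv_prim (a : nat -> C) (k b : R -> C) (i : nat) : R -> C :=
  match i with
  | O => b
  | S i' => fun s => (a i + CInt (Omega k (kdv_prim a k b i')) 0 s)%C
  end.

(* The integral of al * Omega^(j+1) be_s over the circle. *)
Definition omega_kdv (a : nat -> C) (j : nat) (k al be : R -> C) : C :=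
  CInt (fun s => (al s * Omega k (kdv_prim a k be j) s)%C) 0 (2 * PI).

(* The curvature (i/2) k_s + k^2/4 of the image of g under the geometric Miura
   transformation, and the function lambda + i mu which describes the image of
   the tangent vector lambda T + mu N. *)
Definition miura_curvature (g : R -> C) : R -> C :=
  fun s => (/ 4 * curvature g s ^ 2, / 2 * Derive (curvature g) s).

Definition miura_tangent (g X : R -> C) : R -> C := fun s => (lam g X s, mu g X s).

(* A choice of the integration constants for each base point g and each second
   argument Y. *)
Definition constants : Type := (R -> C) -> (R -> C) -> nat -> C.

(* The forms of index k >= 2 are pullbacks of complex-valued forms, whence the
   type [C]; see the first clause of [presymplectic]. *)
Definition omegahat (a : constants) (k : nat) (g X Y : R -> C) : C :=
  match k with
  | O => RtoC (RInt (fun s => dot (CDerive X s) (Y s)) 0 (2 * PI))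
  | S O => RtoC (/ 2 * RInt (fun s => dot (CDerive X s) (CDerive (CDerive Y) s)) 0 (2 * PI))
  | S j => omega_kdv (a g Y) j (miura_curvature g) (miura_tangent g X) (miura_tangent g Y)
  end.

(** * Smooth families of curves and closed forms

   A point of R^3 x R is written ((u0, u1, u2), s). *)

Definition pt : Type := ((R * R * R) * R)%type.

Definition shift (i : nat) (p : pt) (e : R) : pt :=
  match p with
  | ((x, y, z), s) =>
      match i with
      | 0%nat => ((x + e, y, z), s)
      | 1%nat => ((x, y + e, z), s)
      | 2%nat => ((x, y, z + e), s)
      | _ => ((x, y, z), s + e)
      end
  end.

Definition pd (i : nat) (f : pt -> R) : pt -> R :=
  fun p => Derive (fun e => f (shift i p e)) 0.

(* Iterated partial derivatives of all orders exist and are continuous. *)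
Definition smooth_pt (f : pt -> R) : Prop :=
  forall (l : list nat) (p : pt),
    continuous (fold_right pd f l) p /\
    forall i, ex_derive (fun e => fold_right pd f l (shift i p e)) 0.

(* Smooth maps from R^3 into a set M of curves. *)
Definition plot (M : (R -> C) -> Prop) (G : pt -> C) : Prop :=
  smooth_pt (fun p => fst (G p)) /\ smooth_pt (fun p => snd (G p)) /\
  forall u, M (fun s => G (u, s)).

Definition velocity (G : pt -> C) (i : nat) (u : R * R * R) : R -> C :=
  fun s => (pd i (fun p => fst (G p)) (u, s), pd i (fun p => snd (G p)) (u, s)).

(* The coefficient of du_i /\ du_j in the pullback of w by G, as a function on
   R^3 x R which does not depend on s. *)
Definition pullback (w : (R -> C) -> (R -> C) -> (R -> C) -> C) (G : pt -> C)
    (i j : nat) : pt -> R :=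
  fun p => fst (w (fun s => G (fst p, s)) (velocity G i (fst p)) (velocity G j (fst p))).

(* w is a closed 2-form on the set M of curves, with tangent spaces T.  M need
   not be a manifold, so smoothness and dw = 0 are understood through the
   pullbacks by the smooth maps from R^3 into M. *)
Definition presymplectic (M : (R -> C) -> Prop) (T : (R -> C) -> (R -> C) -> Prop)
    (w : (R -> C) -> (R -> C) -> (R -> C) -> C) : Prop :=
  (forall g X Y, M g -> T g X -> T g Y -> snd (w g X Y) = 0) /\
  (forall g X X' Y (r : R), M g -> T g X -> T g X' -> T g Y ->
     w g (fun s => (RtoC r * X s + X' s)%C) Y = (RtoC r * w g X Y + w g X' Y)%C) /\
  (forall g X Y, M g -> T g X -> T g Y -> w g Y X = (- w g X Y)%C) /\
  (forall G, plot M G ->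
     (forall i j, (i < 3)%nat -> (j < 3)%nat -> smooth_pt (pullback w G i j)) /\
     (forall p, pd 0 (pullback w G 1 2) p + pd 1 (pullback w G 2 0) p
                + pd 2 (pullback w G 0 1) p = 0)).

Definition vector_field (M : (R -> C) -> Prop) (T : (R -> C) -> (R -> C) -> Prop)
    (X : (R -> C) -> (R -> C)) : Prop :=
  forall g, M g -> T g (X g).

(* w (X, .) = dF on M *)
Definition hamiltonian_for (M : (R -> C) -> Prop) (T : (R -> C) -> (R -> C) -> Prop)
    (w : (R -> C) -> (R -> C) -> (R -> C) -> C) (dF : (R -> C) -> (R -> C) -> R)
    (X : (R -> C) -> (R -> C)) : Prop :=
  vector_field M T X /\
  forall g Y, M g -> T g Y -> w g (X g) Y = RtoC (dF g Y).

(* Main.v *)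
(* Along a curve with curvature k, the tangent vectors lambda T + mu N are the pairs
   with lambda_s = k mu, and phi := mu_s + k lambda is the variation of the tangent
   angle.  Writing P for mu |-> phi, the recursion operator is D P / 2, and both D and P
   are skew for integration over the circle.  Moving the factors D and P across one at a
   time shows that int phi_X Omegahat^k mu_Y is antisymmetric in X and Y, whatever
   integration constants occur in the powers of Omegahat.  Applied to the translation
   field T, whose iterates are the fields Xhat_n, this gives at once the existence of
   periodic primitives on the level sets, the independence of the constants and the
   Hamilton equations, because dHhat_i (X) = - int phi_X Omegahat^i (T).  The operator
   B = k + i D satisfies Omega B = B Omegahat, which turns the forms pulled back from the
   KdV side into int phi_X Omegahat^k mu_Y.

   For closedness, the iterates are collected in a power series in z.  Then (p, mu, phi)
   satisfies a linear equation A_s = [U, A] + inhomogeneity in a copy of so(2,1), as the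
   variation of a frame with spectral parameter does; dA + A /\ A solves the homogeneous
   equation, and the invariant quadratic form exhibits d omegahat_k as the integral of a
   total derivative. *)
Require Import Defs.
From Stdlib Require Import Reals.
From Stdlib Require Import Lra Lia FunctionalExtensionality ClassicalEpsilon List Arith
  Compare_dec Ring.
From Coquelicot Require Import Coquelicot.
Open Scope R_scope.

(** * Smooth functions of three parameters and one arc length *)

(** Periodicity is the obstacle. On the common level set of the first [m] Hamiltonians whole chains
    are known to be periodic only up to index [m], while the forms go up to index [m + 1]. This is
    consistent because the function mu of index [m + 1] is half the derivative of a periodic
    function, and its primitive p never enters the integrations by parts. In the proof of closedness
    one derivative is moved onto the other factor, which lowers the index by one and brings in the
    parameter derivatives of the curvature; these form a gradient, so their own curl vanishes.

    The variable z is formal. The coefficient of z^b in a product involves only coefficients up to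
    b, so periodicity up to a bound suffices and no question of convergence arises. The forms of
    index 0 and 1 are treated separately: in Cartesian coordinates they have constant coefficients.

    Closedness is tested on functions of three parameters and s, so all integrals must be shown to
    depend smoothly on parameters. One criterion serves for this: a class of functions that is
    stable under all partial derivatives. *)

Lemma shift_shift i p a b : shift i (shift i p a) b = shift i p (a + b).
Proof.
  destruct p as [[[x y] z] s]; destruct i as [|[|[|i]]]; simpl; now rewrite Rplus_assoc.
Qed.

Lemma shift_0 i p : shift i p 0 = p.
Proof.
  destruct p as [[[x y] z] s]; destruct i as [|[|[|i]]]; simpl; now rewrite Rplus_0_r.
Qed.

Lemma shift_comm i j p a b : shift i (shift j p a) b = shift j (shift i p b) a.
Proof.
  destruct p as [[[x y] z] s];
  destruct i as [|[|[|i]]]; destruct j as [|[|[|j]]]; simpl; try reflexivity;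
  now rewrite Rplus_assoc, (Rplus_comm a b), <- Rplus_assoc.
Qed.

Lemma Derive_shift (f : pt -> R) i p a :
  Derive (fun e => f (shift i p e)) a = pd i f (shift i p a).
Proof.
  unfold pd. unfold Derive. f_equal. apply Lim_ext. intros y.
  rewrite !shift_shift. rewrite Rplus_0_r, Rplus_0_l. reflexivity.
Qed.

Lemma ex_derive_shift (f : pt -> R) i p a :
  ex_derive (fun e => f (shift i (shift i p a) e)) 0 ->
  ex_derive (fun e => f (shift i p e)) a.
Proof.
  intros H.
  apply (ex_derive_ext (fun e => (fun e => f (shift i (shift i p a) e)) (e - a))).
  - intros e. simpl. rewrite shift_shift. f_equal. f_equal. ring.
  - apply (ex_derive_comp (fun e => f (shift i (shift i p a) e)) (fun e => e - a)).
    + replace (a - a) with 0 by ring. exact H.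
    + auto_derive. exact I.
Qed.

(** A coinduction principle: iterated partial derivatives of a member stay in the class, so
    smoothness is reduced to one derivative at a time. The closure properties below rest on finding
    a class stable under [pd]. *)
Lemma smooth_coind (C : (pt -> R) -> Prop) :
  (forall f, C f -> (forall p, continuous f p) /\
     (forall i p, ex_derive (fun e => f (shift i p e)) 0) /\ (forall i, C (pd i f))) ->
  forall f, C f -> smooth_pt f.
Proof.
  intros H f Hf l p.
  assert (Hl : C (fold_right pd f l)).
  { induction l as [|i l IH]; simpl; [exact Hf|]. apply H. exact IH. }
  destruct (H _ Hl) as [H1 [H2 _]]. split; [apply H1|]. intros i. apply H2.
Qed.

Lemma smooth_continuous f p : smooth_pt f -> continuous f p.
Proof. intros H. apply (H nil p). Qed.

Lemma smooth_ex f i p : smooth_pt f -> ex_derive (fun e => f (shift i p e)) 0.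
Proof. intros H. apply (H nil p). Qed.

Lemma smooth_ex_at f i p a : smooth_pt f -> ex_derive (fun e => f (shift i p e)) a.
Proof. intros H. apply ex_derive_shift. apply (H nil). Qed.

Lemma smooth_pd f i : smooth_pt f -> smooth_pt (pd i f).
Proof.
  intros H l p. specialize (H (l ++ i :: nil) p).
  rewrite fold_right_app in H. exact H.
Qed.

Lemma is_derive_pd f i p : smooth_pt f -> is_derive (fun e => f (shift i p e)) 0 (pd i f p).
Proof. intros H. apply Derive_correct. now apply smooth_ex. Qed.

Lemma pd_const c i : pd i (fun _ => c) = fun _ => 0.
Proof. extensionality p. unfold pd. apply Derive_const. Qed.

Lemma smooth_const c : smooth_pt (fun _ => c).
Proof.
  apply (smooth_coind (fun f => exists c, f = fun _ => c)); [|now exists c].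
  intros f [a ->]. repeat split.
  - intros p. apply continuous_const.
  - intros i p. apply ex_derive_const.
  - intros i. exists 0. apply pd_const.
Qed.

Lemma pd_plus f g i : smooth_pt f -> smooth_pt g ->
  pd i (fun p => f p + g p) = fun p => pd i f p + pd i g p.
Proof.
  intros Hf Hg. extensionality p. unfold pd.
  apply Derive_plus; now apply smooth_ex.
Qed.

Lemma pd_mult f g i : smooth_pt f -> smooth_pt g ->
  pd i (fun p => f p * g p) = fun p => pd i f p * g p + f p * pd i g p.
Proof.
  intros Hf Hg. extensionality p. unfold pd.
  rewrite Derive_mult by (now apply smooth_ex). now rewrite shift_0.
Qed.

Lemma smooth_plus f g : smooth_pt f -> smooth_pt g -> smooth_pt (fun p => f p + g p).
Proof.
  intros Hf Hg.
  apply (smooth_coind (fun h => exists f g, smooth_pt f /\ smooth_pt g /\ h = fun p => f p + g p)).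
  2: now exists f, g.
  clear. intros h (f & g & Hf & Hg & ->). repeat split.
  - intros p. apply (continuous_plus (V:=R_NormedModule)); now apply smooth_continuous.
  - intros i p. apply (ex_derive_plus (V:=R_NormedModule)
      (fun e => f (shift i p e)) (fun e => g (shift i p e))); now apply smooth_ex.
  - intros i. exists (pd i f), (pd i g). repeat split; try now apply smooth_pd.
    now apply pd_plus.
Qed.

(** Single products are not stable under [pd], because the product rule produces sums; these finite
    sums are. *)
Inductive sum_of_products : (pt -> R) -> Prop :=
| sop_mult f g : smooth_pt f -> smooth_pt g -> sum_of_products (fun p => f p * g p)
| sop_plus f g : sum_of_products f -> sum_of_products g -> sum_of_products (fun p => f p + g p).

Lemma smooth_mult f g : smooth_pt f -> smooth_pt g -> smooth_pt (fun p => f p * g p).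
Proof.
  intros Hf Hg. apply (smooth_coind sum_of_products); [|now constructor].
  clear. intros h Hh.
  induction Hh as [f g Hf Hg | f g _ [IHf1 [IHf2 IHf3]] _ [IHg1 [IHg2 IHg3]]]; repeat split.
  - intros p. apply (continuous_mult (K:=R_AbsRing)); now apply smooth_continuous.
  - intros i p. apply (ex_derive_mult
      (fun e => f (shift i p e)) (fun e => g (shift i p e))); now apply smooth_ex.
  - intros i. rewrite pd_mult by assumption.
    apply (sop_plus (fun p => pd i f p * g p) (fun p => f p * pd i g p));
      constructor; trivial; now apply smooth_pd.
  - intros p. now apply (continuous_plus (V:=R_NormedModule)).
  - intros i p. apply (ex_derive_plus (V:=R_NormedModule)
      (fun e => f (shift i p e)) (fun e => g (shift i p e))); auto.
  - intros i. replace (pd i (fun p => f p + g p)) with (fun p => pd i f p + pd i g p).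
    + now constructor.
    + extensionality p. unfold pd. symmetry. apply Derive_plus; auto.
Qed.

Lemma smooth_scal c f : smooth_pt f -> smooth_pt (fun p => c * f p).
Proof. intros H. apply (smooth_mult (fun _ => c)); [apply smooth_const | exact H]. Qed.

Lemma smooth_opp f : smooth_pt f -> smooth_pt (fun p => - f p).
Proof.
  intros H. replace (fun p => - f p) with (fun p => (-1) * f p) by (extensionality p; ring).
  now apply smooth_scal.
Qed.

Lemma smooth_minus f g : smooth_pt f -> smooth_pt g -> smooth_pt (fun p => f p - g p).
Proof. intros Hf Hg. apply smooth_plus; [exact Hf | now apply smooth_opp]. Qed.

Lemma pd_scal c f i : pd i (fun p => c * f p) = fun p => c * pd i f p.
Proof. extensionality p. unfold pd. apply (Derive_scal (fun e => f (shift i p e))). Qed.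

Lemma pd_opp f i : pd i (fun p => - f p) = fun p => - pd i f p.
Proof. extensionality p. unfold pd. apply (Derive_opp (fun e => f (shift i p e))). Qed.

Lemma pd_minus f g i : smooth_pt f -> smooth_pt g ->
  pd i (fun p => f p - g p) = fun p => pd i f p - pd i g p.
Proof.
  intros Hf Hg. extensionality p. unfold pd.
  apply Derive_minus; now apply smooth_ex.
Qed.

(** Joint continuity in two directions, as required by Schwarz's theorem and by differentiation
    under the integral sign. *)
Lemma continuity_2d_shift f i j p x y : smooth_pt f ->
  continuity_2d_pt (fun a b => f (shift i (shift j p b) a)) x y.
Proof.
  intros Hf. apply continuity_2d_pt_filterlim.
  set (h := fun z : R * R => shift i (shift j p (snd z)) (fst z)).
  assert (Hh : continuous h (x, y)).
  { unfold h.
    assert (C0 : forall a : R, continuous (fun _ : R * R => a) (x, y)).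
    { intros a. apply continuous_const. }
    assert (C1 : continuous (fun z : R * R => fst z) (x, y)) by apply continuous_fst.
    assert (C2 : continuous (fun z : R * R => snd z) (x, y)) by apply continuous_snd.
    assert (CP : forall (a b : R * R -> R), continuous a (x, y) -> continuous b (x, y) ->
      continuous (fun z => a z + b z) (x, y)).
    { intros a b Ha Hb. now apply (continuous_plus (V:=R_NormedModule) a b). }
    assert (CC : forall (a b c d : R * R -> R), continuous a (x, y) -> continuous b (x, y) ->
      continuous c (x, y) -> continuous d (x, y) ->
      continuous (fun z => (a z, b z, c z, d z)) (x, y)).
    { intros a b c d Ha Hb Hc Hd.
      apply (continuous_comp_2 (fun z => (a z, b z, c z)) d pair).
      - apply (continuous_comp_2 (fun z => (a z, b z)) c pair).
        + apply (continuous_comp_2 a b pair); trivial. apply (continuous_ext (fun z => z));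
            [now intros [? ?] | apply continuous_id].
        + exact Hc.
        + apply (continuous_ext (fun z => z)); [now intros [? ?] | apply continuous_id].
      - exact Hd.
      - apply (continuous_ext (fun z => z)); [now intros [? ?] | apply continuous_id]. }
    destruct p as [[[u v] w] s].
    destruct i as [|[|[|i]]]; destruct j as [|[|[|j]]]; simpl; apply CC; auto. }
  assert (Hc : continuous (fun z : R * R => f (h z)) (x, y)).
  { apply (continuous_comp h f); [exact Hh | now apply smooth_continuous]. }
  exact Hc.
Qed.

Lemma pd_comm f i j : smooth_pt f -> pd i (pd j f) = pd j (pd i f).
Proof.
  intros Hf. extensionality p.
  pose (F := fun a b => f (shift i (shift j p b) a)).
  assert (E1 : forall a b, Derive (fun z => F z b) a = pd i f (shift i (shift j p b) a)).
  { intros a b. unfold F. apply Derive_shift. }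
  assert (E2 : forall a b, Derive (fun z => F a z) b = pd j f (shift i (shift j p b) a)).
  { intros a b. unfold F. rewrite shift_comm. rewrite <- Derive_shift.
    apply Derive_ext. intros t. now rewrite shift_comm. }
  assert (E3 : forall a b, Derive (fun z => Derive (fun t => F z t) b) a
     = pd i (pd j f) (shift i (shift j p b) a)).
  { intros a b. rewrite <- Derive_shift. apply Derive_ext. intros t. apply E2. }
  assert (E4 : forall a b, Derive (fun z => Derive (fun t => F t z) a) b
     = pd j (pd i f) (shift i (shift j p b) a)).
  { intros a b. rewrite shift_comm, <- Derive_shift. apply Derive_ext. intros t.
    rewrite E1. now rewrite shift_comm. }
  pose proof (E3 0 0) as E30. pose proof (E4 0 0) as E40.
  rewrite !shift_0 in E30, E40. rewrite <- E30, <- E40.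
  apply (Schwarz F).
  - exists (mkposreal 1 Rlt_0_1). intros a b _ _. repeat split.
    + apply (smooth_ex_at f i (shift j p b) a Hf).
    + apply (ex_derive_ext (fun z => f (shift j (shift i p a) z))).
      { intros t. unfold F. now rewrite shift_comm. }
      now apply smooth_ex_at.
    + apply (ex_derive_ext (fun z => pd j f (shift i (shift j p b) z))).
      { intros t. now rewrite E2. }
      now apply smooth_ex_at, smooth_pd.
    + apply (ex_derive_ext (fun z => pd i f (shift j (shift i p a) z))).
      { intros t. rewrite E1. now rewrite shift_comm. }
      now apply smooth_ex_at, smooth_pd.
  - eapply continuity_2d_pt_ext; [intros; symmetry; apply E3|].
    now apply continuity_2d_shift, smooth_pd, smooth_pd.
  - eapply continuity_2d_pt_ext; [intros; symmetry; apply E4|].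
    now apply continuity_2d_shift, smooth_pd, smooth_pd.
Qed.

(** * Primitives and circle integrals depending on parameters *)

Lemma locally_uniform_in_last (f : pt -> R) (u : R * R * R) (A B : R) (eps : posreal) :
  (forall p, continuous f p) ->
  exists d : posreal, forall v : R * R * R, ball u d v -> forall t : R, A <= t <= B ->
    Rabs (f (v, t) - f (u, t)) < eps.
Proof.
  intros Hf.
  assert (H : forall t : R, exists d : posreal, forall q : pt, ball (u, t) d q ->
            Rabs (f q - f (u, t)) < pos_div_2 eps).
  { intros t. specialize (Hf (u, t)). apply filterlim_locally with (eps := pos_div_2 eps) in Hf.
    destruct Hf as [d Hd]. exists d. exact Hd. }
  pose (delta (t : R) := proj1_sig (constructive_indefinite_description _ (H t))).
  assert (Hdelta : forall (t : R) (q : pt), ball (u, t) (delta t) q ->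
            Rabs (f q - f (u, t)) < pos_div_2 eps).
  { intros t. unfold delta. apply proj2_sig. }
  (* Every [t] in [[A, B]] lies near a centre [t0] whose radius is at least [d]; comparing both
     values with the one at [t0] costs half of [eps] twice. The centre is supplied under a double
     negation. *)
  destruct (compactness_value_1d A B delta) as [d Hd].
  exists d. intros v Hv t Ht.
  destruct (NNPP _ (Hd t Ht)) as [t0 [_ [H1 H2]]].
  assert (Hb : ball t0 (delta t0) t) by exact H1.
  assert (G1 := Hdelta t0 (v, t) (conj (ball_le _ _ _ H2 _ Hv) Hb)).
  assert (G2 := Hdelta t0 (u, t) (conj (ball_center _ _) Hb)).
  simpl in G1, G2. apply Rabs_def2 in G1, G2. apply Rabs_def1. all: lra.
Qed.

Lemma continuous_slice f u s : smooth_pt f -> continuous (fun t => f (u, t)) s.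
Proof.
  intros Hf. apply (continuous_comp_2 (fun _ => u) (fun t => t) (fun v t => f (v, t))).
  - apply continuous_const.
  - apply continuous_id.
  - apply (continuous_ext f); [now intros [? ?] | now apply smooth_continuous].
Qed.

Lemma ex_RInt_slice f u a b : smooth_pt f -> ex_RInt (fun t => f (u, t)) a b.
Proof.
  intros Hf. apply (ex_RInt_continuous (V:=R_CompleteNormedModule)).
  intros z _. now apply continuous_slice.
Qed.

Definition prim_pt (f : pt -> R) : pt -> R := fun p => RInt (fun t => f (fst p, t)) 0 (snd p).

Lemma is_derive_prim f u s : smooth_pt f ->
  is_derive (fun t => RInt (fun t => f (u, t)) 0 t) s (f (u, s)).
Proof.
  intros Hf. apply (is_derive_RInt (fun t => f (u, t)) _ 0).
  - apply filter_forall. intros x.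
    apply (RInt_correct (V:=R_CompleteNormedModule)), ex_RInt_slice, Hf.
  - now apply continuous_slice.
Qed.

Lemma continuous_prim f p : smooth_pt f -> continuous (prim_pt f) p.
Proof.
  intros Hf. destruct p as [u s]. apply filterlim_locally. intros eps.
  (* [M] bounds the upper limit [r] once [r] is within 1 of [s]; hence the cap by 1 in the radius
     below. Half of [eps] pays for moving the parameter, half for moving the limit. *)
  pose (M := Rabs s + 1).
  assert (HM : 0 < M) by (unfold M; pose proof (Rabs_pos s); lra).
  assert (He : 0 < eps / 2 / M).
  { apply Rdiv_lt_0_compat; [|exact HM]. apply is_pos_div_2. }
  destruct (locally_uniform_in_last f u (- M) M (mkposreal _ He)
    (fun q => smooth_continuous f q Hf)) as [d1 Hd1].
  assert (Hc : continuous (fun t => RInt (fun t => f (u, t)) 0 t) s).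
  { apply (ex_derive_continuous (V:=R_NormedModule)). eexists. now apply is_derive_prim. }
  apply filterlim_locally with (eps := pos_div_2 eps) in Hc.
  destruct Hc as [d2 Hd2].
  assert (Hd : 0 < Rmin (Rmin d1 d2) 1).
  { repeat apply Rmin_glb_lt; try apply cond_pos. lra. }
  exists (mkposreal _ Hd). intros [v r] [Hv Hr]. simpl in Hv, Hr.
  assert (Hv' : ball u d1 v).
  { eapply ball_le; [|exact Hv]. simpl.
    eapply Rle_trans; [apply Rmin_l|]. apply Rmin_l. }
  assert (Hr' : ball s d2 r).
  { eapply ball_le; [|exact Hr]. simpl.
    eapply Rle_trans; [apply Rmin_l|]. apply Rmin_r. }
  assert (Hr1 : Rabs (r - s) < 1).
  { eapply Rlt_le_trans; [exact Hr|]. simpl. apply Rmin_r. }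
  specialize (Hd2 r Hr').
  assert (Hdiff : Rabs (RInt (fun t => f (v, t)) 0 r - RInt (fun t => f (u, t)) 0 r) <= eps / 2).
  { assert (Hrr : Rabs r <= M).
    { unfold M. replace r with ((r - s) + s) at 1 by ring.
      eapply Rle_trans; [apply Rabs_triang|]. lra. }
    rewrite <- (RInt_minus (V:=R_CompleteNormedModule)) by now apply ex_RInt_slice.
    assert (Hx : ex_RInt (fun t => minus (f (v, t)) (f (u, t))) 0 r).
    { apply (ex_RInt_minus (V:=R_NormedModule)); now apply ex_RInt_slice. }
    assert (Hbnd : forall t, -M <= t <= M -> Rabs (f (v, t) - f (u, t)) <= eps / 2 / M).
    { intros t Ht. left. now apply Hd1. }
    assert (Hfin : Rabs r * (eps / 2 / M) <= eps / 2).
    { replace (eps / 2) with (M * (eps / 2 / M)) at 2 by (field; lra).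
      apply Rmult_le_compat_r; [lra | exact Hrr]. }
    apply Rabs_le_between in Hrr.
    destruct (Rle_dec 0 r) as [H0|H0].
    - eapply Rle_trans.
      { apply (abs_RInt_le_const _ 0 r (eps / 2 / M) H0 Hx).
        intros t Ht. apply Hbnd. lra. }
      rewrite (Rabs_pos_eq r H0) in Hfin. lra.
    - rewrite <- (opp_RInt_swap (V:=R_CompleteNormedModule)) by now apply ex_RInt_swap.
      unfold opp; simpl. rewrite Rabs_Ropp.
      eapply Rle_trans.
      { apply (abs_RInt_le_const _ r 0 (eps / 2 / M)); [lra | now apply ex_RInt_swap|].
        intros t Ht. apply Hbnd. lra. }
      rewrite (Rabs_left r) in Hfin by lra. lra. }
  change (Rabs (RInt (fun t => f (v, t)) 0 r - RInt (fun t => f (u, t)) 0 s) < eps).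
  change (Rabs (RInt (fun t => f (u, t)) 0 r - RInt (fun t => f (u, t)) 0 s) < eps / 2) in Hd2.
  replace (RInt (fun t => f (v, t)) 0 r - RInt (fun t => f (u, t)) 0 s) with
    ((RInt (fun t => f (v, t)) 0 r - RInt (fun t => f (u, t)) 0 r) +
     (RInt (fun t => f (u, t)) 0 r - RInt (fun t => f (u, t)) 0 s)) by ring.
  eapply Rle_lt_trans; [apply Rabs_triang|]. lra.
Qed.

Lemma is_derive_param f u i b : (i < 3)%nat -> smooth_pt f ->
  is_derive (fun e => RInt (fun t => f (shift i (u, t) e)) 0 b) 0
    (RInt (fun t => pd i f (u, t)) 0 b).
Proof.
  intros Hi Hf.
  apply (is_derive_RInt_param (fun e t => f (shift i (u, t) e)) 0 b 0).
  - apply filter_forall. intros x t _. now apply smooth_ex_at.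
  - intros t _.
    eapply continuity_2d_pt_ext.
    { intros x y. symmetry. apply Derive_shift. }
    (* Direction 3 is the arc length, measured from [(u, 0)]. *)
    eapply continuity_2d_pt_ext; [|apply (continuity_2d_shift (pd i f) i 3 (u, 0) 0 t)].
    + intros x y. simpl. destruct u as [[x1 x2] x3]. simpl. now rewrite Rplus_0_l.
    + now apply smooth_pd.
  - apply filter_forall. intros x.
    apply (ex_RInt_ext (fun t => f (fst (shift i (u, 0) x), t))).
    + intros t _. destruct u as [[x1 x2] x3]. f_equal.
      destruct i as [|[|[|i]]]; try reflexivity. lia.
    + now apply ex_RInt_slice.
Qed.

Lemma pt_shift_small i u s e : (i < 3)%nat ->
  shift i (u, s) e = (fst (shift i (u, 0) e), s).
Proof.
  intros Hi. destruct u as [[x1 x2] x3].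
  destruct i as [|[|[|i]]]; try reflexivity. lia.
Qed.

Lemma shift_large i u s e : (3 <= i)%nat -> shift i (u, s) e = (u, s + e).
Proof.
  intros Hi. destruct u as [[x1 x2] x3].
  destruct i as [|[|[|i]]]; try lia. reflexivity.
Qed.

Lemma prim_shift_small f i u s e : (i < 3)%nat ->
  prim_pt f (shift i (u, s) e) = RInt (fun t => f (shift i (u, t) e)) 0 s.
Proof.
  intros Hi. rewrite pt_shift_small by assumption. unfold prim_pt; cbn [fst snd].
  apply RInt_ext. intros t _. now rewrite (pt_shift_small i u t).
Qed.

(** [shift] sends every index from 3 on to the arc length, so there are only four directions and a
    case split on [i < 3] separates parameters from arc length. *)
Lemma pd_large i f : (3 <= i)%nat -> pd i f = pd 3 f.
Proof.
  intros Hi. extensionality p. destruct p as [u s]. unfold pd.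
  apply Derive_ext. intros e. now rewrite !shift_large by lia.
Qed.

Lemma is_derive_prim_shift f i p : smooth_pt f ->
  is_derive (fun e => prim_pt f (shift i p e)) 0
    (if Nat.ltb i 3 then prim_pt (pd i f) p else f p).
Proof.
  intros Hf. destruct p as [u s]. destruct (Nat.ltb_spec i 3) as [Hi|Hi].
  - eapply is_derive_ext; [|now apply is_derive_param].
    intros e. symmetry. now apply prim_shift_small.
  - eapply is_derive_ext.
    { intros e. symmetry. rewrite shift_large by assumption. reflexivity. }
    unfold prim_pt; simpl.
    evar_last.
    { apply (is_derive_comp (fun x => RInt (fun t => f (u, t)) 0 x) (fun e => s + e)).
      - now apply is_derive_prim.
      - auto_derive; [exact I | reflexivity]. }
    rewrite Rplus_0_r. apply Rmult_1_l.
Qed.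

Lemma pd3_prim f : smooth_pt f -> pd 3 (prim_pt f) = f.
Proof.
  intros Hf. extensionality p. apply is_derive_unique.
  apply (is_derive_prim_shift f 3 p Hf).
Qed.

Lemma pd_prim f i : (i < 3)%nat -> smooth_pt f -> pd i (prim_pt f) = prim_pt (pd i f).
Proof.
  intros Hi Hf. extensionality p. apply is_derive_unique.
  evar_last; [now apply is_derive_prim_shift|].
  apply Nat.ltb_lt in Hi. now rewrite Hi.
Qed.

(** In a parameter direction [pd] commutes with taking the primitive; along the arc length it
    returns the smooth integrand. The class must therefore contain both the smooth functions and
    their primitives. *)
Lemma smooth_prim f : smooth_pt f -> smooth_pt (prim_pt f).
Proof.
  intros Hf.
  apply (smooth_coind (fun h => smooth_pt h \/ exists f, smooth_pt f /\ h = prim_pt f)).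
  2: right; now exists f.
  clear. intros h [Hh | (f & Hf & ->)]; repeat split.
  - intros p. now apply smooth_continuous.
  - intros i p. now apply smooth_ex.
  - intros i. left. now apply smooth_pd.
  - intros p. now apply continuous_prim.
  - intros i p. eexists. now apply is_derive_prim_shift.
  - intros i. destruct (le_lt_dec 3 i) as [Hi|Hi].
    + left. rewrite pd_large by assumption. now rewrite pd3_prim.
    + right. exists (pd i f). split; [now apply smooth_pd | now apply pd_prim].
Qed.

(** Evaluation at arc length [b], kept as a function on [pt]. A circle integral is a primitive
    frozen at the end of the period, so it inherits smoothness and parameter derivatives from
    primitives. *)
Definition freeze (b : R) (f : pt -> R) : pt -> R := fun p => f (fst p, b).

Lemma pd_freeze b f i : (i < 3)%nat -> pd i (freeze b f) = freeze b (pd i f).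
Proof.
  intros Hi. extensionality p. destruct p as [u s]. unfold pd, freeze; cbn [fst snd].
  apply Derive_ext. intros e. rewrite (pt_shift_small i u s) by assumption.
  now rewrite (pt_shift_small i u b).
Qed.

Lemma smooth_freeze b f : smooth_pt f -> smooth_pt (freeze b f).
Proof.
  intros Hf.
  apply (smooth_coind (fun h => (exists f, smooth_pt f /\ h = freeze b f) \/ h = fun _ => 0)).
  2: left; now exists f.
  clear. intros h [(f & Hf & ->) | ->]; repeat split.
  - intros [u s]. unfold freeze.
    apply (continuous_comp_2 fst (fun _ => b) (fun v t => f (v, t))).
    + apply continuous_fst.
    + apply continuous_const.
    + apply (continuous_ext f); [now intros [? ?] | now apply smooth_continuous].
  - intros i [u s]. unfold freeze. destruct (le_lt_dec 3 i) as [Hi|Hi].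
    + apply (ex_derive_ext (fun _ => f (u, b))); [|apply ex_derive_const].
      intros e. now rewrite shift_large.
    + apply (ex_derive_ext (fun e => f (shift i (u, b) e))); [|now apply smooth_ex].
      intros e. rewrite (pt_shift_small i u s) by assumption.
      now rewrite (pt_shift_small i u b).
  - intros i. destruct (le_lt_dec 3 i) as [Hi|Hi].
    + right. extensionality p. destruct p as [u s]. unfold pd, freeze.
      transitivity (Derive (fun _ => f (u, b)) 0); [|apply Derive_const].
      apply Derive_ext. intros e. now rewrite shift_large.
    + left. exists (pd i f). split; [now apply smooth_pd | now apply pd_freeze].
  - intros p. apply continuous_const.
  - intros i p. apply ex_derive_const.
  - intros i. right. apply pd_const.
Qed.

Definition circle_int_pt (f : pt -> R) : pt ->
    R := fun p => RInt (fun t => f (fst p, t)) 0 (2 * PI).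

Lemma circle_int_pt_freeze f : circle_int_pt f = freeze (2 * PI) (prim_pt f).
Proof. reflexivity. Qed.

Lemma smooth_circ f : smooth_pt f -> smooth_pt (circle_int_pt f).
Proof. intros Hf. rewrite circle_int_pt_freeze. now apply smooth_freeze, smooth_prim. Qed.

Lemma pd_circ f i : (i < 3)%nat -> smooth_pt f -> pd i (circle_int_pt f) = circle_int_pt (pd i f).
Proof.
  intros Hi Hf. rewrite !circle_int_pt_freeze. rewrite pd_freeze by assumption.
  now rewrite pd_prim.
Qed.

Lemma circle_int_pt_plus f g : smooth_pt f -> smooth_pt g ->
  circle_int_pt (fun p => f p + g p) = fun p => circle_int_pt f p + circle_int_pt g p.
Proof.
  intros Hf Hg. extensionality p. unfold circle_int_pt.
  apply (RInt_plus (V:=R_CompleteNormedModule)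
    (fun t => f (fst p, t)) (fun t => g (fst p, t))); now apply ex_RInt_slice.
Qed.

Definition periodic_pt (f : pt -> R) : Prop := forall u s, f (u, s + 2 * PI) = f (u, s).

Lemma circle_int_pt_pd3 f : smooth_pt f -> periodic_pt f -> circle_int_pt (pd 3 f) = fun _ => 0.
Proof.
  intros Hf Hp. extensionality p. destruct p as [u s]. unfold circle_int_pt; simpl.
  transitivity (f (u, 2 * PI) - f (u, 0)).
  - apply is_RInt_unique. apply (is_RInt_derive (V:=R_CompleteNormedModule) (fun t => f (u, t))).
    + intros x _. pose proof (is_derive_pd f 3 (u, x) Hf) as H.
      destruct u as [[x1 x2] x3]. simpl in H.
      apply (is_derive_ext (fun t => (fun e => f (x1, x2, x3, x + e)) (t - x))).
      * intros t. simpl. f_equal. f_equal. ring.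
      * evar_last.
        { apply (is_derive_comp (fun e => f (x1, x2, x3, x + e)) (fun t => t - x)).
          - replace (x - x) with 0 by ring. exact H.
          - auto_derive; [exact I | reflexivity]. }
        apply Rmult_1_l.
    + intros x _. now apply continuous_slice, smooth_pd.
  - rewrite <- (Rplus_0_l (2 * PI)), Hp. ring.
Qed.

Lemma periodic_pd f i : periodic_pt f -> periodic_pt (pd i f).
Proof.
  intros Hp u s. unfold pd. apply Derive_ext. intros e.
  destruct (le_lt_dec 3 i) as [Hi|Hi].
  - rewrite !shift_large by assumption. rewrite <- (Hp u (s + e)). f_equal. f_equal. ring.
  - rewrite (pt_shift_small i u (s + 2 * PI)), (pt_shift_small i u s) by assumption. apply Hp.
Qed.

(** * Restriction to a fixed value of the parameters *)

Lemma Derive_slice f u s : Derive (fun t => f (u, t)) s = pd 3 f (u, s).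
Proof.
  destruct u as [[x y] z].
  pose proof (Derive_shift f 3 (x, y, z, 0) s) as H. simpl in H.
  rewrite Rplus_0_l in H. rewrite <- H. apply Derive_ext. intros t. now rewrite Rplus_0_l.
Qed.

Lemma Derive_n_slice f u n s : Derive_n (fun t => f (u, t)) n s = Nat.iter n (pd 3) f (u, s).
Proof.
  revert s. induction n as [|n IH]; intros s; [reflexivity|].
  simpl. rewrite <- Derive_slice. apply Derive_ext. exact IH.
Qed.

Lemma smooth_iter f n : smooth_pt f -> smooth_pt (Nat.iter n (pd 3) f).
Proof. intros H. induction n; simpl; [exact H | now apply smooth_pd]. Qed.

Lemma ex_derive_slice f u s : smooth_pt f -> ex_derive (fun t => f (u, t)) s.
Proof.
  intros Hf. destruct u as [[x y] z].
  apply (ex_derive_ext (fun e => f (shift 3 (x, y, z, 0) e))).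
  - intros t. simpl. now rewrite Rplus_0_l.
  - now apply smooth_ex_at.
Qed.

(** * Smooth functions of one variable *)

Definition smooth1 (f : R -> R) : Prop := forall n s, ex_derive_n f n s.

Lemma smooth1_slice f u : smooth_pt f -> smooth1 (fun s => f (u, s)).
Proof.
  intros Hf [|n] s; [exact I|]. simpl.
  apply (ex_derive_ext (fun t => Nat.iter n (pd 3) f (u, t))).
  - intros t. symmetry. apply Derive_n_slice.
  - now apply ex_derive_slice, smooth_iter.
Qed.

(** Lifting to [pt] makes the closure properties of [smooth1] instances of those of [smooth_pt],
    read back through [smooth1_slice]. *)
Lemma smooth_of_smooth1 f : smooth1 f -> smooth_pt (fun p => f (snd p)).
Proof.
  intros Hf.
  apply (smooth_coind (fun h => (exists n, h = fun p => Derive_n f n (snd p)) \/ h = fun _ => 0)).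
  2: left; now exists O.
  assert (Hx : forall n s, ex_derive (Derive_n f n) s) by (intros n s; apply (Hf (S n) s)).
  intros h [[n ->] | ->]; repeat split.
  - intros [u s]. apply (continuous_comp snd (Derive_n f n)); [apply continuous_snd|].
    apply (ex_derive_continuous (V:=R_NormedModule)), Hx.
  - intros i [u s]. destruct (le_lt_dec 3 i) as [Hi|Hi].
    + apply (ex_derive_ext (fun e => Derive_n f n (s + e))).
      { intros e. now rewrite shift_large. }
      apply (ex_derive_comp (Derive_n f n)); [apply Hx|]. auto_derive. exact I.
    + apply (ex_derive_ext (fun _ => Derive_n f n s)); [|apply ex_derive_const].
      intros e. now rewrite pt_shift_small.
  - intros i. destruct (le_lt_dec 3 i) as [Hi|Hi].
    + left. exists (S n). rewrite pd_large by assumption. extensionality p.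
      destruct p as [u s]. now rewrite <- Derive_slice.
    + right. extensionality p. destruct p as [u s]. unfold pd.
      transitivity (Derive (fun _ => Derive_n f n s) 0); [|apply Derive_const].
      apply Derive_ext. intros e. now rewrite pt_shift_small.
  - intros p. apply continuous_const.
  - intros i p. apply ex_derive_const.
  - intros i. right. apply pd_const.
Qed.

Lemma smooth1_plus f g : smooth1 f -> smooth1 g -> smooth1 (fun s => f s + g s).
Proof.
  intros Hf Hg. apply (smooth1_slice (fun p => f (snd p) + g (snd p)) (0, 0, 0)).
  apply smooth_plus; now apply smooth_of_smooth1.
Qed.

Lemma smooth1_mult f g : smooth1 f -> smooth1 g -> smooth1 (fun s => f s * g s).
Proof.
  intros Hf Hg. apply (smooth1_slice (fun p => f (snd p) * g (snd p)) (0, 0, 0)).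
  apply smooth_mult; now apply smooth_of_smooth1.
Qed.

Lemma smooth1_const c : smooth1 (fun _ => c).
Proof. apply (smooth1_slice (fun _ => c) (0, 0, 0)). apply smooth_const. Qed.

Lemma smooth1_opp f : smooth1 f -> smooth1 (fun s => - f s).
Proof.
  intros Hf. apply (smooth1_slice (fun p => - f (snd p)) (0, 0, 0)).
  now apply smooth_opp, smooth_of_smooth1.
Qed.

Lemma smooth1_minus f g : smooth1 f -> smooth1 g -> smooth1 (fun s => f s - g s).
Proof. intros Hf Hg. apply smooth1_plus; [exact Hf | now apply smooth1_opp]. Qed.

Lemma smooth1_Derive f : smooth1 f -> smooth1 (Derive f).
Proof.
  intros Hf. replace (Derive f) with (fun s => pd 3 (fun p => f (snd p)) (0, 0, 0, s)).
  - now apply smooth1_slice, smooth_pd, smooth_of_smooth1.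
  - extensionality s. now rewrite <- Derive_slice.
Qed.

Lemma smooth1_prim f : smooth1 f -> smooth1 (fun s => RInt f 0 s).
Proof.
  intros Hf. apply (smooth1_slice (prim_pt (fun p => f (snd p))) (0, 0, 0)).
  now apply smooth_prim, smooth_of_smooth1.
Qed.

Lemma Derive_prim f s : smooth1 f -> Derive (fun s => RInt f 0 s) s = f s.
Proof.
  intros Hf. apply is_derive_unique.
  apply (is_derive_prim (fun p => f (snd p)) (0, 0, 0)). now apply smooth_of_smooth1.
Qed.

Lemma smooth1_ex f s : smooth1 f -> ex_derive f s.
Proof. intros Hf. apply (Hf 1%nat s). Qed.

Lemma smooth1_continuous f s : smooth1 f -> continuous f s.
Proof. intros Hf. now apply (ex_derive_continuous (V:=R_NormedModule)), smooth1_ex. Qed.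

Lemma smooth1_ex_RInt f a b : smooth1 f -> ex_RInt f a b.
Proof.
  intros Hf. apply (ex_RInt_continuous (V:=R_CompleteNormedModule)).
  intros z _. now apply smooth1_continuous.
Qed.

(** * Differential polynomials *)

Definition sumR (f : nat -> R) (N : nat) : R := fold_right Rplus 0 (map f (seq 0 N)).

Lemma sumR_S f N : sumR f (S N) = sumR f N + f N.
Proof.
  unfold sumR. rewrite seq_S, map_app, fold_right_app. simpl.
  generalize (map f (seq 0 N)). intros l. induction l as [|a l IH]; simpl; [ring|].
  rewrite IH. ring.
Qed.

Lemma sumR_ext f g N : (forall j, (j < N)%nat -> f j = g j) -> sumR f N = sumR g N.
Proof.
  induction N as [|N IH]; intros H; [reflexivity|].
  rewrite !sumR_S, IH, H; auto with arith.
Qed.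

Lemma sumR_plus f g N : sumR (fun j => f j + g j) N = sumR f N + sumR g N.
Proof. induction N as [|N IH]; [unfold sumR; simpl; ring|]. rewrite !sumR_S, IH. ring. Qed.

Lemma sumR_scal c f N : sumR (fun j => c * f j) N = c * sumR f N.
Proof. induction N as [|N IH]; [unfold sumR; simpl; ring|]. rewrite !sumR_S, IH. ring. Qed.

Lemma sumR_single (f : nat -> R) j N : (j < N)%nat ->
  sumR (fun i => (if Nat.eqb i j then 1 else 0) * f i) N = f j.
Proof.
  assert (H0 : forall M, (M <= j)%nat ->
    sumR (fun i => (if Nat.eqb i j then 1 else 0) * f i) M = 0).
  { induction M as [|M IH]; intros HM; [reflexivity|].
    rewrite sumR_S, IH by lia. destruct (Nat.eqb_spec M j); [lia|ring]. }
  induction N as [|N IH]; intros HN; [lia|].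
  rewrite sumR_S. destruct (Nat.eqb_spec N j) as [->|Hne].
  - rewrite H0 by lia. ring.
  - rewrite IH by lia. ring.
Qed.

(** The directional derivative of [p] at the jet [x] along [xi]. It yields the total derivative when
    [xi] is the shifted jet, and the first variation when [xi] is the jet of a variation. *)
Fixpoint dp_lin (p : dpoly) (x xi : nat -> R) : R :=
  match p with
  | DConst _ => 0
  | DVar j => xi j
  | DAdd p q => dp_lin p x xi + dp_lin q x xi
  | DMul p q => dp_lin p x xi * dp_eval q x + dp_eval p x * dp_lin q x xi
  end.

Lemma dp_lin_partial p x xi N : (dp_order p <= N)%nat ->
  dp_lin p x xi = sumR (fun j => dp_eval (dp_partial j p) x * xi j) N.
Proof.
  induction p as [a|j|p IHp q IHq|p IHp q IHq]; simpl; intros HN.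
  - rewrite sumR_scal. ring.
  - symmetry. apply (sumR_single xi). lia.
  - rewrite IHp, IHq by lia. rewrite <- sumR_plus. apply sumR_ext. intros; ring.
  - rewrite IHp, IHq by lia. rewrite Rmult_comm, <- !sumR_scal, <- sumR_plus.
    apply sumR_ext. intros; ring.
Qed.

Lemma dp_eval_euler p x : dp_eval (dp_euler p) x =
  sumR (fun j => (-1) ^ j * dp_eval (Nat.iter j dp_D (dp_partial j p)) x) (dp_order p).
Proof.
  unfold dp_euler, sumR. generalize (seq 0 (dp_order p)). intros l.
  induction l as [|j l IH]; simpl; [reflexivity|]. now rewrite IH.
Qed.

Lemma dp_eval_D p x : dp_eval (dp_D p) x = dp_lin p x (fun j => x (S j)).
Proof. induction p as [a|j|p IHp q IHq|p IHp q IHq]; simpl; congruence. Qed.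

(** Formal integration by parts, repeated [j] times, against [k_1], whose [j]-th derivative is
    [k_(j+1)]. *)
Lemma dp_by_parts j a : exists w, forall x, dp_eval (dp_D w) x =
  dp_eval a x * x (S j) - (-1) ^ j * dp_eval (Nat.iter j dp_D a) x * x 1%nat.
Proof.
  revert a. induction j as [|j IH]; intros a.
  - exists (DConst 0). intros x. simpl. ring.
  - destruct (IH (dp_D a)) as [w Hw].
    exists (DAdd (DMul a (DVar (S j))) (DMul (DConst (-1)) w)).
    intros x. cbn [dp_D dp_eval]. rewrite Hw, Nat.iter_swap. simpl. ring.
Qed.

(* Translation invariance: [Dp] is the linearization of [p] in the direction
   [k_1, k_2, ...], so that it differs from [k_1 E(p)] by a total derivative. *)
Lemma dp_noether p : exists q, forall x, dp_eval (dp_D q) x = x 1%nat * dp_eval (dp_euler p) x.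
Proof.
  assert (H : forall N, exists w, forall x, dp_eval (dp_D w) x =
    sumR (fun j => dp_eval (dp_partial j p) x * x (S j)) N -
    x 1%nat * sumR (fun j => (-1) ^ j * dp_eval (Nat.iter j dp_D (dp_partial j p)) x) N).
  { induction N as [|N [w Hw]].
    - exists (DConst 0). intros x. unfold sumR. simpl. ring.
    - destruct (dp_by_parts N (dp_partial N p)) as [w' Hw'].
      exists (DAdd w w'). intros x. cbn [dp_D dp_eval]. rewrite Hw, Hw', !sumR_S. ring. }
  destruct (H (dp_order p)) as [w Hw].
  exists (DAdd p (DMul (DConst (-1)) w)). intros x. cbn [dp_D dp_eval].
  rewrite Hw, dp_eval_euler, dp_eval_D, (dp_lin_partial p _ _ (dp_order p)) by lia. ring.
Qed.

Section Densities.
Variable h : nat -> dpoly.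
Hypothesis Hh : mkdv_densities h.

(** [dp_Dinv] is chosen by [epsilon], hence meaningful only once an antiderivative is known to
    exist. With [E] the variational derivative of [h (S n)], the hypothesis gives
    [k * mkdv_rhs n = 2 k D E], and [k D E = D (k E) - k_1 E], where [k_1 E] is a total derivative
    by [dp_noether]. *)
Lemma mkdv_Dinv n x :
  dp_eval (dp_D (dp_Dinv (DMul (DVar 0) (mkdv_rhs n)))) x = x 0%nat * dp_eval (mkdv_rhs n) x.
Proof.
  destruct Hh as [_ Hn]. specialize (Hn n).
  assert (E : exists q, dp_eq (dp_D q) (DMul (DVar 0) (mkdv_rhs n)) /\ dp_eval q (fun _ => 0) = 0).
  { destruct (dp_noether (h (S n))) as [q Hq].
    set (E := dp_euler (h (S n))) in *.
    pose (q' := DMul (DConst 2) (DAdd (DMul (DVar 0) E) (DMul (DConst (-1)) q))).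
    (* Subtracting the value at the zero jet meets the normalization without constant term. *)
    exists (DAdd q' (DConst (- dp_eval q' (fun _ => 0)))). split.
    - intros x'. cbn [dp_D dp_eval q']. rewrite Hq, (Hn x'). cbn [dp_eval]. ring.
    - cbn [dp_eval]. ring. }
  unfold dp_Dinv. destruct (epsilon_spec (inhabits (DConst 0)) _ E) as [H _].
  apply (H x).
Qed.

End Densities.

(** * Differential polynomials along families of functions *)

Definition jet (K : pt -> R) (q : pt) (j : nat) : R := Nat.iter j (pd 3) K q.

Definition dpE (p : dpoly) (K : pt -> R) : pt -> R := fun q => dp_eval p (jet K q).

Lemma smooth_dpE p K : smooth_pt K -> smooth_pt (dpE p K).
Proof.
  intros HK. unfold dpE. induction p as [a|j|p IHp q IHq|p IHp q IHq]; simpl.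
  - apply smooth_const.
  - now apply smooth_iter.
  - now apply smooth_plus.
  - now apply smooth_mult.
Qed.

Lemma periodic_iter K j : periodic_pt K -> periodic_pt (Nat.iter j (pd 3) K).
Proof. intros HK. induction j; simpl; [exact HK | now apply periodic_pd]. Qed.

Lemma periodic_dpE p K : periodic_pt K -> periodic_pt (dpE p K).
Proof.
  intros HK u s. unfold dpE. f_equal. extensionality j. now apply periodic_iter.
Qed.

Lemma pd_iter K i j : smooth_pt K -> pd i (Nat.iter j (pd 3) K) = Nat.iter j (pd 3) (pd i K).
Proof.
  intros HK. induction j as [|j IH]; simpl; [reflexivity|].
  rewrite pd_comm by now apply smooth_iter. now rewrite IH.
Qed.

Lemma pd_dpE p K i : smooth_pt K ->
  pd i (dpE p K) = fun q => dp_lin p (jet K q) (jet (pd i K) q).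
Proof.
  intros HK. unfold dpE. induction p as [a|j|p IHp q IHq|p IHp q IHq]; simpl.
  - apply pd_const.
  - unfold jet. now rewrite <- pd_iter.
  - rewrite pd_plus, IHp, IHq; try reflexivity; now apply (smooth_dpE _ K).
  - rewrite pd_mult, IHp, IHq; try reflexivity; now apply (smooth_dpE _ K).
Qed.

Lemma pd3_dpE p K : smooth_pt K -> pd 3 (dpE p K) = dpE (dp_D p) K.
Proof.
  intros HK. rewrite pd_dpE by assumption. extensionality q. unfold dpE.
  rewrite dp_eval_D. f_equal. extensionality j. unfold jet.
  now rewrite Nat.iter_swap.
Qed.

(** The counterpart of [dp_by_parts] for functions; periodicity of [w] makes the boundary terms
    disappear after integration. *)
Lemma pt_by_parts j a v : smooth_pt a -> periodic_pt a -> smooth_pt v -> periodic_pt v ->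
  exists w, smooth_pt w /\ periodic_pt w /\ forall q,
    pd 3 w q = a q * jet v q j - (-1) ^ j * jet a q j * v q.
Proof.
  intros Ha Pa Hv Pv. revert a Ha Pa. induction j as [|j IH]; intros a Ha Pa.
  - exists (fun _ => 0). split; [apply smooth_const|]. split; [now intros u s|].
    intros q. rewrite pd_const. unfold jet. simpl. ring.
  - destruct (IH (pd 3 a)) as [w [Hw [Pw Ew]]]; [now apply smooth_pd | now apply periodic_pd|].
    exists (fun q => a q * Nat.iter j (pd 3) v q - w q).
    assert (Hj : smooth_pt (Nat.iter j (pd 3) v)) by now apply smooth_iter.
    split; [|split].
    + apply smooth_minus; [now apply smooth_mult | exact Hw].
    + intros u s. now rewrite Pa, Pw, (periodic_iter v j Pv).
    + intros q. rewrite pd_minus, pd_mult, Ew by (try apply smooth_mult; assumption).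
      unfold jet. rewrite Nat.iter_swap. simpl. ring.
Qed.

(** Each term of the linearization is integrated by parts as often as the order of its jet variable;
    the signs and total derivatives that accumulate are those of the Euler operator. *)
Lemma circle_int_pt_lin p K v : smooth_pt K -> periodic_pt K -> smooth_pt v -> periodic_pt v ->
  smooth_pt (fun q => dp_lin p (jet K q) (jet v q)) ->
  circle_int_pt (fun q => dp_lin p (jet K q) (jet v q)) =
      circle_int_pt (fun q => dpE (dp_euler p) K q * v q).
Proof.
  intros HK PK Hv Pv Hs.
  assert (H : forall N, exists w, smooth_pt w /\ periodic_pt w /\ forall q, pd 3 w q =
    sumR (fun j => dp_eval (dp_partial j p) (jet K q) * jet v q j) N -
    sumR (fun j => (-1) ^ j * dp_eval (Nat.iter j dp_D (dp_partial j p)) (jet K q)) N * v q).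
  { assert (HD : forall j a, Nat.iter j (pd 3) (dpE a K) = dpE (Nat.iter j dp_D a) K).
    { intros j a. induction j as [|j IH]; simpl; [reflexivity|].
      now rewrite IH, pd3_dpE. }
    induction N as [|N [w [Hw [Pw Ew]]]].
    - exists (fun _ => 0). split; [apply smooth_const|]. split; [now intros u s|].
      intros q. rewrite pd_const. unfold sumR. simpl. ring.
    - destruct (pt_by_parts N (dpE (dp_partial N p) K) v) as [w' [Hw' [Pw' Ew']]];
        trivial; [now apply smooth_dpE | now apply periodic_dpE|].
      exists (fun q => w q + w' q). split; [|split].
      + now apply smooth_plus.
      + intros u s. now rewrite Pw, Pw'.
      + intros q. rewrite pd_plus, Ew, Ew', !sumR_S by assumption.
        assert (EJ : jet (dpE (dp_partial N p) K) q N
          = dp_eval (Nat.iter N dp_D (dp_partial N p)) (jet K q)).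
        { unfold jet at 1. now rewrite HD. }
        rewrite EJ. unfold dpE. ring. }
  destruct (H (dp_order p)) as [w [Hw [Pw Ew]]].
  assert (Hm : smooth_pt (fun q => dpE (dp_euler p) K q * v q)).
  { apply smooth_mult; [now apply smooth_dpE | exact Hv]. }
  replace (fun q => dp_lin p (jet K q) (jet v q))
    with (fun q => pd 3 w q + dpE (dp_euler p) K q * v q).
  - rewrite circle_int_pt_plus by (try apply smooth_pd; assumption).
    rewrite circle_int_pt_pd3 by assumption. extensionality q. ring.
  - extensionality q. rewrite Ew. unfold dpE. rewrite dp_eval_euler.
    rewrite (dp_lin_partial p _ _ (dp_order p)) by lia. ring.
Qed.

Lemma pd_circ_dpE p K i : (i < 3)%nat -> smooth_pt K -> periodic_pt K ->
  pd i (circle_int_pt (dpE p K)) = circle_int_pt (fun q => dpE (dp_euler p) K q * pd i K q).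
Proof.
  intros Hi HK PK.
  rewrite pd_circ by (try apply smooth_dpE; assumption).
  rewrite pd_dpE by assumption. apply circle_int_pt_lin; trivial.
  - now apply smooth_pd.
  - now apply periodic_pd.
  - rewrite <- pd_dpE by assumption. now apply smooth_pd, smooth_dpE.
Qed.

(** * Smooth periodic functions and integration over the circle *)

Definition smooth_periodic (f : R -> R) : Prop := smooth1 f /\ forall s, f (s + 2 * PI) = f s.

Lemma smooth_periodic_const c : smooth_periodic (fun _ => c).
Proof. split; [apply smooth1_const | reflexivity]. Qed.

Lemma smooth_periodic_plus f g : smooth_periodic f -> smooth_periodic g ->
    smooth_periodic (fun s => f s + g s).
Proof. intros [? ?] [? ?]; split; [now apply smooth1_plus | congruence]. Qed.

Lemma smooth_periodic_mult f g : smooth_periodic f -> smooth_periodic g ->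
    smooth_periodic (fun s => f s * g s).
Proof. intros [? ?] [? ?]; split; [now apply smooth1_mult | congruence]. Qed.

Lemma smooth_periodic_minus f g : smooth_periodic f -> smooth_periodic g ->
    smooth_periodic (fun s => f s - g s).
Proof. intros [? ?] [? ?]; split; [now apply smooth1_minus | congruence]. Qed.

Lemma smooth_periodic_opp f : smooth_periodic f -> smooth_periodic (fun s => - f s).
Proof. intros [? ?]; split; [now apply smooth1_opp | congruence]. Qed.

Lemma smooth_periodic_Derive f : smooth_periodic f -> smooth_periodic (Derive f).
Proof.
  intros [Hs Hp]; split; [now apply smooth1_Derive|].
  intros s. rewrite <- (Derive_ext _ _ s Hp). symmetry. apply is_derive_unique.
  evar_last.
  { apply (is_derive_comp f (fun s => s + 2 * PI)).
    - apply Derive_correct. now apply smooth1_ex.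
    - auto_derive; [exact I | reflexivity]. }
  apply Rmult_1_l.
Qed.

Lemma smooth1_pow2 f : smooth1 f -> smooth1 (fun s => f s ^ 2).
Proof.
  intros Hf. replace (fun s => f s ^ 2) with (fun s => f s * f s) by (extensionality s; ring).
  now apply smooth1_mult.
Qed.

Ltac solve_smooth1 :=
  try assumption;
  lazymatch goal with
  | |- smooth1 (fun s => @?f s + @?g s) => apply (smooth1_plus f g); solve_smooth1
  | |- smooth1 (fun s => @?f s - @?g s) => apply (smooth1_minus f g); solve_smooth1
  | |- smooth1 (fun s => @?f s * @?g s) => apply (smooth1_mult f g); solve_smooth1
  | |- smooth1 (fun s => - @?f s) => apply (smooth1_opp f); solve_smooth1
  | |- smooth1 (fun s => @?f s ^ 2) => apply (smooth1_pow2 f); solve_smooth1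
  | |- smooth1 (fun _ => ?c) => apply (smooth1_const c)
  | |- smooth1 (fun s => Derive ?f s) => apply (smooth1_Derive f); solve_smooth1
  | |- smooth1 (Derive ?f) => apply (smooth1_Derive f); solve_smooth1
  | |- smooth1 (fun s => ?f s) => change (smooth1 f); solve_smooth1
  | |- _ => idtac
  end.

Ltac solve_smooth_periodic :=
  try assumption;
  lazymatch goal with
  | |- smooth_periodic (fun s => @?f s + @?g s) => apply (smooth_periodic_plus f g);
      solve_smooth_periodic
  | |- smooth_periodic (fun s => @?f s - @?g s) => apply (smooth_periodic_minus f g);
      solve_smooth_periodic
  | |- smooth_periodic (fun s => @?f s * @?g s) => apply (smooth_periodic_mult f g);
      solve_smooth_periodic
  | |- smooth_periodic (fun s => - @?f s) => apply (smooth_periodic_opp f); solve_smooth_periodic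
  | |- smooth_periodic (fun _ => ?c) => apply (smooth_periodic_const c)
  | |- smooth_periodic (fun s => Derive ?f s) => apply (smooth_periodic_Derive f);
      solve_smooth_periodic
  | |- smooth_periodic (Derive ?f) => apply (smooth_periodic_Derive f); solve_smooth_periodic
  | |- smooth_periodic (fun s => ?f s) => change (smooth_periodic f); solve_smooth_periodic
  | |- _ => idtac
  end.

Lemma smooth_periodic_ext f g : (forall s, f s = g s) -> smooth_periodic f -> smooth_periodic g.
Proof. intros H. now replace g with f by now extensionality s. Qed.

Definition circle_int (f : R -> R) : R := RInt f 0 (2 * PI).

Lemma circle_int_ext f g : (forall s, f s = g s) -> circle_int f = circle_int g.
Proof. intros H. unfold circle_int. now replace g with f by now extensionality s. Qed.

Lemma circle_int_plus f g : smooth1 f -> smooth1 g -> circle_int (fun s => f s + g s) =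
    circle_int f + circle_int g.
Proof.
  intros Hf Hg. apply (RInt_plus (V:=R_CompleteNormedModule)); now apply smooth1_ex_RInt.
Qed.

Lemma circle_int_scal c f : smooth1 f -> circle_int (fun s => c * f s) = c * circle_int f.
Proof. intros Hf. apply (RInt_scal (V:=R_CompleteNormedModule)). now apply smooth1_ex_RInt. Qed.

Lemma circle_int_Derive f : smooth_periodic f -> circle_int (Derive f) = 0.
Proof.
  intros [Hs Hp]. unfold circle_int. rewrite RInt_Derive.
  - rewrite <- (Rplus_0_l (2 * PI)), Hp. ring.
  - intros x _. now apply smooth1_ex.
  - intros x _. now apply smooth1_continuous, smooth1_Derive.
Qed.

(** The form in which integration by parts is used: naming the periodic boundary function [w]
    reduces an equality of integrals to a pointwise identity. *)
Lemma circle_int_eq f g w : smooth1 g -> smooth_periodic w -> (forall s, f s =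
    g s + Derive w s) -> circle_int f = circle_int g.
Proof.
  intros Hg Hw H.
  rewrite (circle_int_ext _ _ H), (circle_int_plus g (Derive w) Hg (smooth1_Derive w (proj1
      Hw))), (circle_int_Derive w Hw). ring.
Qed.

Lemma D_plus f g s : smooth1 f -> smooth1 g -> Derive (fun s => f s + g s) s =
    Derive f s + Derive g s.
Proof. intros; apply Derive_plus; now apply smooth1_ex. Qed.
Lemma D_minus f g s : smooth1 f -> smooth1 g -> Derive (fun s => f s - g s) s =
    Derive f s - Derive g s.
Proof. intros; apply Derive_minus; now apply smooth1_ex. Qed.
Lemma D_mult f g s : smooth1 f -> smooth1 g ->
  Derive (fun s => f s * g s) s = Derive f s * g s + f s * Derive g s.
Proof. intros; apply Derive_mult; now apply smooth1_ex. Qed.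

(** * Plane curves *)

Definition xcoord (f : R -> C) : R -> R := fun s => fst (f s).
Definition ycoord (f : R -> C) : R -> R := fun s => snd (f s).

(* [phi g X] is the variation of the tangent angle of [g] along [X]; for
   [X = lambda T + mu N] it equals [mu_s + k lambda]. *)
Definition phi (g X : R -> C) : R -> R := fun s => dot (CDerive X s) (normal_of g s).

Lemma loop_iff f : loop f <-> smooth_periodic (xcoord f) /\ smooth_periodic (ycoord f).
Proof.
  unfold loop, smooth, smooth_periodic, smooth1, xcoord, ycoord. split.
  - intros [Hs Hp]. repeat split; try apply Hs; intros s; now rewrite Hp.
  - intros [[H1 P1] [H2 P2]]. repeat split; auto.
    intros s. apply injective_projections; auto.
Qed.

Section Curve.
Variable g : R -> C.
Let x' := Derive (xcoord g).
Let y' := Derive (ycoord g).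

Lemma curvature_coord s :
  curvature g s = x' s * Derive y' s - y' s * Derive x' s.
Proof.
  change (Derive x' s * (0 * x' s - 1 * y' s) + Derive y' s * (0 * y' s + 1 * x' s)
    = x' s * Derive y' s - y' s * Derive x' s). ring.
Qed.

Lemma lam_coord X s : lam g X s = xcoord X s * x' s + ycoord X s * y' s.
Proof. reflexivity. Qed.

Lemma mu_coord X s : mu g X s = ycoord X s * x' s - xcoord X s * y' s.
Proof.
  change (xcoord X s * (0 * x' s - 1 * y' s) + ycoord X s * (0 * y' s + 1 * x' s)
    = ycoord X s * x' s - xcoord X s * y' s). ring.
Qed.

Lemma phi_coord X s : phi g X s = Derive (ycoord X) s * x' s - Derive (xcoord X) s * y' s.
Proof.
  change (Derive (xcoord X) s * (0 * x' s - 1 * y' s) + Derive (ycoord X) s * (0 * y' s + 1 * x' s)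
    = Derive (ycoord X) s * x' s - Derive (xcoord X) s * y' s). ring.
Qed.

Hypothesis Hg : loop g.

Lemma smooth_periodic_x' : smooth_periodic x'. Proof. apply loop_iff in Hg.
  now apply smooth_periodic_Derive. Qed.
Lemma smooth_periodic_y' : smooth_periodic y'. Proof. apply loop_iff in Hg.
  now apply smooth_periodic_Derive. Qed.

Lemma smooth_periodic_curvature : smooth_periodic (curvature g).
Proof.
  apply (smooth_periodic_ext _ _ (fun s => eq_sym (curvature_coord s))).
  pose proof smooth_periodic_x'; pose proof smooth_periodic_y'. solve_smooth_periodic.
Qed.

Lemma smooth_periodic_lam X : loop X -> smooth_periodic (lam g X).
Proof.
  intros HX. apply loop_iff in HX. destruct HX.
  apply (smooth_periodic_ext _ _ (fun s => eq_sym (lam_coord X s))).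
  pose proof smooth_periodic_x'; pose proof smooth_periodic_y'. solve_smooth_periodic.
Qed.

Lemma smooth_periodic_mu X : loop X -> smooth_periodic (mu g X).
Proof.
  intros HX. apply loop_iff in HX. destruct HX.
  apply (smooth_periodic_ext _ _ (fun s => eq_sym (mu_coord X s))).
  pose proof smooth_periodic_x'; pose proof smooth_periodic_y'. solve_smooth_periodic.
Qed.

Lemma smooth_periodic_phi X : loop X -> smooth_periodic (phi g X).
Proof.
  intros HX. apply loop_iff in HX. destruct HX.
  apply (smooth_periodic_ext _ _ (fun s => eq_sym (phi_coord X s))).
  pose proof smooth_periodic_x'; pose proof smooth_periodic_y'. solve_smooth_periodic.
Qed.

Hypothesis Hu : forall s, dot (CDerive g s) (CDerive g s) = 1.

Lemma unit_speed s : x' s * x' s + y' s * y' s = 1.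
Proof. exact (Hu s). Qed.

Lemma speed_orth s : x' s * Derive x' s + y' s * Derive y' s = 0.
Proof.
  pose proof (proj1 smooth_periodic_x') as Hx; pose proof (proj1 smooth_periodic_y') as Hy.
  assert (E : Derive (fun s => x' s * x' s + y' s * y' s) s = 0).
  { rewrite (Derive_ext _ _ s unit_speed). apply Derive_const. }
  rewrite D_plus, !D_mult in E by solve_smooth1. lra.
Qed.

Lemma frenet_x s : Derive x' s = - curvature g s * y' s.
Proof.
  rewrite curvature_coord. pose proof (unit_speed s) as U. pose proof (speed_orth s) as O.
  (* A factor 1 is expanded as the squared speed; the remaining difference is a multiple of the
     orthogonality of velocity and acceleration. *)
  transitivity ((x' s * x' s + y' s * y' s) * Derive x' s); [rewrite U; ring|].
  apply Rminus_diag_uniq.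
  transitivity (x' s * (x' s * Derive x' s + y' s * Derive y' s)); [ring | rewrite O; ring].
Qed.

Lemma frenet_y s : Derive y' s = curvature g s * x' s.
Proof.
  rewrite curvature_coord. pose proof (unit_speed s) as U. pose proof (speed_orth s) as O.
  transitivity ((x' s * x' s + y' s * y' s) * Derive y' s); [rewrite U; ring|].
  apply Rminus_diag_uniq.
  transitivity (y' s * (x' s * Derive x' s + y' s * Derive y' s)); [ring | rewrite O; ring].
Qed.

Lemma Derive_mu X s : loop X -> Derive (mu g X) s = phi g X s - curvature g s * lam g X s.
Proof.
  intros HX. apply loop_iff in HX. destruct HX as [[H1 _] [H2 _]].
  pose proof (proj1 smooth_periodic_x') as Hx; pose proof (proj1 smooth_periodic_y') as Hy.
  rewrite (Derive_ext _ _ s (mu_coord X)).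
  rewrite D_minus, !D_mult by solve_smooth1. rewrite frenet_x, frenet_y, phi_coord, lam_coord. ring.
Qed.

Lemma Derive_lam X s : loop X -> Derive (lam g X) s =
  curvature g s * mu g X s + (Derive (xcoord X) s * x' s + Derive (ycoord X) s * y' s).
Proof.
  intros HX. apply loop_iff in HX. destruct HX as [[H1 _] [H2 _]].
  pose proof (proj1 smooth_periodic_x') as Hx; pose proof (proj1 smooth_periodic_y') as Hy.
  rewrite (Derive_ext _ _ s (lam_coord X)).
  rewrite D_plus, !D_mult by solve_smooth1. rewrite frenet_x, frenet_y, mu_coord. ring.
Qed.

(** Tangency is the linearized unit-speed condition. In this form it involves no curvature and can
    be checked on coordinates. *)
Lemma tangent_iff X : tangent_Mhat g X <->
  loop X /\ forall s, Derive (xcoord X) s * x' s + Derive (ycoord X) s * y' s = 0.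
Proof.
  unfold tangent_Mhat. split; intros [HX H]; split; trivial; intros s; specialize (H s);
    rewrite Derive_lam in * by assumption; lra.
Qed.

(** [X_s] has no tangential part, so it is [phi] times the normal; this is its first coordinate. *)
Lemma tangent_x X s : tangent_Mhat g X -> Derive (xcoord X) s = - phi g X s * y' s.
Proof.
  intros HX. apply tangent_iff in HX. destruct HX as [_ H]. specialize (H s).
  rewrite phi_coord. pose proof (unit_speed s) as U.
  transitivity ((x' s * x' s + y' s * y' s) * Derive (xcoord X) s); [rewrite U; ring|].
  apply Rminus_diag_uniq.
  transitivity (x' s * (Derive (xcoord X) s * x' s + Derive (ycoord X) s * y' s));
      [ring | rewrite H; ring].
Qed.

Lemma tangent_y X s : tangent_Mhat g X -> Derive (ycoord X) s = phi g X s * x' s.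
Proof.
  intros HX. apply tangent_iff in HX. destruct HX as [_ H]. specialize (H s).
  rewrite phi_coord. pose proof (unit_speed s) as U.
  transitivity ((x' s * x' s + y' s * y' s) * Derive (ycoord X) s); [rewrite U; ring|].
  apply Rminus_diag_uniq.
  transitivity (y' s * (Derive (xcoord X) s * x' s + Derive (ycoord X) s * y' s));
      [ring | rewrite H; ring].
Qed.

End Curve.

Lemma dp_on_dpE p g u s : dp_on p g s = dpE p (fun q => curvature g (snd q)) (u, s).
Proof.
  unfold dp_on, dpE. f_equal. extensionality j. unfold jet.
  rewrite <- Derive_n_slice. reflexivity.
Qed.

Lemma smooth_periodic_dp_on p g : loop g -> smooth_periodic (dp_on p g).
Proof.
  intros Hg. pose proof (smooth_periodic_curvature g Hg) as [Hs Hp].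
  apply (smooth_periodic_ext (fun s => dpE p (fun q => curvature g (snd q)) (0, 0, 0, s))).
  - intros s. symmetry. apply dp_on_dpE.
  - split.
    + now apply smooth1_slice, smooth_dpE, smooth_of_smooth1.
    + intros s. apply (periodic_dpE p (fun q => curvature g (snd q))). intros u t. apply Hp.
Qed.

Lemma Derive_dp_on p g s : loop g -> Derive (dp_on p g) s = dp_on (dp_D p) g s.
Proof.
  intros Hg. pose proof (smooth_periodic_curvature g Hg) as [Hs Hp].
  rewrite (dp_on_dpE _ _ (0, 0, 0)), <- pd3_dpE by now apply smooth_of_smooth1.
  rewrite <- Derive_slice. apply Derive_ext. intros t. apply dp_on_dpE.
Qed.

(** * Families of curves *)

Section Family.
Variable G : pt -> C.
Let Gx : pt -> R := fun p => fst (G p).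
Let Gy : pt -> R := fun p => snd (G p).
Hypothesis HGx : smooth_pt Gx.
Hypothesis HGy : smooth_pt Gy.
Hypothesis PG : forall u s, G (u, s + 2 * PI) = G (u, s).

Let curve (u : R * R * R) : R -> C := fun s => G (u, s).

Definition curvature_pt : pt -> R := fun q =>
  pd 3 Gx q * pd 3 (pd 3 Gy) q - pd 3 Gy q * pd 3 (pd 3 Gx) q.

Lemma curvature_family u s : curvature (curve u) s = curvature_pt (u, s).
Proof.
  rewrite curvature_coord. unfold curvature_pt. rewrite <- !Derive_slice.
  unfold xcoord, ycoord, curve.
  assert (E : forall f : pt -> R, Derive (Derive (fun t => f (u, t))) s =
      Derive (fun t => pd 3 f (u, t)) s).
  { intros f. apply Derive_ext. intros t. apply Derive_slice. }
  now rewrite (E (fun p => fst (G p))), (E (fun p => snd (G p))).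
Qed.

Lemma smooth_curvature_pt : smooth_pt curvature_pt.
Proof. apply smooth_minus; apply smooth_mult; repeat apply smooth_pd; assumption. Qed.

Lemma periodic_Gx : periodic_pt Gx.
Proof. intros u s. unfold Gx. now rewrite PG. Qed.
Lemma periodic_Gy : periodic_pt Gy.
Proof. intros u s. unfold Gy. now rewrite PG. Qed.

Lemma periodic_curvature_pt : periodic_pt curvature_pt.
Proof.
  intros u s. unfold curvature_pt.
  now rewrite !(periodic_pd _ _ (periodic_pd _ _ periodic_Gx)),
    !(periodic_pd _ _ (periodic_pd _ _ periodic_Gy)),
    !(periodic_pd _ _ periodic_Gx), !(periodic_pd _ _ periodic_Gy).
Qed.

Lemma dp_on_family p u s : dp_on p (curve u) s = dpE p curvature_pt (u, s).
Proof.
  unfold dp_on, dpE. f_equal. extensionality j. unfold jet.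
  rewrite <- Derive_n_slice. apply Derive_n_ext. apply curvature_family.
Qed.

Lemma Hhat_family p u s : Hhat p (curve u) = circle_int_pt (dpE p curvature_pt) (u, s).
Proof. unfold Hhat, circle_int_pt. apply RInt_ext. intros t _. apply dp_on_family. Qed.

Lemma loop_velocity i u : loop (velocity G i u).
Proof.
  apply loop_iff. split; split.
  - apply (smooth1_slice (pd i Gx) u), smooth_pd, HGx.
  - apply (periodic_pd _ i periodic_Gx u).
  - apply (smooth1_slice (pd i Gy) u), smooth_pd, HGy.
  - apply (periodic_pd _ i periodic_Gy u).
Qed.

(** The variation rotates the tangent at the rate [phi], and the curvature is the arc-length
    derivative of the tangent angle. Unit speed is required only of the curve at the parameter
    [u]. *)
Lemma pd_curvature_pt i u s : Mhat (curve u) -> tangent_Mhat (curve u) (velocity G i u) ->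
  pd i curvature_pt (u, s) = Derive (phi (curve u) (velocity G i u)) s.
Proof.
  intros [Hl Hu] HT.
  pose proof (smooth_periodic_x' _ Hl) as [Sx _]. pose proof (smooth_periodic_y' _ Hl) as [Sy _].
  pose proof (proj1 HT) as HX. apply loop_iff in HX. destruct HX as [[SX _] [SY _]].
  rewrite (Derive_ext _ _ s (phi_coord _ _)).
  rewrite D_minus, !D_mult by solve_smooth1.
  pose proof (tangent_x _ Hl Hu _ s HT) as TX. pose proof (tangent_y _ Hl Hu _ s HT) as TY.
  pose proof (frenet_x _ Hl Hu s) as FX. pose proof (frenet_y _ Hl Hu s) as FY.
  rewrite TX, TY.
  unfold curvature_pt.
  rewrite pd_minus, !pd_mult by (try apply smooth_mult; repeat apply smooth_pd; assumption).
  rewrite !(pd_comm _ i 3) by (repeat apply smooth_pd; assumption).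
  assert (E1 : forall f : pt -> R, pd 3 f (u, s) = Derive (fun t => f (u, t)) s).
  { intros f. now rewrite Derive_slice. }
  assert (E2 : forall f : pt -> R, pd 3 (pd 3 f) (u, s) = Derive (Derive (fun t => f (u, t))) s).
  { intros f. rewrite E1. apply Derive_ext. intros t. now rewrite Derive_slice. }
  rewrite !E2, !E1.
  change (fun t => Gx (u, t)) with (xcoord (curve u)).
  change (fun t => Gy (u, t)) with (ycoord (curve u)).
  change (fun t => pd i Gx (u, t)) with (xcoord (velocity G i u)).
  change (fun t => pd i Gy (u, t)) with (ycoord (velocity G i u)).
  rewrite TX, TY, FX, FY. ring.
Qed.

Lemma pd_Hhat_family p i u s : (i < 3)%nat ->
  Mhat (curve u) -> tangent_Mhat (curve u) (velocity G i u) ->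
  pd i (circle_int_pt (dpE p curvature_pt)) (u, s) =
  circle_int (fun t => dp_on (dp_euler p) (curve u) t * Derive (phi (curve u) (velocity G i u)) t).
Proof.
  intros Hi HM HT.
  rewrite pd_circ_dpE by (try apply smooth_curvature_pt; try apply periodic_curvature_pt; trivial).
  unfold circle_int_pt, circle_int. apply RInt_ext. intros t _. cbn [fst].
  rewrite dp_on_family. now rewrite pd_curvature_pt.
Qed.

End Family.

(** The straight line through [g] along [X] in general leaves [Mhat]. Only the derivative at
    parameter 0 is wanted, where the curve has unit speed and the velocity is tangent, and
    [pd_Hhat_family] asks for no more. *)
Lemma dHhat_formula p g X : Mhat g -> tangent_Mhat g X ->
  dHhat p g X = circle_int (fun t => dp_on (dp_euler p) g t * Derive (phi g X) t).
Proof.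
  intros HM HT.
  pose proof (proj1 (loop_iff g) (proj1 HM)) as [[Sx Px] [Sy Py]].
  pose proof (proj1 (loop_iff X) (proj1 HT)) as [[SX PX] [SY PY]].
  set (u0 := fun p : pt => fst (fst (fst p))).
  assert (Hu0 : smooth_pt u0).
  { apply (smooth_coind (fun f => f = u0 \/ exists c, f = fun _ => c)); [|now left].
    intros f [-> | [c ->]]; repeat split.
    - intros q. apply (continuous_comp (fun p : pt => fst (fst p)) fst).
      + apply (continuous_comp (fun p : pt => fst p) fst); apply continuous_fst.
      + apply continuous_fst.
    - intros i [[[a b] c] s]. unfold u0. destruct i as [|[|[|i]]]; simpl; auto_derive; exact I.
    - intros i. right. destruct i as [|i].
      + exists 1. extensionality q. destruct q as [[[a b] c] s]. unfold pd, u0. simpl.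
        apply is_derive_unique. auto_derive; [exact I | ring].
      + exists 0. extensionality q. destruct q as [[[a b] c] s]. unfold pd, u0.
        destruct i as [|[|i]]; simpl; apply Derive_const.
    - intros q. apply continuous_const.
    - intros i q. apply ex_derive_const.
    - intros i. right. exists 0. apply pd_const. }
  pose (G := fun p : pt => (g (snd p) + RtoC (u0 p) * X (snd p))%C).
  assert (Ex : (fun p => fst (G p)) = fun p => xcoord g (snd p) + u0 p * xcoord X (snd p)).
  { extensionality p0. unfold G, xcoord; simpl. ring. }
  assert (Ey : (fun p => snd (G p)) = fun p => ycoord g (snd p) + u0 p * ycoord X (snd p)).
  { extensionality p0. unfold G, ycoord; simpl. ring. }
  assert (HGx : smooth_pt (fun p => fst (G p))).
  { rewrite Ex. apply smooth_plus; [|apply smooth_mult]; trivial; now apply smooth_of_smooth1. }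
  assert (HGy : smooth_pt (fun p => snd (G p))).
  { rewrite Ey. apply smooth_plus; [|apply smooth_mult]; trivial; now apply smooth_of_smooth1. }
  assert (PG : forall u s, G (u, s + 2 * PI) = G (u, s)).
  { intros u s. unfold G, u0; simpl. now rewrite (proj2 (proj1 HM)), (proj2 (proj1 HT)). }
  assert (E0 : (fun s => G (0, 0, 0, s)) = g).
  { extensionality s. unfold G, u0; simpl. apply injective_projections; simpl; ring. }
  assert (EV : velocity G 0 (0, 0, 0) = X).
  { extensionality s. unfold velocity. rewrite Ex, Ey. unfold pd, u0. simpl.
    apply injective_projections; simpl; apply is_derive_unique; auto_derive; trivial;
        unfold xcoord, ycoord; ring. }
  pose proof (pd_Hhat_family G HGx HGy PG p 0 (0, 0, 0) 0) as H.
  cbv beta zeta in H. rewrite E0, EV in H. rewrite <- H by (trivial; lia).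
  unfold dHhat, pd. apply Derive_ext. intros e. simpl.
  rewrite <- Hhat_family. f_equal. extensionality s. unfold G, u0; simpl.
  now rewrite Rplus_0_l.
Qed.

Section DensitiesGeometry.
Variable h : nat -> dpoly.
Hypothesis Hh : mkdv_densities h.

(** Integration by parts moves the derivative from [phi] to the variational derivative of [h (S n)],
    whose own derivative is half of [mkdv_rhs n]; hence the factor [- / 2]. *)
Lemma dHhat_density n g X : Mhat g -> tangent_Mhat g X ->
  dHhat (h (S n)) g X = - / 2 * circle_int (fun t => dp_on (mkdv_rhs n) g t * phi g X t).
Proof.
  intros HM HT. rewrite dHhat_formula by assumption.
  pose proof (smooth_periodic_dp_on (dp_euler (h (S n))) g (proj1 HM)) as [S1 P1].
  pose proof (smooth_periodic_dp_on (mkdv_rhs n) g (proj1 HM)) as [S2 P2].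
  pose proof (smooth_periodic_phi g (proj1 HM) X (proj1 HT)) as [S3 P3].
  rewrite <- circle_int_scal by solve_smooth1.
  apply (circle_int_eq _ _ (fun t => dp_on (dp_euler (h (S n))) g t * phi g X t)).
  - solve_smooth1.
  - apply smooth_periodic_mult; split; assumption.
  - intros s. rewrite D_mult by assumption. rewrite Derive_dp_on by apply HM.
    destruct Hh as [_ Hn]. unfold dp_on at 2. rewrite (Hn n). cbn [dp_eval].
    unfold dp_on. field.
Qed.

End DensitiesGeometry.

Lemma velocity_tangent G u i : (i < 3)%nat -> smooth_pt (fun p => fst (G p)) ->
  smooth_pt (fun p => snd (G p)) -> (forall u, Mhat (fun s => G (u, s))) ->
  tangent_Mhat (fun s => G (u, s)) (velocity G i u).
Proof.
  intros Hi HGx HGy HM.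
  assert (PG : forall u s, G (u, s + 2 * PI) = G (u, s)).
  { intros v s. apply (proj2 (proj1 (HM v)) s). }
  destruct (HM u) as [Hl Hu].
  apply (tangent_iff _ Hl Hu). split; [now apply loop_velocity|]. intros s.
  set (Gx := fun p => fst (G p)) in *. set (Gy := fun p => snd (G p)) in *.
  assert (E : (fun q => pd 3 Gx q * pd 3 Gx q + pd 3 Gy q * pd 3 Gy q) = fun _ => 1).
  { extensionality q. destruct q as [v t]. rewrite <- !Derive_slice. apply (proj2 (HM v) t). }
  assert (E' : pd i (fun q => pd 3 Gx q * pd 3 Gx q + pd 3 Gy q * pd 3 Gy q) (u, s) = 0).
  { rewrite E. now rewrite pd_const. }
  rewrite pd_plus, !pd_mult in E' by (try apply smooth_mult; repeat apply smooth_pd; assumption).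
  rewrite !(pd_comm _ i 3) in E' by assumption. rewrite <- !Derive_slice in E'.
  change (Derive (fun t => pd i Gx (u, t)) s * Derive (fun t => Gx (u, t)) s +
          Derive (fun t => pd i Gy (u, t)) s * Derive (fun t => Gy (u, t)) s = 0).
  lra.
Qed.

(** Along a plot the Hamiltonians are constant, so their parameter derivatives, given by the first
    variation formula, vanish. *)
Lemma velocity_tangent_level h c m G u i : (i < 3)%nat -> plot (level h c m) G ->
  tangent_level h m (fun s => G (u, s)) (velocity G i u).
Proof.
  intros Hi [HGx [HGy HL]].
  assert (HM : forall u, Mhat (fun s => G (u, s))) by (intros v; apply (HL v)).
  assert (PG : forall u s, G (u, s + 2 * PI) = G (u, s)).
  { intros v s. apply (proj2 (proj1 (HM v)) s). }
  assert (HT := velocity_tangent G u i Hi HGx HGy HM).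
  split; [exact HT|]. intros a Ha.
  rewrite dHhat_formula by trivial.
  rewrite <- (pd_Hhat_family G HGx HGy PG (h a) i u 0) by trivial.
  replace (circle_int_pt (dpE (h a) (curvature_pt G))) with (fun _ : pt => c a).
  - now rewrite pd_const.
  - extensionality q. destruct q as [v t]. rewrite <- Hhat_family.
    symmetry. now apply (HL v).
Qed.

(** * Chains of the recursion operator *)

(* The recursion operator is [D P / 2] with [P = D + k D^-1 k]; in a chain
   [f = P m], where [p] is the chosen primitive of [k m]. *)
Definition chain (k : R -> R) (p m f : nat -> R -> R) : Prop :=
  forall a, (smooth1 (p a) /\ smooth1 (m a) /\ smooth1 (f a)) /\
    (forall s, Derive (p a) s = k s * m a s) /\
    (forall s, Derive (m a) s = f a s - k s * p a s) /\
    (forall s, Derive (f a) s = 2 * m (S a) s).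

Definition periodic_upto (N : nat) (p m : nat -> R -> R) : Prop :=
  forall a, (a <= N)%nat -> smooth_periodic (p a) /\ smooth_periodic (m a).

Section Chains.
Variable k : R -> R.
Hypothesis Hk : smooth_periodic k.

Lemma chain_f_smooth_periodic p m f a : chain k p m f -> smooth_periodic (p a) ->
    smooth_periodic (m a) -> smooth_periodic (f a).
Proof.
  intros HC Hp Hm. destruct (HC a) as [_ [_ [E _]]].
  apply (smooth_periodic_ext (fun s => Derive (m a) s + k s * p a s)); [intros s; rewrite E; ring|].
  solve_smooth_periodic.
Qed.

Section Pair.
Variables p m f q n e : nat -> R -> R.
Hypothesis C1 : chain k p m f.
Hypothesis C2 : chain k q n e.

(** Skewness of [P]: the boundary function is [m n + p q], whose second summand accounts for the
    nonlocal part [k D^-1 k]. *)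
Lemma chain_skew a b : smooth_periodic (p a) -> smooth_periodic (m a) -> smooth_periodic (q b) ->
    smooth_periodic (n b) ->
  circle_int (fun s => f a s * n b s) = - circle_int (fun s => m a s * e b s).
Proof.
  intros Hp Hm Hq Hn.
  destruct (C1 a) as [[S1 [S2 S3]] [E1 [E2 _]]]. destruct (C2 b) as [[S4 [S5 S6]] [E4 [E5 _]]].
  replace (- circle_int (fun s => m a s * e b s)) with (-1 * circle_int (fun s => m a s * e b s))
      by ring.
  rewrite <- circle_int_scal by solve_smooth1.
  apply (circle_int_eq _ _ (fun s => m a s * n b s + p a s * q b s));
      [solve_smooth1 | solve_smooth_periodic|].
  intros s. rewrite D_plus, !D_mult by solve_smooth1. rewrite E1, E2, E4, E5. ring.
Qed.

(** Skewness of [D], applied to [f] and [e], whose derivatives are twice the next members of the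
    chains. *)
Lemma chain_step a b : smooth_periodic (p a) -> smooth_periodic (m a) -> smooth_periodic (q b) ->
    smooth_periodic (n b) ->
  circle_int (fun s => f a s * n (S b) s) = - circle_int (fun s => m (S a) s * e b s).
Proof.
  intros Hp Hm Hq Hn.
  destruct (C1 a) as [[S1 [S2 S3]] [_ [_ E3]]]. destruct (C2 b) as [[S4 [S5 S6]] [_ [_ E6]]].
  destruct (C1 (S a)) as [[_ [S2' _]] _].
  replace (- circle_int (fun s => m (S a) s * e b s)) with (-1 * circle_int (fun s => m (S a) s *
      e b s)) by ring.
  rewrite <- circle_int_scal by solve_smooth1.
  pose proof (chain_f_smooth_periodic _ _ _ _ C1 Hp Hm).
    pose proof (chain_f_smooth_periodic _ _ _ _ C2 Hq Hn).
  apply (circle_int_eq _ _ (fun s => / 2 * (f a s * e b s)));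
      [solve_smooth1 | solve_smooth_periodic|].
  intros s. rewrite !D_mult by solve_smooth1. rewrite E3, E6, Derive_const. field.
Qed.

(** Alternating [chain_step] and [chain_skew] carries the index from one chain to the other. The
    value [j = N + 1] is allowed because all factors integrated by parts have indices at most [N];
    the primitives [p] and [q] of index [N + 1] never appear. *)
Lemma chain_antisym N j : periodic_upto N p m -> periodic_upto N q n -> (j <= S N)%nat ->
  circle_int (fun s => f 0%nat s * n j s) = - circle_int (fun s => e 0%nat s * m j s).
Proof.
  intros P1 P2 Hj.
  assert (SW : forall a b, circle_int (fun s => m a s * e b s) =
      circle_int (fun s => e b s * m a s)).
  { intros a b. apply circle_int_ext. intros s. ring. }
  assert (step : forall a b, (a <= N)%nat -> (b <= N)%nat ->
    circle_int (fun s => f a s * n (S b) s) = - circle_int (fun s => m (S a) s * e b s)).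
  { intros a b Ha Hb. destruct (P1 a Ha), (P2 b Hb). now apply chain_step. }
  assert (skew : forall a b, (a <= N)%nat -> (b <= N)%nat ->
    circle_int (fun s => f a s * n b s) = - circle_int (fun s => m a s * e b s)).
  { intros a b Ha Hb. destruct (P1 a Ha), (P2 b Hb). now apply chain_skew. }
  destruct j as [|j].
  - rewrite skew by lia. now rewrite SW.
  - assert (H : forall c, (c <= j)%nat ->
      circle_int (fun s => f 0%nat s * n (S j) s) =
          - circle_int (fun s => m (S c) s * e (j - c)%nat s)).
    { induction c as [|c IH]; intros Hc.
      - rewrite Nat.sub_0_r. apply step; lia.
      - rewrite IH by lia. replace (j - c)%nat with (S (j - S c)) by lia.
        rewrite <- skew by lia. apply step; lia. }
    rewrite (H j) by lia. rewrite Nat.sub_diag. now rewrite SW.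
Qed.

End Pair.

Lemma primitive_periodic p f : smooth1 p -> smooth_periodic f -> (forall s, Derive p s = f s) ->
    circle_int f = 0 -> smooth_periodic p.
Proof.
  intros Hp [Hf Pf] E H0. split; [exact Hp|]. intros s.
  assert (HI : forall a b, RInt f a b = p b - p a).
  { intros a b. rewrite <- RInt_Derive.
    - apply RInt_ext. intros t _. now rewrite E.
    - intros t _. now apply smooth1_ex.
    - intros t _. now apply smooth1_continuous, smooth1_Derive. }
  assert (H1 : p (s + 2 * PI) - p (0 + 2 * PI) = p s - p 0).
  { rewrite <- (HI 0 s), <- HI.
    (* Translation by one period is a linear substitution of slope 1. *)
    pose proof (RInt_comp_lin (V:=R_CompleteNormedModule) f 1 (2 * PI) 0 s) as HL.
    rewrite !Rmult_1_l in HL. rewrite <- HL by now apply smooth1_ex_RInt.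
    apply RInt_ext. intros t _. rewrite Pf, !Rmult_1_l. reflexivity. }
  unfold circle_int in H0. rewrite HI in H0. rewrite Rplus_0_l in H1. lra.
Qed.

Lemma chain_tail p m f n : chain k p m f ->
  chain k (fun a => p (n + a)%nat) (fun a => m (n + a)%nat) (fun a => f (n + a)%nat).
Proof.
  intros HC a. specialize (HC (n + a)%nat). now rewrite Nat.add_succ_r.
Qed.

Section Translation.
(* The chain of the field [T], which has [p = 1], [m = 0] and [f = k]. *)
Variables tp tm tf : nat -> R -> R.
Hypothesis CT : chain k tp tm tf.
Hypothesis PT : forall a, smooth_periodic (tp a) /\ smooth_periodic (tm a).
Hypothesis ET : forall s, tf 0%nat s = k s.

(** The obstruction to a periodic [p (S M)] is the mean of [k * m (S M)]. Since [k] is the [f] of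
    the translation chain, antisymmetry turns this mean into an integral assumed to vanish. The
    induction advances because [chain_antisym] reaches one index beyond the periodic range. *)
Lemma chain_periodic p m f M : chain k p m f -> smooth_periodic (p 0%nat) ->
    smooth_periodic (m 0%nat) ->
  (forall i, (1 <= i <= M)%nat -> circle_int (fun s => f 0%nat s * tm i s) = 0) ->
  periodic_upto M p m.
Proof.
  intros HC Hp Hm H0. induction M as [|M IH].
  - intros a Ha. assert (a = 0)%nat as -> by lia. now split.
  - assert (P : periodic_upto M p m) by (apply IH; intros i Hi; apply H0; lia).
    intros a Ha. destruct (le_lt_dec a M) as [Ha'|Ha']; [now apply P|].
    assert (a = S M) as -> by lia.
    destruct (HC M) as [[S1 [S2 S3]] [E1 [E2 E3]]].
    destruct (HC (S M)) as [[S1' [S2' S3']] [E1' [E2' E3']]].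
    destruct (P M) as [PM1 PM2]; [lia|].
    pose proof (chain_f_smooth_periodic _ _ _ _ HC PM1 PM2) as PF.
    assert (SM : smooth_periodic (m (S M))).
    { apply (smooth_periodic_ext (fun s => / 2 * Derive (f M) s)); [intros s; rewrite E3;
        field | solve_smooth_periodic]. }
    split; [|exact SM].
    apply (primitive_periodic _ (fun s => k s * m (S M) s)); trivial; [solve_smooth_periodic|].
    rewrite (circle_int_ext _ (fun s => tf 0%nat s * m (S M) s)) by (intros s; now rewrite ET).
    rewrite (chain_antisym _ _ _ _ _ _ CT HC M) by (trivial; try lia; intros b _; apply PT).
    rewrite H0 by lia. ring.
Qed.

(** A tail of the translation chain is paired with itself, and antisymmetry makes the integral equal
    to its own negative. This is the involution of the conserved quantities. *)
Lemma translation_involution a b : circle_int (fun s => tf a s * tm b s) = 0.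
Proof.
  assert (P : forall c N, periodic_upto N (fun a => tp (c + a)%nat) (fun a => tm (c + a)%nat)).
  { intros c N i _. apply PT. }
  assert (H1 : forall a j, circle_int (fun s => tf a s * tm (a + j)%nat s) = 0).
  { intros c j. pose proof (chain_tail _ _ _ c CT) as CC.
    pose proof (chain_antisym _ _ _ _ _ _ CC CC j j (P c j) (P c j) (Nat.le_succ_diag_r j)) as H.
    cbv beta in H. rewrite Nat.add_0_r in H. lra. }
  destruct (le_lt_dec a b) as [H|H].
  - replace b with (a + (b - a))%nat by lia. apply H1.
  (* For [b < a] skewness alone, the case [j = 0], exchanges the two indices. *)
  - pose proof (chain_antisym _ _ _ _ _ _ (chain_tail _ _ _ a CT) (chain_tail _ _ _ b CT)
      0 0 (P a 0%nat) (P b 0%nat) (Nat.le_succ_diag_r 0)) as E.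
    cbv beta in E. rewrite !Nat.add_0_r in E. rewrite E.
    replace a with (b + (a - b))%nat by lia. rewrite H1. ring.
Qed.

End Translation.

(** ** The primitives [kdv_prim] *)

Section Prims.
Variable av : nat -> C.
Variables la ma : R -> R.
Hypothesis Hla : smooth1 la.
Hypothesis Hma : smooth1 ma.
Hypothesis Ela : forall s, Derive la s = k s * ma s.

Let half_D_P (p m : R -> R) : R -> R := fun s => / 2 * Derive (fun t => Derive m t + k t * p t) s.
Let next (c : R) (m : R -> R) : R -> R := fun s => c + RInt (fun t => k t * m t) 0 s.

(* [(p, m)] starts at [(la, ma)], [(q, n)] at [(0, 0)]; the integration constants
   are chosen such that [kdv_prim] is [(p - n) + i (q + m)]. *)
Fixpoint prim_chains (i : nat) : (R -> R) * (R -> R) * (R -> R) * (R -> R) :=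
  match i with
  | O => (la, ma, fun _ => 0, fun _ => 0)
  | S i' =>
      match prim_chains i' with
      | (p, m, q, n) =>
          let m' := half_D_P p m in
          let n' := half_D_P q n in
          (next (fst (av i) + n' 0) m', m', next (snd (av i) - m' 0) n', n')
      end
  end.

Let qp i := fst (fst (fst (prim_chains i))).
Let qm i := snd (fst (fst (prim_chains i))).
Let qq i := snd (fst (prim_chains i)).
Let qn i := snd (prim_chains i).

Lemma smooth1_half_D_P p m : smooth1 p -> smooth1 m -> smooth1 (half_D_P p m).
Proof. intros Hp Hm. destruct Hk as [Sk _]. unfold half_D_P.
  apply (smooth1_mult (fun _ => / 2)); [apply smooth1_const|].
  apply (smooth1_Derive (fun t => Derive m t + k t * p t)). solve_smooth1. Qed.

Lemma smooth1_next c m : smooth1 m -> smooth1 (next c m).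
Proof.
  intros Hm. destruct Hk as [Sk _]. unfold next.
  apply (smooth1_plus (fun _ => c)); [apply smooth1_const|].
  apply (smooth1_prim (fun t => k t * m t)). solve_smooth1.
Qed.

Lemma Derive_next c m s : smooth1 m -> Derive (next c m) s = k s * m s.
Proof.
  intros Hm. destruct Hk as [Sk _]. unfold next.
  assert (Sm : smooth1 (fun t => k t * m t)) by solve_smooth1.
  rewrite (D_plus _ _ s (smooth1_const c) (smooth1_prim _ Sm)).
  rewrite Derive_const, Derive_prim by assumption. ring.
Qed.

Lemma quad_sm i : (smooth1 (qp i) /\ smooth1 (qm i)) /\ (smooth1 (qq i) /\ smooth1 (qn i)).
Proof.
  induction i as [|i [[S1 S2] [S3 S4]]].
  - split; split; [exact Hla | exact Hma | apply (smooth1_const 0) | apply (smooth1_const 0)].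
  - unfold qp, qm, qq, qn in *. cbn [prim_chains]. destruct (prim_chains i) as [[[p m] q] n].
    cbn [fst snd] in *.
    pose proof (smooth1_half_D_P p m S1 S2). pose proof (smooth1_half_D_P q n S3 S4).
    split; split; trivial; now apply smooth1_next.
Qed.

Lemma quad_S i :
  qm (S i) = half_D_P (qp i) (qm i) /\ qn (S i) = half_D_P (qq i) (qn i) /\
  qp (S i) = next (fst (av (S i)) + qn (S i) 0) (qm (S i)) /\
  qq (S i) = next (snd (av (S i)) - qm (S i) 0) (qn (S i)).
Proof.
  unfold qp, qm, qq, qn. cbn [prim_chains]. destruct (prim_chains i) as [[[p m] q] n].
    now cbn [fst snd].
Qed.

Lemma chain_of_pm p m : (forall i, smooth1 (p i) /\ smooth1 (m i)) ->
  (forall i s, Derive (p i) s = k s * m i s) ->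
  (forall i, m (S i) = half_D_P (p i) (m i)) ->
  chain k p m (fun i s => Derive (m i) s + k s * p i s).
Proof.
  intros HS E1 E2 a. destruct (HS a) as [S1 S2]. destruct Hk as [Sk _].
  repeat split; trivial.
  - solve_smooth1.
  - intros s. ring.
  - intros s. rewrite E2. unfold half_D_P. field.
Qed.

Lemma quad_D i s : Derive (qp i) s = k s * qm i s /\ Derive (qq i) s = k s * qn i s.
Proof.
  destruct i as [|i].
  - split; [apply Ela|]. unfold qq, qn; simpl. rewrite Derive_const. ring.
  - destruct (quad_S i) as [_ [_ [E3 E4]]]. destruct (quad_sm (S i)) as [[_ S2] [_ S4]].
    rewrite E3, E4. now split; apply Derive_next.
Qed.

Lemma chain_pm : chain k qp qm (fun i s => Derive (qm i) s + k s * qp i s).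
Proof.
  apply chain_of_pm.
  - intros i. exact (proj1 (quad_sm i)).
  - intros i s. exact (proj1 (quad_D i s)).
  - intros i. exact (proj1 (quad_S i)).
Qed.

Lemma chain_qn : chain k qq qn (fun i s => Derive (qn i) s + k s * qq i s).
Proof.
  apply chain_of_pm.
  - intros i. exact (proj2 (quad_sm i)).
  - intros i s. exact (proj2 (quad_D i s)).
  - intros i. exact (proj1 (proj2 (quad_S i))).
Qed.

Let kappa : R -> C := fun s => (/ 4 * k s ^ 2, / 2 * Derive k s).

(* With [b = (p - n) + i (q + m)] and [B = k + i D] one has [b_s = B (m + i n)] and
   [Omega B = B Omegahat]. *)
Lemma Omega_quad i s (b : R -> C) : (forall t, b t = (qp i t - qn i t, qq i t + qm i t)) ->
  Omega kappa b s = (k s * qm (S i) s - Derive (qn (S i)) s, k s * qn (S i) s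
      + Derive (qm (S i)) s).
Proof.
  intros Eb.
  set (bq := fun t : R => (qp i t - qn i t, qq i t + qm i t)).
  replace b with bq by (extensionality t; now rewrite Eb).
  destruct (quad_sm i) as [[S1 S2] [S3 S4]]. destruct (quad_S i) as [Em [En _]].
  destruct Hk as [Sk _].
  assert (F1 : forall t, Derive (fun x => fst (bq x)) t
     = k t * qm i t - Derive (qn i) t).
  { intros t. unfold bq; cbn [fst]. rewrite D_minus by assumption.
    now rewrite (proj1 (quad_D i t)). }
  assert (F2 : forall t, Derive (fun x => snd (bq x)) t
     = k t * qn i t + Derive (qm i) t).
  { intros t. unfold bq; cbn [snd]. rewrite D_plus by assumption.
    now rewrite (proj2 (quad_D i t)). }
  assert (G1 : forall t, Derive (Derive (fun x => fst (bq x))) t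
     = Derive k t * qm i t + k t * Derive (qm i) t - Derive (Derive (qn i)) t).
  { intros t. rewrite (Derive_ext _ _ t F1). rewrite D_minus, D_mult by solve_smooth1. ring. }
  assert (G2 : forall t, Derive (Derive (fun x => snd (bq x))) t
     = Derive k t * qn i t + k t * Derive (qn i) t + Derive (Derive (qm i)) t).
  { intros t. rewrite (Derive_ext _ _ t F2). rewrite D_plus, D_mult by solve_smooth1. ring. }
  assert (H1 : Derive (Derive (Derive (fun x => fst (bq x)))) s
     = Derive (Derive k) s * qm i s + 2 * (Derive k s * Derive (qm i) s)
         + k s * Derive (Derive (qm i)) s
       - Derive (Derive (Derive (qn i))) s).
  { rewrite (Derive_ext _ _ s G1). rewrite D_minus, D_plus, !D_mult by solve_smooth1. ring. }
  assert (H2 : Derive (Derive (Derive (fun x => snd (bq x)))) s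
     = Derive (Derive k) s * qn i s + 2 * (Derive k s * Derive (qn i) s)
         + k s * Derive (Derive (qn i)) s
       + Derive (Derive (Derive (qm i))) s).
  { rewrite (Derive_ext _ _ s G2). rewrite !D_plus, !D_mult by solve_smooth1. ring. }
  assert (K1 : Derive (fun x => fst (kappa x)) s = / 2 * (k s * Derive k s)).
  { unfold kappa; cbn [fst].
    rewrite (Derive_ext _ (fun t => / 4 * (k t * k t))) by (intros t; ring).
    rewrite !D_mult by solve_smooth1. rewrite Derive_const. field. }
  assert (K2 : Derive (fun x => snd (kappa x)) s = / 2 * Derive (Derive k) s).
  { unfold kappa; cbn [snd]. rewrite !D_mult by solve_smooth1. rewrite Derive_const. ring. }
  assert (M1 : forall t (p m : R -> R), smooth1 p -> smooth1 m -> Derive p t = k t * m t ->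
     half_D_P p m t = / 2 * (Derive (Derive m) t + Derive k t * p t + k t * (k t * m t))).
  { intros t p m Hp Hm E. unfold half_D_P. rewrite D_plus, D_mult by solve_smooth1. rewrite E.
    ring. }
  assert (N1 : forall (p m : R -> R), smooth1 p -> smooth1 m -> (forall t, Derive p t =
      k t * m t) ->
     Derive (half_D_P p m) s = / 2 * (Derive (Derive (Derive m)) s + Derive (Derive k) s * p s
       + Derive k s * (k s * m s) + 2 * (k s * Derive k s * m s) + k s * k s * Derive m s)).
  { intros p m Hp Hm E. rewrite (Derive_ext _ _ s (fun t => M1 t p m Hp Hm (E t))).
    rewrite !D_mult, !D_plus, !D_mult by solve_smooth1. rewrite Derive_const, E. ring. }
  pose proof (fun t => proj1 (quad_D i t)) as D1. pose proof (fun t => proj2 (quad_D i t)) as D2.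
  rewrite Em, En, (N1 _ _ S1 S2 D1), (N1 _ _ S3 S4 D2),
    (M1 s _ _ S1 S2 (D1 s)), (M1 s _ _ S3 S4 (D2 s)).
  pose proof (injective_projections (CDerive (CDerive (CDerive bq)) s) (_, _) H1 H2) as CD3.
  pose proof (injective_projections (CDerive bq s) (_, _) (F1 s) (F2 s)) as CD1.
  pose proof (injective_projections (CDerive kappa s) (_, _) K1 K2) as CDk.
  unfold Omega. rewrite CD3, CD1, CDk. unfold bq, kappa.
  apply injective_projections; simpl; field.
Qed.

(** The integrand is [B (m + i n)]: its part with [k] gives the primitives of [k m] and [k n], and
    its part with [i D] integrates to values of [m] and [n]. The contributions of the lower limit 0
    are those compensated by the constants in [prim_chains]. *)
Lemma kdv_prim_quad i s :
  kdv_prim av kappa (fun t => (la t, ma t)) i s = (qp i s - qn i s, qq i s + qm i s).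
Proof.
  revert s. induction i as [|i IH]; intros s.
  - unfold qp, qm, qq, qn; simpl. apply injective_projections; simpl; ring.
  - cbn [kdv_prim].
    assert (EO : forall t, Omega kappa (kdv_prim av kappa (fun t => (la t, ma t)) i) t =
      (k t * qm (S i) t - Derive (qn (S i)) t, k t * qn (S i) t + Derive (qm (S i)) t)).
    { intros t. now apply Omega_quad. }
    destruct (quad_sm (S i)) as [[S1 S2] [S3 S4]]. destruct (quad_S i) as [_ [_ [Ep Eq]]].
    destruct Hk as [Sk _].
    assert (I1 : RInt (fun x => fst (Omega kappa (kdv_prim av kappa (fun t => (la t, ma t)) i)
        x)) 0 s
      = RInt (fun t => k t * qm (S i) t) 0 s - (qn (S i) s - qn (S i) 0)).
    { rewrite (RInt_ext _ (fun t => minus (k t * qm (S i) t) (Derive (qn (S i)) t)))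
        by (intros t _; now rewrite EO).
      rewrite (RInt_minus (V:=R_CompleteNormedModule) (fun t => k t * qm (S i) t)
          (Derive (qn (S i))))
        by (apply smooth1_ex_RInt; solve_smooth1).
      rewrite RInt_Derive; [reflexivity | |].
      - intros t _. now apply smooth1_ex.
      - intros t _. now apply smooth1_continuous, smooth1_Derive. }
    assert (I2 : RInt (fun x => snd (Omega kappa (kdv_prim av kappa (fun t => (la t, ma t)) i)
        x)) 0 s
      = RInt (fun t => k t * qn (S i) t) 0 s + (qm (S i) s - qm (S i) 0)).
    { rewrite (RInt_ext _ (fun t => plus (k t * qn (S i) t) (Derive (qm (S i)) t)))
        by (intros t _; now rewrite EO).
      rewrite (RInt_plus (V:=R_CompleteNormedModule) (fun t => k t * qn (S i) t)
          (Derive (qm (S i))))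
        by (apply smooth1_ex_RInt; solve_smooth1).
      rewrite RInt_Derive; [reflexivity | |].
      - intros t _. now apply smooth1_ex.
      - intros t _. now apply smooth1_continuous, smooth1_Derive. }
    unfold CInt. rewrite I1, I2, Ep, Eq. unfold next.
    apply injective_projections; simpl; ring.
Qed.

(** A real chain can absorb only real integration constants; the second chain, which starts at zero,
    takes up the imaginary ones. *)
Lemma kdv_prim_chain : exists p m f q n e,
  chain k p m f /\ p 0%nat = la /\ m 0%nat = ma /\
  chain k q n e /\ q 0%nat = (fun _ => 0) /\ n 0%nat = (fun _ => 0) /\
  (forall i s, Omega kappa (kdv_prim av kappa (fun t => (la t, ma t)) i) s =
    (k s * m (S i) s - Derive (n (S i)) s, k s * n (S i) s + Derive (m (S i)) s)).
Proof.
  exists qp, qm, (fun i s => Derive (qm i) s + k s * qp i s),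
    qq, qn, (fun i s => Derive (qn i) s + k s * qq i s).
  split; [exact chain_pm|]. split; [reflexivity|]. split; [reflexivity|].
  split; [exact chain_qn|]. split; [reflexivity|]. split; [reflexivity|].
  intros i s. apply Omega_quad. intros t. apply kdv_prim_quad.
Qed.

End Prims.
End Chains.

(** * The forms in terms of chains *)

Section Forms.
Variable h : nat -> dpoly.
Hypothesis Hh : mkdv_densities h.

(* The components of [Xhat n], extended by [Xhat 0 = T]. *)
Definition trans_p (g : R -> C) (n : nat) : R -> R :=
  match n with
  | O => fun _ => 1
  | S n' => fun s => / 2 * dp_on (dp_Dinv (DMul (DVar 0) (mkdv_rhs n'))) g s
  end.

Definition trans_m (g : R -> C) (n : nat) : R -> R :=
  match n with
  | O => fun _ => 0
  | S n' => fun s => / 2 * dp_on (mkdv_rhs n') g s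
  end.

Definition trans_f (g : R -> C) (n : nat) : R -> R :=
  fun s => Derive (trans_m g n) s + curvature g s * trans_p g n s.

Lemma trans_smooth_periodic g a : loop g ->
    smooth_periodic (trans_p g a) /\ smooth_periodic (trans_m g a).
Proof.
  intros Hg. destruct a as [|n]; split; unfold trans_p, trans_m.
  - apply smooth_periodic_const.
  - apply smooth_periodic_const.
  - apply (smooth_periodic_mult (fun _ => / 2));
      [apply smooth_periodic_const | now apply smooth_periodic_dp_on].
  - apply (smooth_periodic_mult (fun _ => / 2));
      [apply smooth_periodic_const | now apply smooth_periodic_dp_on].
Qed.

(** The field [T] has [f = k], and half of [k_s] is the next [m]. From there on the chain recursion
    is [dp_Omegahat], once [mkdv_Dinv] guarantees that the chosen antiderivative is a genuine
    one. *)
Lemma trans_chain g : loop g -> chain (curvature g) (trans_p g) (trans_m g) (trans_f g).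
Proof.
  intros Hg a. pose proof (smooth_periodic_curvature g Hg) as [Sk _].
  destruct (trans_smooth_periodic g a Hg) as [[Sp _] [Sm _]].
  split; [|split; [|split]].
  - repeat split; trivial. unfold trans_f. solve_smooth1.
  - intros s. destruct a as [|n].
    + unfold trans_p, trans_m. rewrite Derive_const. ring.
    + unfold trans_p, trans_m.
      pose proof (smooth_periodic_dp_on (dp_Dinv (DMul (DVar 0) (mkdv_rhs n))) g Hg) as [Sd _].
      rewrite D_mult by solve_smooth1. rewrite Derive_const, Derive_dp_on by assumption.
      unfold dp_on at 2. rewrite (mkdv_Dinv h Hh). unfold dp_on. simpl. ring.
  - intros s. unfold trans_f. ring.
  - intros s. destruct a as [|n].
    + rewrite (Derive_ext (trans_f g 0) (curvature g)).
      * unfold trans_m, dp_on. simpl.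
        transitivity (2 * (/ 2 * Derive (curvature g) s)); [field | reflexivity].
      * intros t. unfold trans_f, trans_m, trans_p. rewrite Derive_const. ring.
    + set (Di := dp_Dinv (DMul (DVar 0) (mkdv_rhs n))).
      pose proof (smooth_periodic_dp_on Di g Hg) as [Sd _].
      pose proof (smooth_periodic_dp_on (mkdv_rhs n) g Hg) as [Sr _].
      pose proof (smooth_periodic_dp_on (dp_D (mkdv_rhs n)) g Hg) as [Sr' _].
      rewrite (Derive_ext (trans_f g (S n))
        (fun t => / 2 * dp_on (dp_D (mkdv_rhs n)) g t + curvature g t * (/ 2 * dp_on Di g t))).
      * rewrite D_plus, !D_mult by solve_smooth1.
        rewrite !Derive_const, !Derive_dp_on by assumption.
        unfold trans_m. change (mkdv_rhs (S n)) with (dp_Omegahat (mkdv_rhs n)).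
        unfold dp_Omegahat. fold Di.
        unfold dp_on. cbn [dp_eval].
        rewrite (mkdv_Dinv h Hh n : forall x, dp_eval (dp_D Di) x = _).
        change (Derive_n (curvature g) 1 s) with (Derive (curvature g) s).
        change (Derive_n (curvature g) 0 s) with (curvature g s). field.
      * intros t. unfold trans_f, trans_m, trans_p. fold Di.
        rewrite D_mult by solve_smooth1. rewrite Derive_const, Derive_dp_on by assumption. ring.
Qed.

Lemma trans_f0 g s : trans_f g 0 s = curvature g s.
Proof. unfold trans_f, trans_m, trans_p. rewrite Derive_const. ring. Qed.

(** In this form tangency to a level set is exactly the vanishing condition in [chain_periodic]. *)
Lemma dHhat_trans i g X : (1 <= i)%nat -> Mhat g -> tangent_Mhat g X ->
  dHhat (h i) g X = - circle_int (fun s => phi g X s * trans_m g i s).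
Proof.
  intros Hi HM HT. destruct i as [|n]; [lia|].
  rewrite (dHhat_density h Hh n g X HM HT).
  pose proof (smooth_periodic_dp_on (mkdv_rhs n) g (proj1 HM)) as [Sr _].
  pose proof (smooth_periodic_phi g (proj1 HM) X (proj1 HT)) as [Sf _].
  unfold trans_m.
  rewrite (circle_int_ext (fun s => phi g X s * (/ 2 * dp_on (mkdv_rhs n) g s))
    (fun s => / 2 * (dp_on (mkdv_rhs n) g s * phi g X s))) by (intros s; ring).
  rewrite circle_int_scal by solve_smooth1. ring.
Qed.

Lemma Xhat_coord n g s : (1 <= n)%nat ->
  xcoord (Xhat n g) s = trans_p g n s * Derive (xcoord g) s - trans_m g n s * Derive (ycoord g) s /\
  ycoord (Xhat n g) s = trans_p g n s * Derive (ycoord g) s + trans_m g n s * Derive (xcoord g) s.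
Proof.
  intros Hn. destruct n as [|n]; [lia|].
  unfold xcoord at 1, ycoord at 2, Xhat. unfold trans_p, trans_m. rewrite Nat.sub_succ, Nat.sub_0_r.
  unfold normal_of, tangent_of.
  change (CDerive g s) with (Derive (xcoord g) s, Derive (ycoord g) s). unfold RtoC.
  split; simpl; ring.
Qed.

Lemma loop_Xhat n g : (1 <= n)%nat -> loop g -> loop (Xhat n g).
Proof.
  intros Hn Hg. apply loop_iff.
  pose proof (smooth_periodic_x' g Hg). pose proof (smooth_periodic_y' g Hg).
  destruct (trans_smooth_periodic g n Hg).
  split.
  - apply (smooth_periodic_ext _ _ (fun s => eq_sym (proj1 (Xhat_coord n g s Hn)))).
    solve_smooth_periodic.
  - apply (smooth_periodic_ext _ _ (fun s => eq_sym (proj2 (Xhat_coord n g s Hn)))).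
    solve_smooth_periodic.
Qed.

Lemma lam_Xhat n g s : (1 <= n)%nat -> Mhat g -> lam g (Xhat n g) s = trans_p g n s.
Proof.
  intros Hn [Hg Hu]. rewrite lam_coord.
  destruct (Xhat_coord n g s Hn) as [-> ->].
  transitivity (trans_p g n s *
    (Derive (xcoord g) s * Derive (xcoord g) s + Derive (ycoord g) s * Derive (ycoord g) s));
        [ring|].
  rewrite (unit_speed g Hu). ring.
Qed.

Lemma mu_Xhat n g s : (1 <= n)%nat -> Mhat g -> mu g (Xhat n g) s = trans_m g n s.
Proof.
  intros Hn [Hg Hu]. rewrite mu_coord.
  destruct (Xhat_coord n g s Hn) as [-> ->].
  transitivity (trans_m g n s *
    (Derive (xcoord g) s * Derive (xcoord g) s + Derive (ycoord g) s * Derive (ycoord g) s));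
        [ring|].
  rewrite (unit_speed g Hu). ring.
Qed.

Lemma tangent_Xhat n g : (1 <= n)%nat -> Mhat g -> tangent_Mhat g (Xhat n g).
Proof.
  intros Hn HM. split; [now apply loop_Xhat; [|apply HM]|]. intros s.
  rewrite (Derive_ext _ _ s (fun t => lam_Xhat n g t Hn HM)), mu_Xhat by assumption.
  exact (proj1 (proj2 (trans_chain g (proj1 HM) n)) s).
Qed.

Lemma phi_Xhat n g s : (1 <= n)%nat -> Mhat g -> phi g (Xhat n g) s = trans_f g n s.
Proof.
  intros Hn HM. destruct HM as [Hg Hu]. pose proof (conj Hg Hu : Mhat g) as HM.
  pose proof (Derive_mu g Hg Hu (Xhat n g) s (loop_Xhat n g Hn Hg)) as E.
  rewrite lam_Xhat in E by assumption.
  rewrite (Derive_ext _ _ s (fun t => mu_Xhat n g t Hn HM)) in E.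
  unfold trans_f. lra.
Qed.

(** Involution of the conserved quantities, expressed through the translation chain, makes the
    fields tangent to the level sets for every [m]. *)
Lemma tangent_level_Xhat m n g : (1 <= n)%nat -> Mhat g -> tangent_level h m g (Xhat n g).
Proof.
  intros Hn HM. split; [now apply tangent_Xhat|]. intros i Hi.
  rewrite (dHhat_trans i g _ (proj1 Hi) HM (tangent_Xhat n g Hn HM)).
  rewrite (circle_int_ext _ (fun s => trans_f g n s * trans_m g i s))
    by (intros s; now rewrite phi_Xhat).
  pose proof (proj1 HM) as Hg.
  rewrite (translation_involution _ (smooth_periodic_curvature g Hg) (trans_p g) (trans_m g)
      (trans_f g)).
  - ring.
  - now apply trans_chain.
  - intros a. now apply trans_smooth_periodic.
Qed.

(** The integration constants beyond index 0 are left free. Statements about every such chain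
    thereby include independence of the constants. *)
Definition chain_of (g X : R -> C) (p m f : nat -> R -> R) : Prop :=
  chain (curvature g) p m f /\ (forall s, p 0%nat s = lam g X s) /\ (forall s, m 0%nat s =
      mu g X s).

Lemma chain_of_f g X p m f s : Mhat g -> loop X -> chain_of g X p m f -> f 0%nat s = phi g X s.
Proof.
  intros [Hg Hu] HX [HC [E1 E2]]. destruct (HC 0%nat) as [_ [_ [E _]]]. specialize (E s).
  rewrite E1, (Derive_ext _ _ s E2), Derive_mu in E by assumption. lra.
Qed.

Lemma chain_of_periodic M g X p m f : Mhat g -> tangent_level h M g X ->
  chain_of g X p m f -> periodic_upto M p m.
Proof.
  intros HM [HT HL] HCO. pose proof (proj1 HM) as Hg. pose proof (proj1 HT) as HX.
  destruct HCO as [HC [E1 E2]].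
  apply (chain_periodic _ (smooth_periodic_curvature g Hg) (trans_p g) (trans_m g) (trans_f g)
    (trans_chain g Hg) (fun a => trans_smooth_periodic g a Hg) (trans_f0 g) p m f M HC).
  - apply (smooth_periodic_ext (lam g X)); [easy | now apply smooth_periodic_lam].
  - apply (smooth_periodic_ext (mu g X)); [easy | now apply smooth_periodic_mu].
  - intros i Hi. specialize (HL i Hi). rewrite dHhat_trans in HL by (trivial; lia).
    rewrite (circle_int_ext _ (fun s => phi g X s * trans_m g i s)); [lra|].
    intros s. now rewrite (chain_of_f g X p m f).
Qed.

Lemma chain_of_antisym M j g X Y p m f q n e : Mhat g ->
  tangent_level h M g X -> tangent_level h M g Y ->
  chain_of g X p m f -> chain_of g Y q n e -> (j <= M + 1)%nat ->
  circle_int (fun s => phi g X s * n j s) = - circle_int (fun s => phi g Y s * m j s).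
Proof.
  intros HM TX TY CX CY Hj.
  rewrite (circle_int_ext _ (fun s => f 0%nat s * n j s))
    by (intros s; now rewrite (chain_of_f g X p m f s HM (proj1 (proj1 TX)) CX)).
  rewrite (circle_int_ext (fun s => phi g Y s * m j s) (fun s => e 0%nat s * m j s))
    by (intros s; now rewrite (chain_of_f g Y q n e s HM (proj1 (proj1 TY)) CY)).
  apply (chain_antisym _ (smooth_periodic_curvature g (proj1 HM)) p m f q n e (proj1 CX)
      (proj1 CY) M).
  - now apply (chain_of_periodic M g X p m f).
  - now apply (chain_of_periodic M g Y q n e).
  - lia.
Qed.

Lemma chain_of_exists g X : Mhat g -> tangent_Mhat g X -> exists p m f, chain_of g X p m f.
Proof.
  intros HM [HX HT]. pose proof (proj1 HM) as Hg.
  (* With all constants zero, the first of the two chains is a chain of [X]. *)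
  destruct (kdv_prim_chain (curvature g) (smooth_periodic_curvature g Hg) (fun _ => RtoC 0)
    (lam g X) (mu g X) (proj1 (smooth_periodic_lam g Hg X HX))
        (proj1 (smooth_periodic_mu g Hg X HX)) HT)
    as (p & m & f & _ & _ & _ & HC & E1 & E2 & _).
  exists p, m, f. split; [exact HC|]. now split; intros s; rewrite ?E1, ?E2.
Qed.

Lemma chain_next_smooth_periodic k p m f j : smooth_periodic k -> chain k p m f ->
    smooth_periodic (p j) -> smooth_periodic (m j) -> smooth_periodic (m (S j)).
Proof.
  intros Hk HC Hp Hm. pose proof (chain_f_smooth_periodic k Hk p m f j HC Hp Hm) as Hf.
  destruct (HC j) as [_ [_ [_ E]]].
  apply (smooth_periodic_ext (fun s => / 2 * Derive (f j) s)); [intros s; rewrite E;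
      field | solve_smooth_periodic].
Qed.

(** One expression for all the forms: it is real, linear in [phi g X], and free of the constants
    [a]. For indices 0 and 1 it follows from [X_s] being [phi] times the normal. *)
Lemma omegahat_chain a k M g X Y p m f : Mhat g ->
  tangent_level h M g X -> tangent_level h M g Y -> chain_of g Y p m f -> (k <= M + 1)%nat ->
  omegahat a k g X Y = RtoC (circle_int (fun s => phi g X s * m k s)).
Proof.
  intros HM TX TY CY Hk.
  pose proof (proj1 HM) as Hg. pose proof (proj2 HM) as Hu.
  pose proof (proj1 TX) as TX'. pose proof (proj1 TY) as TY'.
  pose proof (smooth_periodic_x' g Hg) as [Sx _]. pose proof (smooth_periodic_y' g Hg) as [Sy _].
  pose proof (smooth_periodic_phi g Hg Y (proj1 TY')) as [SF _].
  assert (DX : forall s, CDerive X s =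
      (- phi g X s * Derive (ycoord g) s, phi g X s * Derive (xcoord g) s)).
  { intros s. apply injective_projections; [now apply tangent_x | now apply tangent_y]. }
  destruct k as [|[|j]].
  - cbn [omegahat]. f_equal. apply RInt_ext. intros s _. rewrite DX.
    destruct CY as [_ [_ ->]]. rewrite mu_coord. unfold dot, xcoord, ycoord. simpl. ring.
  - cbn [omegahat]. f_equal.
    assert (DDY : forall s, CDerive (CDerive Y) s =
      (- (Derive (phi g Y) s * Derive (ycoord g) s + phi g Y s * Derive (Derive (ycoord g)) s),
       Derive (phi g Y) s * Derive (xcoord g) s + phi g Y s * Derive (Derive (xcoord g)) s)).
    { intros s. apply injective_projections; cbn [fst snd].
      - change (fst (CDerive (CDerive Y) s)) with (Derive (Derive (xcoord Y)) s).
        rewrite (Derive_ext _ _ s (fun t => tangent_x g Hg Hu Y t TY')).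
        rewrite D_mult by solve_smooth1. rewrite (Derive_opp (phi g Y)). ring.
      - change (snd (CDerive (CDerive Y) s)) with (Derive (Derive (ycoord Y)) s).
        rewrite (Derive_ext _ _ s (fun t => tangent_y g Hg Hu Y t TY')).
        rewrite D_mult by solve_smooth1. ring. }
    pose proof (smooth_periodic_phi g Hg X (proj1 TX')) as [SX _].
    rewrite (RInt_ext _ (fun s => phi g X s * Derive (phi g Y) s)).
    + change (/ 2 * circle_int (fun s => phi g X s * Derive (phi g Y) s) =
        circle_int (fun s => phi g X s * m 1%nat s)).
      rewrite <- circle_int_scal by solve_smooth1. apply circle_int_ext. intros s.
      destruct CY as [HC E]. destruct (HC 0%nat) as [_ [_ [_ Ef]]]. specialize (Ef s).
      rewrite (Derive_ext _ (phi g Y)) in Ef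
        by (intros t; apply (chain_of_f g Y p m f t HM (proj1 TY')); now split).
      rewrite Ef. field.
    + intros s _. rewrite DX, DDY. unfold dot. simpl.
      rewrite (frenet_x g Hg Hu s), (frenet_y g Hg Hu s).
      transitivity (phi g X s * Derive (phi g Y) s *
        (Derive (xcoord g) s * Derive (xcoord g) s + Derive (ycoord g) s * Derive (ycoord g) s));
            [ring|].
      rewrite (unit_speed g Hu). ring.
  - change (omegahat a (S (S j)) g X Y) with
      (omega_kdv (a g Y) (S j) (miura_curvature g) (miura_tangent g X) (miura_tangent g Y)).
    set (i := S j) in *.
    destruct (kdv_prim_chain (curvature g) (smooth_periodic_curvature g Hg) (a g Y)
      (lam g Y) (mu g Y) (proj1 (smooth_periodic_lam g Hg Y (proj1 TY')))
          (proj1 (smooth_periodic_mu g Hg Y (proj1 TY')))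
      (proj2 TY')) as (p' & m' & f' & q & n & e & C' & Ep & Em & Ce & Eq & En & EO).
    assert (CY' : chain_of g Y p' m' f') by (split; [exact C' | rewrite Ep, Em; now split]).
    destruct (chain_of_exists g X HM TX') as (px & mx & fx & CX).
    pose proof (chain_of_periodic M g X px mx fx HM TX CX) as PX.
    pose proof (chain_of_periodic M g Y p' m' f' HM TY CY') as PY.
    assert (Ee : forall s, e 0%nat s = 0).
    { intros s. destruct (Ce 0%nat) as [_ [_ [E _]]]. specialize (E s).
      rewrite Eq, En, Derive_const in E. lra. }
    assert (PN : periodic_upto M q n).
    { apply (chain_periodic _ (smooth_periodic_curvature g Hg) (trans_p g) (trans_m g) (trans_f g)
        (trans_chain g Hg) (fun a => trans_smooth_periodic g a Hg) (trans_f0 g) q n e M Ce).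
      - rewrite Eq. apply smooth_periodic_const.
      - rewrite En. apply smooth_periodic_const.
      - intros l _. rewrite (circle_int_ext _ (Derive (fun _ => 0))).
        + apply circle_int_Derive, smooth_periodic_const.
        + intros s. rewrite Ee, Derive_const. ring. }
    (* The chain adapted to the constants [a] and the given chain of [Y] yield the same integral,
       since antisymmetry rewrites both in terms of one chain of [X]. *)
    assert (EM : circle_int (fun s => phi g X s * m' (S i) s) =
        circle_int (fun s => phi g X s * m (S i) s)).
    { rewrite (chain_of_antisym M (S i) g X Y px mx fx p' m' f') by assumption.
      now rewrite (chain_of_antisym M (S i) g X Y px mx fx p m f) by assumption. }
    (* The chain started at zero has [e 0 = 0], so antisymmetry annihilates its pairing with
       [phi g X]. This integral is the imaginary part of the form. *)
    assert (EN : circle_int (fun s => phi g X s * n (S i) s) = 0).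
    { rewrite (circle_int_ext _ (fun s => fx 0%nat s * n (S i) s))
        by (intros s; now rewrite (chain_of_f g X px mx fx s HM (proj1 TX') CX)).
      rewrite (chain_antisym _ (smooth_periodic_curvature g Hg) px mx fx q n e (proj1 CX) Ce M)
        by (trivial; lia).
      rewrite (circle_int_ext _ (Derive (fun _ => 0))).
      - rewrite circle_int_Derive by apply smooth_periodic_const. ring.
      - intros s. rewrite Ee, Derive_const. ring. }
    pose proof (smooth_periodic_phi g Hg X (proj1 TX')) as PF.
      pose proof (smooth_periodic_lam g Hg X (proj1 TX')) as PL.
    pose proof (smooth_periodic_mu g Hg X (proj1 TX')) as PM.
    destruct (PY i) as [PY1 PY2]; [lia|]. destruct (PN i) as [PN1 PN2]; [lia|].
    pose proof (chain_next_smooth_periodic _ _ _ _ i (smooth_periodic_curvature g Hg) C' PY1 PY2)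
        as PMi.
    pose proof (chain_next_smooth_periodic _ _ _ _ i (smooth_periodic_curvature g Hg) Ce PN1 PN2)
        as PNi.
    pose proof (proj1 PF). pose proof (proj1 PL). pose proof (proj1 PM).
    pose proof (proj1 PMi). pose proof (proj1 PNi).
    rewrite <- EM. unfold RtoC. rewrite <- EN.
    assert (EX : forall s, Derive (lam g X) s = curvature g s * mu g X s) by exact (proj2 TX').
    assert (EX2 : forall s, Derive (mu g X) s = phi g X s - curvature g s * lam g X s).
    { intros s. apply (Derive_mu g Hg Hu X s (proj1 TX')). }
    (* The transpose [k - i D] of [B] sends [lambda + i mu] to [phi], because [lambda_s = k mu].
       Moving [B] across leaves [phi (m' + i n)]; the boundary functions are the real and imaginary
       parts of [i (lambda + i mu) (m' + i n)]. *)
    unfold omega_kdv, CInt. f_equal.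
    + apply (circle_int_eq _ _ (fun s => 0 - mu g X s * m' (S i) s - lam g X s * n (S i) s));
        [solve_smooth1|solve_smooth_periodic|].
      intros s. change (miura_tangent g Y) with (fun t => (lam g Y t, mu g Y t)).
      change (miura_curvature g) with
        (fun s => (/ 4 * curvature g s ^ 2, / 2 * Derive (curvature g) s)).
      rewrite EO. rewrite !D_minus, !D_mult by solve_smooth1. rewrite Derive_const, EX, EX2.
      unfold miura_tangent. simpl. ring.
    + apply (circle_int_eq _ _ (fun s => lam g X s * m' (S i) s - mu g X s * n (S i) s));
        [solve_smooth1|solve_smooth_periodic|].
      intros s. change (miura_tangent g Y) with (fun t => (lam g Y t, mu g Y t)).
      change (miura_curvature g) with
        (fun s => (/ 4 * curvature g s ^ 2, / 2 * Derive (curvature g) s)).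
      rewrite EO. rewrite !D_minus, !D_mult by solve_smooth1. rewrite EX, EX2.
      unfold miura_tangent. simpl. ring.
Qed.

Lemma omegahat_antisym a k M g X Y : Mhat g ->
  tangent_level h M g X -> tangent_level h M g Y -> (k <= M + 1)%nat ->
  omegahat a k g Y X = (- omegahat a k g X Y)%C.
Proof.
  intros HM TX TY Hk.
  destruct (chain_of_exists g X HM (proj1 TX)) as (p & m & f & CX).
  destruct (chain_of_exists g Y HM (proj1 TY)) as (q & n & e & CY).
  rewrite (omegahat_chain a k M g X Y q n e), (omegahat_chain a k M g Y X p m f) by assumption.
  rewrite (chain_of_antisym M k g X Y p m f q n e) by assumption.
  rewrite <- RtoC_opp. f_equal. ring.
Qed.

(** Antisymmetry passes the index to a chain of [Xhat n], which may be taken as the tail of the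
    translation chain from [n] on. Its member of index [k] is then the one of index [n + k], which
    represents the differential of [h (n + k)]. *)
Lemma omegahat_Xhat a k M n g Y : (1 <= n)%nat -> Mhat g -> tangent_level h M g Y ->
  (k <= M + 1)%nat -> omegahat a k g (Xhat n g) Y = RtoC (dHhat (h (n + k)%nat) g Y).
Proof.
  intros Hn HM TY Hk. pose proof (tangent_level_Xhat M n g Hn HM) as TX.
  pose proof (proj1 HM) as Hg.
  assert (CX : chain_of g (Xhat n g) (fun a => trans_p g (n + a)%nat)
     (fun a => trans_m g (n + a)%nat) (fun a => trans_f g (n + a)%nat)).
  { split; [|split].
    - now apply chain_tail, trans_chain.
    - intros s. rewrite Nat.add_0_r. now rewrite lam_Xhat.
    - intros s. rewrite Nat.add_0_r. now rewrite mu_Xhat. }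
  destruct (chain_of_exists g Y HM (proj1 TY)) as (q & e & f & CY).
  rewrite (omegahat_chain a k M g _ Y q e f) by assumption.
  rewrite (chain_of_antisym M k g _ Y _ _ _ q e f HM TX TY CX CY Hk).
  assert (Hi : (1 <= n + k)%nat) by lia.
  now rewrite (dHhat_trans _ g Y Hi HM (proj1 TY)).
Qed.

Lemma phi_linear g X X' r s : loop X -> loop X' ->
  phi g (fun s => (RtoC r * X s + X' s)%C) s = r * phi g X s + phi g X' s.
Proof.
  intros HX HX'. apply loop_iff in HX, HX'. destruct HX as [[S1 _] [S2 _]].
  destruct HX' as [[S3 _] [S4 _]].
  rewrite !phi_coord.
  rewrite (Derive_ext (xcoord (fun s => (RtoC r * X s + X' s)%C)) (fun s => r * xcoord X s
      + xcoord X' s))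
    by (intros t; unfold xcoord; simpl; ring).
  rewrite (Derive_ext (ycoord (fun s => (RtoC r * X s + X' s)%C)) (fun s => r * ycoord X s
      + ycoord X' s))
    by (intros t; unfold ycoord; simpl; ring).
  rewrite !D_plus, !D_mult by solve_smooth1. rewrite !Derive_const. ring.
Qed.

Lemma tangent_level_linear M g X X' r : Mhat g ->
  tangent_level h M g X -> tangent_level h M g X' ->
  tangent_level h M g (fun s => (RtoC r * X s + X' s)%C).
Proof.
  intros HM [TX LX] [TX' LX']. pose proof HM as [Hg Hu].
  pose proof (proj1 TX) as HX. pose proof (proj1 TX') as HX'.
  pose proof (proj1 (loop_iff X) HX) as [Q1 Q2]. pose proof (proj1 (loop_iff X') HX') as [Q3 Q4].
  assert (E1 : forall t, xcoord (fun s => (RtoC r * X s + X' s)%C) t = r * xcoord X t + xcoord X' t)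
    by (intros t; unfold xcoord; simpl; ring).
  assert (E2 : forall t, ycoord (fun s => (RtoC r * X s + X' s)%C) t = r * ycoord X t + ycoord X' t)
    by (intros t; unfold ycoord; simpl; ring).
  assert (T : tangent_Mhat g (fun s => (RtoC r * X s + X' s)%C)).
  { apply (tangent_iff g Hg Hu). split.
    - apply loop_iff. split.
      + apply (smooth_periodic_ext _ _ (fun t => eq_sym (E1 t))). solve_smooth_periodic.
      + apply (smooth_periodic_ext _ _ (fun t => eq_sym (E2 t))). solve_smooth_periodic.
    - intros s. rewrite (Derive_ext _ _ s E1), (Derive_ext _ _ s E2).
      destruct Q1, Q2, Q3, Q4. rewrite !D_plus, !D_mult by solve_smooth1. rewrite Derive_const.
      apply (tangent_iff g Hg Hu) in TX, TX'. destruct TX as [_ A]. destruct TX' as [_ B].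
      specialize (A s). specialize (B s).
      transitivity (r * (Derive (xcoord X) s * Derive (xcoord g) s
          + Derive (ycoord X) s * Derive (ycoord g) s) +
        (Derive (xcoord X') s * Derive (xcoord g) s
            + Derive (ycoord X') s * Derive (ycoord g) s)); [ring|].
      rewrite A, B. ring. }
  split; [exact T|]. intros i Hi. specialize (LX i Hi). specialize (LX' i Hi).
  rewrite dHhat_trans in * by (trivial; lia).
  pose proof (smooth_periodic_phi g Hg X HX) as [S1 _].
    pose proof (smooth_periodic_phi g Hg X' HX') as [S2 _].
  destruct (trans_smooth_periodic g i Hg) as [_ [S3 _]].
  rewrite (circle_int_ext _ (fun s => r * (phi g X s * trans_m g i s)
      + phi g X' s * trans_m g i s)).
  - rewrite circle_int_plus, circle_int_scal by solve_smooth1.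
    replace (circle_int (fun s => phi g X s * trans_m g i s)) with 0 by lra. lra.
  - intros s. rewrite phi_linear by assumption. ring.
Qed.

Lemma omegahat_linear a k M g X X' Y r : Mhat g -> tangent_level h M g X ->
  tangent_level h M g X' -> tangent_level h M g Y -> (k <= M + 1)%nat ->
  omegahat a k g (fun s => (RtoC r * X s + X' s)%C) Y =
  (RtoC r * omegahat a k g X Y + omegahat a k g X' Y)%C.
Proof.
  intros HM TX TX' TY Hk. pose proof (proj1 HM) as Hg.
  pose proof (tangent_level_linear M g X X' r HM TX TX') as T.
  destruct (chain_of_exists g Y HM (proj1 TY)) as (q & n & e & CY).
  rewrite !(omegahat_chain a k M g _ Y q n e) by assumption.
  rewrite <- RtoC_mult, <- RtoC_plus. f_equal.
  pose proof (smooth_periodic_phi g Hg X (proj1 (proj1 TX))) as [S1 _].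
  pose proof (smooth_periodic_phi g Hg X' (proj1 (proj1 TX'))) as [S2 _].
  destruct (proj1 CY k) as [[_ [S3 _]] _].
  rewrite (circle_int_ext _ (fun s => r * (phi g X s * n k s) + phi g X' s * n k s)).
  - now rewrite circle_int_plus, circle_int_scal by solve_smooth1.
  - intros s. rewrite (phi_linear g X X' r s (proj1 (proj1 TX)) (proj1 (proj1 TX'))). ring.
Qed.

End Forms.

(** * Power series with coefficients in the functions on [pt] *)

(** Coefficient [n] of a product of power series. Shifting the first factor, instead of summing over
    an interval, lets the ring laws follow by direct induction. *)
Fixpoint cauchy (f g : nat -> R) (n : nat) : R :=
  match n with
  | O => f 0%nat * g 0%nat
  | S n' => f 0%nat * g (S n') + cauchy (fun a => f (S a)) g n'
  end.

Lemma cauchy_plus_l f f' g n : cauchy (fun a => f a + f' a) g n = cauchy f g n + cauchy f' g n.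
Proof. revert f f'. induction n as [|n IH]; intros f f'; simpl; [|rewrite IH]; ring. Qed.

Lemma cauchy_scal_l c f g n : cauchy (fun a => c * f a) g n = c * cauchy f g n.
Proof. revert f. induction n as [|n IH]; intros f; simpl; [|rewrite IH]; ring. Qed.

Lemma cauchy_S_r f g n : cauchy f g (S n) = cauchy f (fun a => g (S a)) n + f (S n) * g 0%nat.
Proof.
  revert f. induction n as [|n IH]; intros f; [simpl; ring|].
  change (cauchy f g (S (S n))) with (f 0%nat * g (S (S n)) + cauchy (fun a => f (S a)) g (S n)).
  rewrite IH. simpl. ring.
Qed.

Lemma cauchy_comm f g n : cauchy f g n = cauchy g f n.
Proof.
  revert f g. induction n as [|n IH]; intros f g; [simpl; ring|].
  rewrite cauchy_S_r, IH. simpl. ring.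
Qed.

Lemma cauchy_assoc f g l n : cauchy f (cauchy g l) n = cauchy (cauchy f g) l n.
Proof.
  revert f g. induction n as [|n IH]; intros f g; [simpl; ring|].
  change (cauchy f (cauchy g l) (S n)) with
    (f 0%nat * cauchy g l (S n) + cauchy (fun a => f (S a)) (cauchy g l) n).
  change (cauchy (cauchy f g) l (S n)) with
    (cauchy f g 0%nat * l (S n) +
     cauchy (fun a => f 0%nat * g (S a) + cauchy (fun b => f (S b)) g a) l n).
  rewrite cauchy_plus_l, cauchy_scal_l, IH. simpl. ring.
Qed.

Lemma cauchy_const c g n : cauchy (fun a => match a with O => c | S _ => 0 end) g n = c * g n.
Proof.
  destruct n as [|n]; simpl; [reflexivity|].
  replace (cauchy (fun _ => 0) g n) with (0 * cauchy (fun _ => 0) g n); [ring|].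
  rewrite <- cauchy_scal_l. f_equal. extensionality a. ring.
Qed.

Definition ser := nat -> pt -> R.
Definition sconst (f : pt -> R) : ser := fun n q => match n with O => f q | S _ => 0 end.
Definition sadd (F H : ser) : ser := fun n q => F n q + H n q.
Definition ssub (F H : ser) : ser := fun n q => F n q - H n q.
Definition sopp (F : ser) : ser := fun n q => - F n q.
Definition smul (F H : ser) : ser := fun n q => cauchy (fun a => F a q) (fun a => H a q) n.
Definition szero : ser := sconst (fun _ => 0).
Definition sone : ser := sconst (fun _ => 1).
Definition sz : ser := fun n q => match n with 1%nat => 1 | _ => 0 end.

(** Series with their extensional equality become available to [ring], including its use of given
    equations to eliminate monomials. *)
Lemma ser_ring : ring_theory szero sone sadd smul ssub sopp eq.
Proof.
  assert (E : forall n, szero n = fun _ => 0) by (intros [|n]; reflexivity).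
  split; intros; extensionality n; extensionality q;
    unfold sadd, ssub, sopp, smul, sone; rewrite ?E; try ring.
  - unfold sconst. rewrite cauchy_const. ring.
  - apply cauchy_comm.
  - apply (cauchy_assoc (fun a => x a q) (fun a => y a q) (fun a => z a q)).
  - apply cauchy_plus_l.
Qed.

Add Ring ser_ring : ser_ring.

Definition stwo : ser := sadd sone sone.

Declare Scope ser_scope.
Delimit Scope ser_scope with ser.
Bind Scope ser_scope with ser.
Infix "+" := sadd : ser_scope.
Infix "-" := ssub : ser_scope.
Infix "*" := smul : ser_scope.

Definition sD (i : nat) (F : ser) : ser := fun n => pd i (F n).
Definition smooth_ser (F : ser) : Prop := forall n, smooth_pt (F n).
Definition periodic_ser (N : nat) (F : ser) : Prop := forall n, (n <= N)%nat -> periodic_pt (F n).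

Lemma smul_S F H n q : smul F H (S n) q = F 0%nat q * H (S n) q + smul (fun a => F (S a)) H n q.
Proof. reflexivity. Qed.

Lemma smooth_sconst f : smooth_pt f -> smooth_ser (sconst f).
Proof. intros Hf [|n]; [exact Hf | exact (smooth_const 0)]. Qed.

Lemma smooth_sz : smooth_ser sz.
Proof. intros [|[|n]];
    [exact (smooth_const 0) | exact (smooth_const 1) | exact (smooth_const 0)]. Qed.

Lemma smooth_sadd F H : smooth_ser F -> smooth_ser H -> smooth_ser (F + H)%ser.
Proof. intros HF HH n. now apply (smooth_plus (F n) (H n)). Qed.

Lemma smooth_ssub F H : smooth_ser F -> smooth_ser H -> smooth_ser (F - H)%ser.
Proof. intros HF HH n. now apply (smooth_minus (F n) (H n)). Qed.

Lemma smooth_smul F H : smooth_ser F -> smooth_ser H -> smooth_ser (F * H)%ser.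
Proof.
  intros HF HH n. revert F HF. induction n as [|n IH]; intros F HF.
  - now apply (smooth_mult (F 0%nat) (H 0%nat)).
  - apply (smooth_plus (fun q => F 0%nat q * H (S n) q) (smul (fun a => F (S a)) H n)).
    + now apply (smooth_mult (F 0%nat) (H (S n))).
    + apply IH. intros a. apply HF.
Qed.

Lemma smooth_sD i F : smooth_ser F -> smooth_ser (sD i F).
Proof. intros HF n. now apply smooth_pd. Qed.

Lemma sD_sadd i F H : smooth_ser F -> smooth_ser H -> sD i (F + H)%ser = (sD i F + sD i H)%ser.
Proof. intros HF HH. extensionality n. now apply (pd_plus (F n) (H n)). Qed.

Lemma sD_ssub i F H : smooth_ser F -> smooth_ser H -> sD i (F - H)%ser = (sD i F - sD i H)%ser.
Proof. intros HF HH. extensionality n. now apply (pd_minus (F n) (H n)). Qed.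

Lemma sD_smul i F H : smooth_ser F -> smooth_ser H ->
  sD i (F * H)%ser = (sD i F * H + F * sD i H)%ser.
Proof.
  intros HF HH. extensionality n. unfold sD, sadd. revert F HF.
  induction n as [|n IH]; intros F HF.
  - now apply (pd_mult (F 0%nat) (H 0%nat)).
  - change (smul F H (S n)) with (fun q => F 0%nat q * H (S n) q + smul (fun a => F (S a)) H n q).
    assert (HF' : smooth_ser (fun a => F (S a))) by (intros a; apply HF).
    rewrite pd_plus.
    + rewrite pd_mult by auto. rewrite IH by assumption.
      extensionality q. rewrite !smul_S. ring.
    + now apply (smooth_mult (F 0%nat) (H (S n))).
    + now apply (smooth_smul (fun a => F (S a)) H).
Qed.

Lemma sD_sz i : sD i sz = szero.
Proof. extensionality n. unfold sD. destruct n as [|[|n]];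
    [exact (pd_const 0 i) | exact (pd_const 1 i) | exact (pd_const 0 i)]. Qed.

Lemma sD_sconst i f : sD i (sconst f) = sconst (pd i f).
Proof. extensionality n. unfold sD. destruct n as [|n]; [reflexivity | exact (pd_const 0 i)]. Qed.

Lemma sD_stwo i : sD i stwo = szero.
Proof.
  unfold stwo, sone. rewrite sD_sadd, !sD_sconst by apply smooth_sconst, smooth_const.
  rewrite pd_const. change (szero + szero = szero)%ser. ring.
Qed.

Lemma sD_comm i j F : smooth_ser F -> sD i (sD j F) = sD j (sD i F).
Proof. intros HF. extensionality n. now apply (pd_comm (F n)). Qed.

Lemma sconst_smul f F n q : (sconst f * F)%ser n q = f q * F n q.
Proof. unfold smul, sconst. apply (cauchy_const (f q) (fun a => F a q)). Qed.

Lemma periodic_sadd N F H : periodic_ser N F -> periodic_ser N H -> periodic_ser N (F + H)%ser.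
Proof. intros HF HH n Hn u s. unfold sadd. now rewrite (HF n Hn), (HH n Hn). Qed.

Lemma periodic_ssub N F H : periodic_ser N F -> periodic_ser N H -> periodic_ser N (F - H)%ser.
Proof. intros HF HH n Hn u s. unfold ssub. now rewrite (HF n Hn), (HH n Hn). Qed.

(** Coefficients up to [N] of a product involve only coefficients up to [N] of the factors, so
    periodicity below a bound survives multiplication. *)
Lemma periodic_smul N F H : periodic_ser N F -> periodic_ser N H -> periodic_ser N (F * H)%ser.
Proof.
  intros HF HH n. revert N F H HF HH. induction n as [|n IH]; intros N F H HF HH Hn u s.
  - unfold smul; simpl. now rewrite (HF 0%nat), (HH 0%nat) by lia.
  - rewrite !smul_S. rewrite (HF 0%nat), (HH (S n)) by lia. f_equal.
    apply (IH n); [| |lia].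
    + intros a Ha. apply HF. lia.
    + intros a Ha. apply HH. lia.
Qed.

Lemma periodic_sD N i F : periodic_ser N F -> periodic_ser N (sD i F).
Proof. intros HF n Hn. now apply periodic_pd, HF. Qed.

Lemma periodic_sz N : periodic_ser N sz.
Proof. intros [|[|n]] _ u s; reflexivity. Qed.

Lemma periodic_stwo N : periodic_ser N stwo.
Proof. intros [|n] _ u s; reflexivity. Qed.

Ltac solve_ser :=
  try assumption;
  lazymatch goal with
  | |- smooth_ser (sadd _ _) => apply smooth_sadd; solve_ser
  | |- smooth_ser (ssub _ _) => apply smooth_ssub; solve_ser
  | |- smooth_ser (smul _ _) => apply smooth_smul; solve_ser
  | |- smooth_ser (sD _ _) => apply smooth_sD; solve_ser
  | |- smooth_ser sz => exact smooth_sz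
  | |- smooth_ser stwo => exact (smooth_sadd _ _ (smooth_sconst _ (smooth_const 1))
      (smooth_sconst _ (smooth_const 1)))
  | |- smooth_ser (_ ?i) => auto
  | |- periodic_ser _ (sadd _ _) => apply periodic_sadd; solve_ser
  | |- periodic_ser _ (ssub _ _) => apply periodic_ssub; solve_ser
  | |- periodic_ser _ (smul _ _) => apply periodic_smul; solve_ser
  | |- periodic_ser _ (sD _ _) => apply periodic_sD; solve_ser
  | |- periodic_ser _ sz => apply periodic_sz
  | |- periodic_ser _ stwo => apply periodic_stwo
  | |- periodic_ser _ (_ ?i) => auto
  | |- _ => idtac
  end.

(** * Closedness *)

Lemma circle_int_pt_minus F H : smooth_pt F -> smooth_pt H ->
  circle_int_pt (fun q => F q - H q) = fun q => circle_int_pt F q - circle_int_pt H q.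
Proof.
  intros HF HH. extensionality x. unfold circle_int_pt.
  apply (RInt_minus (V:=R_CompleteNormedModule)
    (fun t => F (fst x, t)) (fun t => H (fst x, t))); now apply ex_RInt_slice.
Qed.

Lemma circle_int_pt_differences F1 H1 F2 H2 F3 H3 q : smooth_pt F1 -> smooth_pt H1 ->
  smooth_pt F2 -> smooth_pt H2 -> smooth_pt F3 -> smooth_pt H3 ->
  circle_int_pt (fun q => (F1 q - H1 q) + (F2 q - H2 q) + (F3 q - H3 q)) q =
  (circle_int_pt F1 q - circle_int_pt H1 q) + (circle_int_pt F2 q - circle_int_pt H2 q)
      + (circle_int_pt F3 q - circle_int_pt H3 q).
Proof.
  intros S1 S1' S2 S2' S3 S3'.
  pose proof (smooth_minus _ _ S1 S1') as D1. pose proof (smooth_minus _ _ S2 S2') as D2.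
  pose proof (smooth_minus _ _ S3 S3') as D3. pose proof (smooth_plus _ _ D1 D2) as D12.
  rewrite (circle_int_pt_plus _ _ D12 D3), (circle_int_pt_plus _ _ D1 D2).
  now rewrite (circle_int_pt_minus _ _ S1 S1'), (circle_int_pt_minus _ _ S2 S2'),
      (circle_int_pt_minus _ _ S3 S3').
Qed.

Section Closed.
Variable K : pt -> R.
Hypothesis HK : smooth_pt K.
Variables p m f : nat -> ser.
Hypothesis Sp : forall i, smooth_ser (p i).
Hypothesis Sm : forall i, smooth_ser (m i).
Hypothesis Sf : forall i, smooth_ser (f i).
Hypothesis Ep : forall i, (i < 3)%nat -> sD 3 (p i) = (sconst K * m i)%ser.
Hypothesis Em : forall i, (i < 3)%nat -> sD 3 (m i) = (f i - sconst K * p i)%ser.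
(** Kept multiplied by [sz], which is not invertible among formal power series. *)
Hypothesis Ef : forall i, (i < 3)%nat ->
  (sz * sD 3 (f i))%ser = (stwo * m i - sconst (pd i K))%ser.

(* [A_i = (p_i, m_i, f_i)] solves [A_s = U A + (0, 0, - K_i / z)] with [U] in a copy of
   so(2,1); the following are the components of [d_l A_j - d_j A_l + [A_l, A_j]],
   which solves the homogeneous equation. *)
Definition curl_p l j : ser := (sD l (p j) - sD j (p l) - sz * (m l * f j - m j * f l))%ser.
Definition curl_m l j : ser := (sD l (m j) - sD j (m l) + sz * (p l * f j - p j * f l))%ser.
Definition curl_f l j : ser := (sD l (f j) - sD j (f l) + stwo * (p l * m j - p j * m l))%ser.

(* The pairing of [A_i] and the above by the invariant quadratic form. *)
Definition curl_pairing i l j : ser :=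
  (stwo * (p i * curl_p l j + m i * curl_m l j) - sz * (f i * curl_f l j))%ser.

Definition triple i l j : ser :=
  (stwo * (sz * (f i * (p l * m j - p j * m l) + f l * (p j * m i - p i * m j)
     + f j * (p i * m l - p l * m i))))%ser.

(** [U] acts as the bracket with [(1/z, 0, K/z)], so the equation for [A_i] is a zero-curvature
    condition and [D1], [D2], [D3] are the Bianchi identity. Invariance of the quadratic form then
    leaves only the inhomogeneity [- K_i / z], paired with the third component of the curl. *)
Lemma sD_curl_pairing i l j : (i < 3)%nat -> (l < 3)%nat -> (j < 3)%nat ->
  sD 3 (curl_pairing i l j) = (sconst (pd i K) * curl_f l j)%ser.
Proof.
  intros Hi Hl Hj.
  assert (S1 : smooth_ser (curl_p l j)) by (unfold curl_p; solve_ser).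
  assert (S2 : smooth_ser (curl_m l j)) by (unfold curl_m; solve_ser).
  assert (S3 : smooth_ser (curl_f l j)) by (unfold curl_f; solve_ser).
  assert (SK : smooth_ser (sconst K)) by now apply smooth_sconst.
  assert (Ep' : forall a b, (b < 3)%nat ->
    sD 3 (sD a (p b)) = (sconst (pd a K) * m b + sconst K * sD a (m b))%ser).
  { intros a b Hb. rewrite sD_comm, Ep, sD_smul, sD_sconst by solve_ser. reflexivity. }
  assert (Em' : forall a b, (b < 3)%nat ->
    sD 3 (sD a (m b)) = (sD a (f b) - (sconst (pd a K) * p b + sconst K * sD a (p b)))%ser).
  { intros a b Hb. rewrite sD_comm, Em, sD_ssub, sD_smul, sD_sconst by solve_ser. reflexivity. }
  assert (Ef' : forall a b, (b < 3)%nat ->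
    (sz * sD 3 (sD a (f b)) = stwo * sD a (m b) - sconst (pd a (pd b K)))%ser).
  { intros a b Hb.
    assert (E : sD a (sz * sD 3 (f b))%ser = sD a (stwo * m b - sconst (pd b K))%ser)
      by now rewrite Ef.
    assert (SKb : smooth_ser (sconst (pd b K))) by now apply smooth_sconst, smooth_pd.
    rewrite sD_smul, sD_ssub, sD_smul, sD_sz, sD_stwo, sD_sconst in E by solve_ser.
    rewrite (sD_comm 3 a) by solve_ser.
    transitivity (szero * sD 3 (f b) + sz * sD a (sD 3 (f b)))%ser; [ring|].
    rewrite E. ring. }
  assert (D1 : sD 3 (curl_p l j) = (sconst K * curl_m l j)%ser).
  { unfold curl_p, curl_m.
    rewrite !sD_ssub, !sD_smul, sD_ssub, !sD_smul, !Ep', sD_sz, !Em by (trivial; solve_ser).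
    (* These equations eliminate [z D f]; the parameter derivatives of [K] that they produce cancel
       those from differentiating the coefficient [K] in the equations for [p]. *)
    pose proof (Ef j Hj) as Ej. pose proof (Ef l Hl) as El.
    ring [Ej El]. }
  assert (D2 : sD 3 (curl_m l j) = (curl_f l j - sconst K * curl_p l j)%ser).
  { unfold curl_p, curl_m, curl_f.
    rewrite !sD_sadd, !sD_smul, !sD_ssub, !sD_smul, !Em', sD_sz, !Ep by (trivial; solve_ser).
    pose proof (Ef j Hj) as Ej. pose proof (Ef l Hl) as El.
    ring [Ej El]. }
  assert (D3 : (sz * sD 3 (curl_f l j) = stwo * curl_m l j)%ser).
  { unfold curl_m, curl_f.
    rewrite !sD_sadd, !sD_smul, !sD_ssub, !sD_smul, sD_stwo, !Em, !Ep by (trivial; solve_ser).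
    pose proof (Ef' l j Hj) as Ej. pose proof (Ef' j l Hl) as El.
    (* The inhomogeneities are the components of a gradient: their curl vanishes by symmetry of
       second derivatives, which is why the equation obtained is homogeneous. *)
    rewrite (pd_comm K j l HK) in El.
    ring [Ej El]. }
  unfold curl_pairing.
  rewrite sD_ssub, !sD_smul, sD_sadd, !sD_smul, sD_stwo, sD_sz, Ep, Em, D1, D2 by (trivial;
      solve_ser).
  pose proof (Ef i Hi) as Ei.
  ring [Ei D3].
Qed.

(** [triple] is minus the invariant pairing of [A_i] with the bracket of [A_l] and [A_j]. It is
    totally antisymmetric and constant for solutions of the homogeneous equation, so only the
    inhomogeneities contribute. *)
Lemma sD_triple i l j : (i < 3)%nat -> (l < 3)%nat -> (j < 3)%nat ->
  sD 3 (triple i l j) = (stwo * (szero - (sconst (pd i K) * (p l * m j - p j * m l)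
    + sconst (pd l K) * (p j * m i - p i * m j) + sconst (pd j K) * (p i * m l - p l * m i))))%ser.
Proof.
  intros Hi Hl Hj. unfold triple.
  assert (SK : smooth_ser (sconst K)) by now apply smooth_sconst.
  repeat (rewrite ?sD_smul, ?sD_sadd, ?sD_ssub by solve_ser).
  rewrite sD_stwo, sD_sz, !Ep, !Em by assumption.
  pose proof (Ef i Hi) as Ei. pose proof (Ef j Hj) as Ej. pose proof (Ef l Hl) as El.
  ring [Ei Ej El].
Qed.

(** The pairings produce the wanted sum together with the bracket part of [curl_f]; the derivative
    of [triple] cancels the latter. *)
Lemma sum_curl i l j : (i < 3)%nat -> (l < 3)%nat -> (j < 3)%nat ->
  (sconst (pd i K) * (sD l (f j) - sD j (f l)) + sconst (pd l K) * (sD j (f i) - sD i (f j))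
   + sconst (pd j K) * (sD i (f l) - sD l (f i)))%ser =
  sD 3 (curl_pairing i l j + curl_pairing l j i + curl_pairing j i l + triple i l j)%ser.
Proof.
  intros Hi Hl Hj.
  assert (S1 : forall a b c, smooth_ser (curl_pairing a b c))
    by (intros; unfold curl_pairing, curl_p, curl_m, curl_f; solve_ser).
  assert (S2 : smooth_ser (triple i l j)) by (unfold triple; solve_ser).
  rewrite !sD_sadd, !sD_curl_pairing, sD_triple by (trivial; solve_ser).
  unfold curl_f. ring.
Qed.

(** By antisymmetry each of the three terms is half a difference of two orderings. In the sum of
    these differences the second derivatives of [K] cancel, and the integrand of [sum_curl]
    remains. *)
Lemma closed_high i j l b : (i < 3)%nat -> (l < 3)%nat -> (j < 3)%nat ->
  (forall a, (a < 3)%nat -> periodic_ser b (p a)) ->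
  (forall a, (a < 3)%nat -> periodic_ser b (m a)) ->
  (forall a, (a < 3)%nat -> periodic_ser b (f a)) ->
  (forall x y, (x < 3)%nat -> (y < 3)%nat -> circle_int_pt (fun q => pd x K q * f y b q) =
     fun q => - circle_int_pt (fun q => pd y K q * f x b q) q) ->
  forall q, pd l (circle_int_pt (fun q => pd i K q * f j b q)) q
    + pd i (circle_int_pt (fun q => pd j K q * f l b q)) q
    + pd j (circle_int_pt (fun q => pd l K q * f i b q)) q = 0.
Proof.
  intros Hi Hl Hj Pp Pm Pf Anti q.
  set (A x y := circle_int_pt (fun q => pd x K q * f y b q)).
  assert (SA : forall x y, smooth_pt (fun q => pd x K q * f y b q)).
  { intros x y. apply smooth_mult; [now apply smooth_pd | apply Sf]. }
  set (T x y z := fun q => pd z (pd x K) q * f y b q + pd x K q * pd z (f y b) q).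
  assert (EA : forall x y z, (z < 3)%nat -> pd z (A x y) q = circle_int_pt (T x y z) q).
  { intros x y z Hz. unfold A. rewrite pd_circ by (try apply SA; trivial).
    rewrite pd_mult by (try apply smooth_pd; try apply Sf; trivial). reflexivity. }
  assert (EN : forall x y z, (x < 3)%nat -> (y < 3)%nat -> pd z (A x y) q = - pd z (A y x) q).
  { intros x y z Hx Hy. unfold A. rewrite (Anti x y Hx Hy), pd_opp. reflexivity. }
  assert (ST : forall x y z, smooth_pt (T x y z)).
  { intros x y z. unfold T. apply (smooth_plus (fun q => pd z (pd x K) q * f y b q)).
    - apply (smooth_mult (pd z (pd x K))); [now apply smooth_pd, smooth_pd | apply Sf].
    - apply (smooth_mult (pd x K)); [now apply smooth_pd | apply (smooth_pd _ z (Sf y b))]. }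
  set (W := (curl_pairing i l j + curl_pairing l j i + curl_pairing j i l + triple i l j)%ser).
  assert (SW : smooth_pt (W b)).
  { assert (H : smooth_ser W).
    { unfold W, curl_pairing, triple, curl_p, curl_m, curl_f; solve_ser. }
    apply H. }
  assert (PW : periodic_pt (W b)).
  { assert (H : periodic_ser b W).
    { unfold W, curl_pairing, triple, curl_p, curl_m, curl_f; solve_ser. }
    apply H, le_n. }
  assert (E : circle_int_pt (fun q => (T i j l q - T j i l q) + (T j l i q - T l j i q)
      + (T l i j q - T i l j q)) q = 0).
  { replace (fun q => (T i j l q - T j i l q) + (T j l i q - T l j i q)
      + (T l i j q - T i l j q)) with (pd 3 (W b)).
    - now rewrite circle_int_pt_pd3.
    - extensionality x.
      assert (EW := f_equal (fun F : ser => F b x) (sum_curl i l j Hi Hl Hj)).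
      cbv beta in EW. fold W in EW. unfold sD at 7 in EW. rewrite <- EW.
      unfold sadd. rewrite !sconst_smul. unfold ssub, sD, T.
      rewrite (pd_comm K i l HK), (pd_comm K j i HK), (pd_comm K l j HK). ring. }
  rewrite (circle_int_pt_differences (T i j l) (T j i l) (T j l i) (T l j i) (T l i j)
      (T i l j)) in E
    by trivial.
  pose proof (EA i j l Hl) as E1. pose proof (EA j l i Hi) as E2. pose proof (EA l i j Hj) as E3.
  pose proof (EA j i l Hl) as E4. pose proof (EA l j i Hi) as E5. pose proof (EA i l j Hj) as E6.
  pose proof (EN i j l Hi Hj) as N1. pose proof (EN j l i Hj Hl) as N2.
  pose proof (EN l i j Hl Hi) as N3.
  change (pd l (A i j) q + pd i (A j l) q + pd j (A l i) q = 0).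
  lra.
Qed.

End Closed.

(** A form with constant coefficients on a space of functions: integration by parts writes each
    derivative as a difference of two integrals of the same shape, and the cyclic sum telescopes. *)
Lemma closed_basic x i j l : smooth_pt x -> periodic_pt x ->
  (i < 3)%nat -> (j < 3)%nat -> (l < 3)%nat -> forall q,
  pd l (circle_int_pt (fun q => pd 3 (pd i x) q * pd j x q)) q
  + pd i (circle_int_pt (fun q => pd 3 (pd j x) q * pd l x q)) q
  + pd j (circle_int_pt (fun q => pd 3 (pd l x) q * pd i x q)) q = 0.
Proof.
  intros Hx Px Hi Hj Hl q.
  assert (S : forall a, smooth_pt (pd a x)) by (intros a; now apply smooth_pd).
  assert (S' : forall a, smooth_pt (pd 3 (pd a x))) by (intros a; now apply smooth_pd).
  assert (E : forall a b c, (a < 3)%nat -> (b < 3)%nat -> (c < 3)%nat ->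
    pd c (circle_int_pt (fun q => pd 3 (pd a x) q * pd b x q)) q =
    circle_int_pt (fun q => pd a (pd 3 x) q * pd c (pd b x) q) q
    - circle_int_pt (fun q => pd b (pd 3 x) q * pd a (pd c x) q) q).
  { intros a b c Ha Hb Hc.
    assert (Sab : smooth_pt (fun q => pd a (pd 3 x) q * pd c (pd b x) q)).
    { apply smooth_mult; now repeat apply smooth_pd. }
    assert (Sba : smooth_pt (fun q => pd b (pd 3 x) q * pd a (pd c x) q)).
    { apply smooth_mult; now repeat apply smooth_pd. }
    assert (Sw : smooth_pt (fun q => pd c (pd a x) q * pd b x q)).
    { apply smooth_mult; now repeat apply smooth_pd. }
    rewrite pd_circ by (try apply smooth_mult; auto).
    rewrite pd_mult by auto.
    pose proof (smooth_pd _ 3 Sw) as Sw3.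
    pose proof (smooth_minus _ _ Sab Sba) as Sd.
    replace (fun q => pd c (pd 3 (pd a x)) q * pd b x q + pd 3 (pd a x) q * pd c (pd b x) q)
      with (fun q => pd 3 (fun q => pd c (pd a x) q * pd b x q) q
         + (pd a (pd 3 x) q * pd c (pd b x) q - pd b (pd 3 x) q * pd a (pd c x) q)).
    - rewrite (circle_int_pt_plus _ _ Sw3 Sd), (circle_int_pt_minus _ _ Sab Sba), circle_int_pt_pd3.
      + ring.
      + exact Sw.
      + intros u s. now rewrite (periodic_pd _ _ (periodic_pd _ _ Px)), (periodic_pd _ _ Px).
    - extensionality y. rewrite pd_mult by (now repeat apply smooth_pd).
      rewrite (pd_comm (pd a x) 3 c) by auto.
      rewrite (pd_comm x 3 a), (pd_comm x 3 b), (pd_comm x c a) by assumption. ring. }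
  rewrite !E by assumption.
  rewrite (pd_comm x i l), (pd_comm x j i), (pd_comm x l j) by assumption. ring.
Qed.

(** * Chains depending smoothly on parameters *)

Section PlotChain.
Variable K : pt -> R.
Variables P0 M0 : pt -> R.
Hypothesis HK : smooth_pt K.
Hypothesis HP0 : smooth_pt P0.
Hypothesis HM0 : smooth_pt M0.
Hypothesis E0 : pd 3 P0 = fun q => K q * M0 q.

(** Starting every new primitive at arc length 0 fixes integration constants for which the chain is
    smooth in the parameters. Periodicity is a separate matter and comes from [chain_of_periodic] on
    plots in a level set. *)
Fixpoint pt_chain (a : nat) : (pt -> R) * (pt -> R) :=
  match a with
  | O => (P0, M0)
  | S a' =>
      let m := fun q => / 2 * pd 3 (fun q => pd 3 (snd (pt_chain a')) q
          + K q * fst (pt_chain a') q) q in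
      (prim_pt (fun q => K q * m q), m)
  end.

Definition pt_p a : pt -> R := fst (pt_chain a).
Definition pt_m a : pt -> R := snd (pt_chain a).
Definition pt_f a : pt -> R := fun q => pd 3 (pt_m a) q + K q * pt_p a q.

Lemma smooth_pt_pm a : smooth_pt (pt_p a) /\ smooth_pt (pt_m a).
Proof.
  induction a as [|a [IH1 IH2]]; [now split|].
  assert (H : smooth_pt (pt_m (S a))).
  { apply (smooth_scal (/ 2) (pd 3 (pt_f a))). apply smooth_pd.
    apply (smooth_plus (pd 3 (pt_m a))); [now apply smooth_pd | now apply smooth_mult]. }
  split; [|exact H]. apply (smooth_prim (fun q => K q * pt_m (S a) q)). now apply smooth_mult.
Qed.

Lemma smooth_pt_f a : smooth_pt (pt_f a).
Proof.
  destruct (smooth_pt_pm a) as [H1 H2].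
  apply (smooth_plus (pd 3 (pt_m a))); [now apply smooth_pd | now apply smooth_mult].
Qed.

Lemma pd3_pt_p a : pd 3 (pt_p a) = fun q => K q * pt_m a q.
Proof.
  destruct a as [|a]; [exact E0|].
  apply (pd3_prim (fun q => K q * pt_m (S a) q)).
  apply smooth_mult; [exact HK | apply smooth_pt_pm].
Qed.

Lemma pd3_pt_f a q : pd 3 (pt_f a) q = 2 * pt_m (S a) q.
Proof. change (pt_m (S a) q) with (/ 2 * pd 3 (pt_f a) q). field. Qed.

Lemma slice_chain u (k : R -> R) : (forall s, k s = K (u, s)) ->
  chain k (fun a s => pt_p a (u, s)) (fun a s => pt_m a (u, s)) (fun a s => pt_f a (u, s)).
Proof.
  intros Ek a. destruct (smooth_pt_pm a) as [H1 H2].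
  split; [|split; [|split]].
  - repeat split.
    + now apply smooth1_slice.
    + now apply smooth1_slice.
    + now apply smooth1_slice, smooth_pt_f.
  - intros s. now rewrite Derive_slice, pd3_pt_p, Ek.
  - intros s. rewrite Derive_slice, Ek. unfold pt_f. ring.
  - intros s. rewrite Derive_slice. apply pd3_pt_f.
Qed.

End PlotChain.

(** * Pullbacks of the forms to three parameters *)

Section Plot.
Variable h : nat -> dpoly.
Hypothesis Hh : mkdv_densities h.
Variable c : nat -> R.
Variable M : nat.
Variable a : constants.
Variable G : pt -> C.
Hypothesis HG : plot (level h c M) G.

Let Gx : pt -> R := fun p => fst (G p).
Let Gy : pt -> R := fun p => snd (G p).
Let K : pt -> R := curvature_pt G.
Let lamP (i : nat) : pt -> R := fun q => pd i Gx q * pd 3 Gx q + pd i Gy q * pd 3 Gy q.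
Let muP (i : nat) : pt -> R := fun q => pd i Gy q * pd 3 Gx q - pd i Gx q * pd 3 Gy q.
Let curve (u : R * R * R) : R -> C := fun s => G (u, s).
Let P (i n : nat) : pt -> R := pt_p K (lamP i) (muP i) n.
Let Mu (i n : nat) : pt -> R := pt_m K (lamP i) (muP i) n.
Let F (i n : nat) : pt -> R := pt_f K (lamP i) (muP i) n.

Lemma plot_Gx : smooth_pt Gx. Proof. apply HG. Qed.
Lemma plot_Gy : smooth_pt Gy. Proof. apply HG. Qed.
Lemma plot_Mhat u : Mhat (curve u). Proof. apply (proj2 (proj2 HG) u). Qed.
Lemma plot_periodic u s : G (u, s + 2 * PI) = G (u, s).
Proof. apply (proj2 (proj1 (plot_Mhat u)) s). Qed.
Lemma plot_K : smooth_pt K.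
Proof. exact (smooth_curvature_pt G plot_Gx plot_Gy). Qed.

Lemma plot_tangent i u : (i < 3)%nat -> tangent_level h M (curve u) (velocity G i u).
Proof. intros Hi. now apply (velocity_tangent_level h c M G u i). Qed.

Lemma smooth_lamP i : smooth_pt (lamP i).
Proof.
  pose proof plot_Gx. pose proof plot_Gy.
  apply smooth_plus; apply smooth_mult; now apply smooth_pd.
Qed.

Lemma smooth_muP i : smooth_pt (muP i).
Proof.
  pose proof plot_Gx. pose proof plot_Gy.
  apply smooth_minus; apply smooth_mult; now apply smooth_pd.
Qed.

Lemma lam_velocity i u s : lam (curve u) (velocity G i u) s = lamP i (u, s).
Proof. rewrite lam_coord. unfold lamP. now rewrite <- !(Derive_slice _ u s). Qed.

Lemma mu_velocity i u s : mu (curve u) (velocity G i u) s = muP i (u, s).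
Proof. rewrite mu_coord. unfold muP. now rewrite <- !(Derive_slice _ u s). Qed.

Lemma pd3_lamP i : (i < 3)%nat -> pd 3 (lamP i) = fun q => K q * muP i q.
Proof.
  intros Hi. extensionality q. destruct q as [u s].
  rewrite <- Derive_slice, <- mu_velocity, <- (Derive_ext _ _ s (lam_velocity i u)).
  rewrite (proj2 (proj1 (plot_tangent i u Hi)) s). f_equal. apply curvature_family.
Qed.

Lemma velocity_chain i u : (i < 3)%nat -> chain_of (curve u) (velocity G i u)
  (fun n s => P i n (u, s)) (fun n s => Mu i n (u, s)) (fun n s => F i n (u, s)).
Proof.
  intros Hi. split; [|split].
  - apply slice_chain.
    + exact plot_K.
    + apply smooth_lamP.
    + apply smooth_muP.
    + now apply pd3_lamP.
    + intros s. apply curvature_family.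
  - intros s. symmetry. apply lam_velocity.
  - intros s. symmetry. apply mu_velocity.
Qed.

Lemma smooth_chain_at i n : smooth_pt (P i n) /\ smooth_pt (Mu i n).
Proof. apply smooth_pt_pm; [exact plot_K | apply smooth_lamP | apply smooth_muP]. Qed.

Lemma smooth_F i n : smooth_pt (F i n).
Proof. apply smooth_pt_f; [exact plot_K | apply smooth_lamP | apply smooth_muP]. Qed.

Lemma pd3_F i n q : pd 3 (F i n) q = 2 * Mu i (S n) q.
Proof. apply pd3_pt_f. Qed.

Lemma periodic_chain_at i n : (i < 3)%nat -> (n <= M)%nat ->
  periodic_pt (P i n) /\ periodic_pt (Mu i n).
Proof.
  intros Hi Hn.
  assert (H : forall u, smooth_periodic (fun s => P i n (u, s)) /\ smooth_periodic (fun s => Mu i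
      n (u, s))).
  { intros u. exact (chain_of_periodic h Hh M (curve u) (velocity G i u) _ _ _
      (plot_Mhat u) (plot_tangent i u Hi) (velocity_chain i u Hi) n Hn). }
  split; intros u s.
  - exact (proj2 (proj1 (H u)) s).
  - exact (proj2 (proj2 (H u)) s).
Qed.

Lemma periodic_K : periodic_pt K.
Proof. apply (periodic_curvature_pt G plot_periodic). Qed.

Lemma periodic_F i n : (i < 3)%nat -> (n <= M)%nat -> periodic_pt (F i n).
Proof.
  intros Hi Hn. destruct (periodic_chain_at i n Hi Hn) as [H1 H2]. intros u s.
  change (pd 3 (Mu i n) (u, s + 2 * PI) + K (u, s + 2 * PI) * P i n (u, s + 2 * PI)
    = pd 3 (Mu i n) (u, s) + K (u, s) * P i n (u, s)).
  now rewrite (periodic_pd _ 3 H2), periodic_K, H1.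
Qed.

Lemma F0_phi i u s : (i < 3)%nat -> F i 0 (u, s) = phi (curve u) (velocity G i u) s.
Proof.
  intros Hi. exact (chain_of_f _ _ _ _ _ s (plot_Mhat u)
    (proj1 (proj1 (plot_tangent i u Hi))) (velocity_chain i u Hi)).
Qed.

Lemma pd3_F0 i : (i < 3)%nat -> pd 3 (F i 0) = pd i K.
Proof.
  intros Hi. extensionality q. destruct q as [u s].
  unfold K. rewrite (pd_curvature_pt G plot_Gx plot_Gy i u s (plot_Mhat u)
    (proj1 (plot_tangent i u Hi))).
  rewrite <- Derive_slice. apply Derive_ext. intros t. now apply F0_phi.
Qed.

Lemma pullback_circ k i j : (k <= M + 1)%nat -> (i < 3)%nat -> (j < 3)%nat ->
  pullback (omegahat a k) G i j = circle_int_pt (fun q => F i 0 q * Mu j k q).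
Proof.
  intros Hk Hi Hj. extensionality q. destruct q as [u s].
  change (fst (omegahat a k (curve u) (velocity G i u) (velocity G j u))
    = circle_int_pt (fun q => F i 0 q * Mu j k q) (u, s)).
  rewrite (omegahat_chain h Hh a k M (curve u) (velocity G i u) (velocity G j u) _ _ _
    (plot_Mhat u) (plot_tangent i u Hi) (plot_tangent j u Hj) (velocity_chain j u Hj) Hk).
  unfold circle_int_pt, circle_int, RtoC. cbn [fst]. apply RInt_ext. intros t _. now rewrite F0_phi.
Qed.

Lemma pullback_smooth k i j : (k <= M + 1)%nat -> (i < 3)%nat -> (j < 3)%nat ->
  smooth_pt (pullback (omegahat a k) G i j).
Proof.
  intros Hk Hi Hj. rewrite pullback_circ by assumption.
  apply smooth_circ, smooth_mult; [apply smooth_F | apply smooth_chain_at].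
Qed.

Lemma pullback_0 i j : (i < 3)%nat -> (j < 3)%nat -> pullback (omegahat a 0) G i j =
  fun q => circle_int_pt (fun q => pd 3 (pd i Gx) q * pd j Gx q) q
         + circle_int_pt (fun q => pd 3 (pd i Gy) q * pd j Gy q) q.
Proof.
  intros Hi Hj. pose proof plot_Gx. pose proof plot_Gy.
  rewrite <- circle_int_pt_plus by (apply smooth_mult; now repeat apply smooth_pd).
  extensionality q. destruct q as [u s]. unfold pullback, circle_int_pt. cbn [fst omegahat RtoC].
  apply RInt_ext. intros t _.
  change (dot (Derive (fun t => pd i Gx (u, t)) t, Derive (fun t => pd i Gy (u, t)) t)
    (pd j Gx (u, t), pd j Gy (u, t)) = pd 3 (pd i Gx) (u, t) * pd j Gx (u, t)
    + pd 3 (pd i Gy) (u, t) * pd j Gy (u, t)).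
  now rewrite !Derive_slice.
Qed.

(** Up to the factor [/ 2], the constant-coefficient form of index 0 with the tangent in place of
    the curve and the two arguments exchanged. *)
Lemma pullback_1 i j : (i < 3)%nat -> (j < 3)%nat -> pullback (omegahat a 1) G i j =
  fun q => / 2 * (circle_int_pt (fun q => pd 3 (pd j (pd 3 Gx)) q * pd i (pd 3 Gx) q) q
         + circle_int_pt (fun q => pd 3 (pd j (pd 3 Gy)) q * pd i (pd 3 Gy) q) q).
Proof.
  intros Hi Hj. pose proof plot_Gx as HGx. pose proof plot_Gy as HGy.
  assert (S1 : smooth_pt (fun q => pd 3 (pd j (pd 3 Gx)) q * pd i (pd 3 Gx) q))
    by (apply smooth_mult; now repeat apply smooth_pd).
  assert (S2 : smooth_pt (fun q => pd 3 (pd j (pd 3 Gy)) q * pd i (pd 3 Gy) q))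
    by (apply smooth_mult; now repeat apply smooth_pd).
  pose proof (circle_int_pt_plus _ _ S1 S2) as EC.
  extensionality q. rewrite <- (f_equal (fun f : pt -> R => f q) EC).
  destruct q as [u s]. unfold pullback, circle_int_pt. cbn [fst omegahat RtoC].
  f_equal. apply RInt_ext. intros t _.
  change (dot (Derive (fun t => pd i Gx (u, t)) t, Derive (fun t => pd i Gy (u, t)) t)
    (Derive (Derive (fun t => pd j Gx (u, t))) t, Derive (Derive (fun t => pd j Gy (u, t))) t)
    = pd 3 (pd j (pd 3 Gx)) (u, t) * pd i (pd 3 Gx) (u, t)
    + pd 3 (pd j (pd 3 Gy)) (u, t) * pd i (pd 3 Gy) (u, t)).
  assert (E2 : forall f : pt -> R, Derive (Derive (fun t => f (u, t))) t = pd 3 (pd 3 f) (u, t)).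
  { intros f. rewrite <- (Derive_slice (pd 3 f)). apply Derive_ext. intros r. apply Derive_slice. }
  rewrite !E2, !Derive_slice.
  rewrite (pd_comm Gx 3 i), (pd_comm Gy 3 i), (pd_comm Gx 3 j), (pd_comm Gy 3 j) by assumption.
  unfold dot. cbn [fst snd]. ring.
Qed.

(** [Mu j (S (S b))] is half the derivative of [F j (S b)]. Moving that derivative onto [F i 0]
    lowers the index into the range where whole chains are periodic and produces [pd i K], a
    gradient in the parameters. *)
Lemma pullback_high b i j : (S (S b) <= M + 1)%nat -> (i < 3)%nat -> (j < 3)%nat ->
  pullback (omegahat a (S (S b))) G i j =
  fun q => - / 2 * circle_int_pt (fun q => pd i K q * F j (S b) q) q.
Proof.
  intros Hk Hi Hj. rewrite pullback_circ by assumption.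
  pose proof (smooth_F i 0) as S1. pose proof (smooth_F j (S b)) as S2.
  assert (P1 : periodic_pt (F i 0)) by (apply periodic_F; lia).
  assert (P2 : periodic_pt (F j (S b))) by (apply periodic_F; lia).
  assert (S12 : smooth_pt (fun q => F i 0 q * F j (S b) q)) by now apply smooth_mult.
  assert (SK : smooth_pt (fun q => pd i K q * F j (S b) q)).
  { apply smooth_mult; [apply smooth_pd, plot_K | exact S2]. }
  assert (P12 : periodic_pt (fun q => F i 0 q * F j (S b) q)) by (intros u s; now rewrite P1, P2).
  assert (SM : smooth_pt (fun q => F i 0 q * Mu j (S (S b)) q)).
  { apply smooth_mult; [exact S1 | apply smooth_chain_at]. }
  assert (E : pd 3 (fun q => F i 0 q * F j (S b) q) =
    fun q => pd i K q * F j (S b) q + 2 * (F i 0 q * Mu j (S (S b)) q)).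
  { rewrite pd_mult, pd3_F0 by assumption. extensionality q.
    rewrite pd3_F. ring. }
  pose proof (circle_int_pt_pd3 _ S12 P12) as EC. rewrite E in EC.
  pose proof (smooth_scal 2 _ SM) as SM2.
  rewrite (circle_int_pt_plus _ _ SK SM2) in EC. extensionality q.
  assert (E2 : circle_int_pt (fun q => 2 * (F i 0 q * Mu j (S (S b)) q)) q
    = 2 * circle_int_pt (fun q => F i 0 q * Mu j (S (S b)) q) q).
  { exact (RInt_scal (V:=R_CompleteNormedModule) _ _ _ 2 (ex_RInt_slice _ (fst q) _ _ SM)). }
  pose proof (f_equal (fun f : pt -> R => f q) EC) as EQ. cbv beta in EQ. rewrite E2 in EQ. lra.
Qed.

Lemma pullback_antisym k i j : (k <= M + 1)%nat -> (i < 3)%nat -> (j < 3)%nat ->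
  forall q, pullback (omegahat a k) G i j q = - pullback (omegahat a k) G j i q.
Proof.
  intros Hk Hi Hj [u s].
  change (fst (omegahat a k (curve u) (velocity G i u) (velocity G j u))
    = - fst (omegahat a k (curve u) (velocity G j u) (velocity G i u))).
  rewrite (omegahat_antisym h Hh a k M (curve u) (velocity G j u) (velocity G i u)
    (plot_Mhat u) (plot_tangent j u Hj) (plot_tangent i u Hi) Hk).
  reflexivity.
Qed.

Lemma pullback_closed k i j l : (k <= M + 1)%nat -> (i < 3)%nat -> (j < 3)%nat -> (l < 3)%nat ->
  forall q, pd l (pullback (omegahat a k) G i j) q + pd i (pullback (omegahat a k) G j l) q
    + pd j (pullback (omegahat a k) G l i) q = 0.
Proof.
  intros Hk Hi Hj Hl q. pose proof plot_Gx as HGx. pose proof plot_Gy as HGy.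
  assert (PGx : periodic_pt Gx) by exact (periodic_Gx G plot_periodic).
  assert (PGy : periodic_pt Gy) by exact (periodic_Gy G plot_periodic).
  destruct k as [|[|b]].
  - rewrite !pullback_0 by assumption.
    assert (SC : forall x y (f : pt -> R), smooth_pt f ->
      smooth_pt (circle_int_pt (fun q => pd 3 (pd x f) q * pd y f q))).
    { intros x y f Hf. apply smooth_circ, smooth_mult; now repeat apply smooth_pd. }
    rewrite !pd_plus by auto.
    pose proof (closed_basic Gx i j l HGx PGx Hi Hj Hl q).
    pose proof (closed_basic Gy i j l HGy PGy Hi Hj Hl q). lra.
  - rewrite !pullback_1 by assumption.
    assert (SC : forall x y (f : pt -> R), smooth_pt f ->
      smooth_pt (circle_int_pt (fun q => pd 3 (pd x (pd 3 f)) q * pd y (pd 3 f) q))).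
    { intros x y f Hf. apply smooth_circ, smooth_mult; now repeat apply smooth_pd. }
    rewrite !pd_scal, !pd_plus by auto.
    pose proof (closed_basic (pd 3 Gx) j i l (smooth_pd _ 3 HGx) (periodic_pd _ 3 PGx) Hj Hi Hl q).
    pose proof (closed_basic (pd 3 Gy) j i l (smooth_pd _ 3 HGy) (periodic_pd _ 3 PGy) Hj Hi Hl q).
    lra.
  - rewrite !pullback_high by assumption. rewrite !pd_scal.
    assert (H : forall x y, (x < 3)%nat -> (y < 3)%nat ->
      circle_int_pt (fun q => pd x K q * F y (S b) q) =
          fun q => - circle_int_pt (fun q => pd y K q * F x (S b) q) q).
    { intros x y Hx Hy. extensionality r.
      pose proof (pullback_antisym (S (S b)) x y Hk Hx Hy r) as E.
      rewrite !pullback_high in E by assumption. lra. }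
    assert (SP : forall x n, smooth_pt (P x n)) by (intros x n; apply smooth_chain_at).
    assert (SMu : forall x n, smooth_pt (Mu x n)) by (intros x n; apply smooth_chain_at).
    (* The series start at index 1; the omitted member enters through [pd 3 (F x 0) = pd x K], which
       becomes the inhomogeneity. The form in question is then read off at coefficient [b], and only
       indices up to [b + 1 <= M] occur. *)
    pose proof (closed_high K plot_K (fun x n => P x (S n)) (fun x n => Mu x (S n))
      (fun x n => F x (S n)) (fun x n => SP x (S n)) (fun x n => SMu x (S n))
      (fun x n => smooth_F x (S n))) as CH.
    cut (pd l (circle_int_pt (fun q => pd i K q * F j (S b) q)) q
      + pd i (circle_int_pt (fun q => pd j K q * F l (S b) q)) q
      + pd j (circle_int_pt (fun q => pd l K q * F i (S b) q)) q = 0); [intros E; lra|].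
    apply CH; trivial.
    + intros x Hx. extensionality n. extensionality r. rewrite sconst_smul.
      unfold sD, P. rewrite pd3_pt_p; [reflexivity | exact plot_K | apply smooth_lamP
        | apply smooth_muP | now apply pd3_lamP].
    + intros x Hx. extensionality n. extensionality r. unfold ssub. rewrite sconst_smul.
      unfold sD. change (F x (S n) r) with (pd 3 (Mu x (S n)) r + K r * P x (S n) r). ring.
    + intros x Hx. extensionality n. extensionality r.
      assert (ET : (stwo * (fun n => Mu x (S n)))%ser n r = 2 * Mu x (S n) r).
      { replace stwo with (sconst (fun _ => 2));
          [exact (sconst_smul (fun _ => 2) (fun n => Mu x (S n)) n r)|].
        extensionality n'. extensionality r'. unfold stwo, sadd, sone, sconst.
        destruct n'; ring. }
      (* Coefficient 0 says [0 = 2 * Mu x 1 - pd x K]; the others are the chain recursion, shifted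
         by the factor [sz]. *)
      unfold ssub. rewrite ET. destruct n as [|n].
      * unfold smul, sconst; simpl. rewrite <- pd3_F0, pd3_F by assumption. ring.
      * rewrite smul_S. replace (fun a0 => sz (S a0)) with sone.
        { change ((0 * sD 3 (fun n => F x (S n)) (S n) r
            + (sone * sD 3 (fun n => F x (S n)))%ser n r) = 2 * Mu x (S (S n)) r - 0).
          unfold sone at 1. rewrite sconst_smul. unfold sD. cbv beta. rewrite !pd3_F. ring. }
        { extensionality n'. extensionality r'. destruct n'; reflexivity. }
    + intros x Hx n Hn. apply periodic_chain_at; lia.
    + intros x Hx n Hn. apply periodic_chain_at; lia.
    + intros x Hx n Hn. apply periodic_F; lia.
Qed.

End Plot.

Theorem theorem14 :
  forall (h : nat -> dpoly) (c : nat -> R) (m : nat) (a : constants),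
    mkdv_densities h ->
    (1 <= m)%nat ->
    (exists g : R -> C, level h c m g) ->
    (forall k : nat, (k <= m + 1)%nat ->
       presymplectic (level h c m) (tangent_level h m) (omegahat a k)) /\
    (forall n k : nat, (1 <= n)%nat -> (k <= m + 1)%nat ->
       hamiltonian_for (level h c m) (tangent_level h m)
         (omegahat a k) (dHhat (h (n + k)%nat)) (Xhat n)).
Proof.
  intros h c m a Hh _ _. split.
  - intros k Hk. split; [|split; [|split]].
    + intros g X Y [HM _] TX TY.
      destruct (chain_of_exists g Y HM (proj1 TY)) as (p & mm & f & CY).
      now rewrite (omegahat_chain h Hh a k m g X Y p mm f HM TX TY CY Hk).
    + intros g X X' Y r [HM _] TX TX' TY. now apply (omegahat_linear h Hh a k m).
    + intros g X Y [HM _] TX TY. now apply (omegahat_antisym h Hh a k m).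
    + intros G HG. split.
      * intros i j Hi Hj. now apply (pullback_smooth h Hh c m a G HG).
      * intros p. rewrite <- (pullback_closed h Hh c m a G HG k 1 2 0 Hk) with (q := p) by lia.
        ring.
  - intros n k Hn Hk. split.
    + intros g [HM _]. now apply tangent_level_Xhat.
    + intros g Y [HM _] TY. now apply (omegahat_Xhat h Hh a k m).
Qed.
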